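(* Let $\beta\in B$. For every $a\in\mathbb R^d$ with $J_\beta(a)$ finite and $\Theta_{F(a),\beta}\neq\emptyset$, there exists a ($\mu$-a.e.) unique $\mathcal Z$-measurable function $\tilde g_a$ such that $$H_\beta(g)=J_\beta(a)+B_\beta(g,\tilde g_a)+C_\beta(g),\qquad g\in\mathcal G_a^+.$$ This function $\tilde g_a$ equals the effective solution $g^*_{F(a),a}$ of the $F(a)$-dual problem for $a$.
   Context: Setting. $(Z,\mathcal Z)$ is a measurable space with a $\sigma$-finite measure $\mu$, and $\varphi\colon Z\to\mathbb R^d$ is $\mathcal Z$-measurable (the moment mapping). $\Gamma$ is the class of functions $\gamma\colon\mathbb R\to(-\infty,+\infty]$ that are finite and strictly convex on $(0,+\infty)$, equal to $+\infty$ for $t<0$, and satisfy $\gamma(0)=\lim_{t\downarrow0}\gamma(t)$. For $\gamma\in\Gamma$, $\gamma'_\pm(t)$ are the right/left derivatives at $t>0$, $\gamma'_-(0)=-\infty$, $\gamma'_+(0)=\lim_{t\downarrow0}\gamma'_+(t)$. $B$ is the class of functions $\beta\colon Z\times\mathbb R\to(-\infty,+\infty]$ such that $\beta(\cdot,t)$ is $\mathcal Z$-measurable for each $t$ and $\beta(z,\cdot)\in\Gamma$ for each $z$; $\beta'_\pm(z,t)$ refer to $\beta(z,\cdot)$. $\mathrm{sgn}(r)$ is the symbol $+$ if $r\ge0$ and $-$ if $r<0$. Convention: an integral whose positive and negative parts are both infinite equals $+\infty$. $\mathcal G$ is the linear space of $\mathcal Z$-measurable $g\colon Z\to\mathbb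 R$ with $\varphi g$ $\mu$-integrable; $\mathcal G_a=\{g\in\mathcal G\colon\int_Z\varphi g\,d\mu=a\}$; the superscript $+$ denotes the subset of nonnegative functions. $H_\beta(g)=\int_Z\beta(z,g(z))\,\mu(dz)$, $J_\beta(a)=\inf_{g\in\mathcal G_a^+}H_\beta(g)$ ($\inf\emptyset=+\infty$). $\beta^*(z,r)=\sup_t[rt-\beta(z,t)]$, and $(\beta^* )'(z,\cdot)$ is its derivative in $r$. Bregman distance. For $\gamma\in\Gamma$ and $s,t\ge0$ let $\Delta_\gamma(s,t)=\gamma(s)-\gamma(t)-\gamma'_{\mathrm{sgn}(s-t)}(t)[s-t]$ if $\gamma'_+(t)$ is finite, and $\Delta_\gamma(s,0)=s\cdot(+\infty)$ otherwise (with $0\cdot\infty=0$); $\Delta_\gamma(s,t)=+\infty$ if $s<0$ or $t<0$. For $\mathcal Z$-measurable $g,h$: $B_\beta(g,h)=\int_Z\Delta_{\beta(z,\cdot)}(g(z),h(z))\,\mu(dz)$. Faces. $\mathrm{cn}_\varphi(\mu)=\{\int_Z\varphi g\,d\mu\colon g\in\mathcal G^+\}$. A face of a convex set $C\subseteq\mathbb R^d$ is a nonempty convex $F\subseteq C$ such that every closed line segment in $C$ with a relative interior point in $F$ lies in $F$. For $a\in\mathrm{cn}_\varphi(\mu)$, $F(a)$ is the unique face of $\mathrm{cn}_\varphi(\mu)$ whose relative interior contains $a$ (finiteness of $J_\beta(a)$ implies $a\in\mathrm{cn}_\varphi(\mu)$). $\mathrm{cl}$ is closure. $F$-dual problem,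 for a face $F$ of $\mathrm{cn}_\varphi(\mu)$. $K_{F,\beta}(\vartheta)=\int_{\{\varphi\in\mathrm{cl}(F)\}}\beta^*(z,\langle\vartheta,\varphi(z)\rangle)\,\mu(dz)$, $K^*_{F,\beta}(a)=\sup_{\vartheta\in\mathbb R^d}[\langle\vartheta,a\rangle-K_{F,\beta}(\vartheta)]$; if this is finite, its maximizers are the $F$-dual solutions for $a$. $\Theta_{F,\beta}$ is the set of $\vartheta$ with $K_{F,\beta}(\vartheta)<+\infty$ such that for $\mu$-a.a. $z$ with $\varphi(z)\in\mathrm{cl}(F)$ the function $r\mapsto\beta^*(z,r)$ is finite in a neighborhood of $\langle\vartheta,\varphi(z)\rangle$. For $\vartheta\in\Theta_{F,\beta}$, $f_{F,\vartheta}(z)=(\beta^* )'(z,\langle\vartheta,\varphi(z)\rangle)$ if $\varphi(z)\in\mathrm{cl}(F)$ and the derivative exists, and $f_{F,\vartheta}(z)=0$ otherwise. If $\Theta_{F,\beta}\ne\emptyset$ and $F$-dual solutions for $a$ exist, each belongs to $\Theta_{F,\beta}$ and all give $\mu$-a.e. the same $f_{F,\vartheta}$, called the effective $F$-dual solution $g^*_{F,a}$. (If $J_\beta(a)$ is finite then $F(a)$-dual solutions for $a$ exist.) Correction functional. For $\vartheta\in\Theta_{F,\beta}$ and $\mathcal Z$-measurable $g\ge0$, $$D_{F,\beta}^\vartheta(g)=\int_{\{\varphi\in\mathrm{cl}(F)\}}\big[\beta'_{\mathrm{sgn}(g(z)-f_{F,\vartheta}(z))}(z,f_{F,\vartheta}(z))-\langle\vartheta,\varphi(z)\rangle\big]\,[g(z)-f_{F,\vartheta}(z)]\,\mu(dz),$$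 with nonnegative integrand $\mu$-a.e. For $g\in\mathcal G_a^+$ with $J_\beta(a)$ finite and $\Theta_{F(a),\beta}\ne\emptyset$, $C_\beta(g)=D^\vartheta_{F(a),\beta}(g)$, where $\vartheta\in\Theta_{F(a),\beta}$ is any $F(a)$-dual solution for $a$ (the value does not depend on the choice). *)

(* Defs.v *)
(* R^n is 'rV[R]_n, with n arbitrary (n = 0 is not excluded). *)
From HB Require Import structures.
From mathcomp Require Export all_boot all_order all_algebra.
From mathcomp Require Export all_classical all_reals all_analysis.
From mathcomp Require Export measurable_realfun.

Set Implicit Arguments.
Unset Strict Implicit.
Unset Printing Implicit Defensive.

Import Order.TTheory GRing.Theory Num.Theory.
Import numFieldNormedType.Exports.

Local Open Scope classical_set_scope.
Local Open Scope ring_scope.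

Section integrands.
Context {R : realType}.
Implicit Types (gamma : R -> \bar R) (s t r : R).

(* The class Gamma; the value -oo is excluded explicitly since \bar R has it. *)
Definition is_Gamma gamma : Prop :=
  [/\ forall t, gamma t != -oo%E,
      forall t, 0 < t -> gamma t \is a fin_num,
      forall s t (l : R), 0 < s -> 0 < t -> s != t -> 0 < l -> l < 1 ->
        (gamma ((1 - l) * s + l * t)%R
           < (1 - l)%:E * gamma s + l%:E * gamma t)%E,
      forall t, t < 0 -> gamma t = +oo%E &
      gamma t @[t --> 0^'+] --> gamma 0].

(* Used at t > 0 only: there gamma is finite, so that fine loses nothing. *)
Definition right_quotient_lim gamma t : R :=
  lim (h^-1 * (fine (gamma (t + h)) - fine (gamma t)) @[h --> 0^'+]).

Definition left_quotient_lim gamma t : R :=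
  lim (h^-1 * (fine (gamma (t + h)) - fine (gamma t)) @[h --> 0^'-]).

(* Used at t >= 0 only.  The right derivative at 0 is by definition the limit of
   the right derivatives, possibly -oo. *)
Definition rderiv gamma t : \bar R :=
  if 0 < t then (right_quotient_lim gamma t)%:E
  else lim ((right_quotient_lim gamma u)%:E @[u --> 0^'+]).

Definition lderiv gamma t : \bar R :=
  if 0 < t then (left_quotient_lim gamma t)%:E else -oo%E.

(* sgn_deriv gamma r t is gamma'_{sgn r}(t), where sgn 0 is +. *)
Definition sgn_deriv gamma r t : \bar R :=
  if 0 <= r then rderiv gamma t else lderiv gamma t.

(* In the last branch t = 0; in \bar R, 0 * +oo = 0 as required. *)
Definition bregman_integrand gamma s t : \bar R :=
  if (s < 0) || (t < 0) then +oo%E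
  else if rderiv gamma t \is a fin_num then
    (gamma s - gamma t - sgn_deriv gamma (s - t)%R t * (s - t)%:E)%E
  else (s%:E * +oo)%E.

Definition conjugate gamma r : \bar R :=
  ereal_sup (range (fun t => (r * t)%:E - gamma t)%E).

(* Differentiability at r of an extended real-valued function requires
   finiteness around r. *)
Definition ediff (f : R -> \bar R) r : Prop :=
  (\forall u \near r, f u \is a fin_num) /\ derivable (fine \o f) r 1.

End integrands.

Section convex_geometry.
Context {R : realType} {n : nat}.
Implicit Types (C F : set 'rV[R]_n) (x y : 'rV[R]_n).

Definition dot x y : R := \sum_(i < n) x 0 i * y 0 i.

Definition segment_point x y (t : R) : 'rV[R]_n := (1 - t) *: x + t *: y.

Definition affine_hull F : set 'rV[R]_n :=
  [set y | exists (k : nat) (w : 'I_k -> R) (x : 'I_k -> 'rV[R]_n),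
    [/\ \sum_i w i = 1, forall i, F (x i) & y = \sum_i w i *: x i]].

Definition relint F : set 'rV[R]_n :=
  [set x | F x /\ \forall y \near x, affine_hull F y -> F y].

Definition is_face C F : Prop :=
  [/\ F !=set0, @convex_set R 'rV[R]_n F, F `<=` C &
    forall x y,
      (forall s, 0 <= s <= 1 -> C (segment_point x y s)) ->
      (exists2 t, 0 < t < 1 & F (segment_point x y t)) ->
      forall s, 0 <= s <= 1 -> F (segment_point x y s)].

(* For C convex and a in C there is exactly one such face. *)
Definition face_at C (a : 'rV[R]_n) : set 'rV[R]_n :=
  xget set0 [set F | is_face C F /\ relint F a].

End convex_geometry.

Section entropy.
Context {d : measure_display} {Z : measurableType d} {R : realType}.
Variable mu : {sigma_finite_measure set Z -> \bar R}.

(* The library integral is the difference of the integrals of the positive and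
   negative parts, with +oo - +oo = -oo; here that difference is +oo. *)
Definition uintegral (D : set Z) (f : Z -> \bar R) : \bar R :=
  (if \int[mu]_(z in D) f^\+ z == +oo then +oo
   else \int[mu]_(z in D) f z)%E.

Context {n : nat}.
Variables (phi : Z -> 'rV[R]_n) (beta : Z -> R -> \bar R).
Implicit Types (g h : Z -> R) (a vt : 'rV[R]_n) (F : set 'rV[R]_n).

Definition moment_mapping : Prop :=
  forall i, measurable_fun setT (fun z => phi z 0 i).

Definition is_B : Prop :=
  (forall t, measurable_fun setT (beta ^~ t)) /\
  (forall z, is_Gamma (beta z)).

Definition G_space : set (Z -> R) :=
  [set g | measurable_fun setT g /\
    forall i, mu.-integrable setT (fun z => (phi z 0 i * g z)%:E)].

Definition moment g : 'rV[R]_n := \row_i \int[mu]_z (phi z 0 i * g z).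

Definition Gplus : set (Z -> R) :=
  [set g | G_space g /\ forall z, 0 <= g z].

Definition Gplus_at a : set (Z -> R) := [set g | Gplus g /\ moment g = a].

Definition H_functional g : \bar R := uintegral setT (fun z => beta z (g z)).

Definition J_value a : \bar R :=
  ereal_inf [set H_functional g | g in Gplus_at a].

Definition bregman_distance g h : \bar R :=
  uintegral setT (fun z => bregman_integrand (beta z) (g z) (h z)).

(* cn_phi(mu) *)
Definition phi_cone : set 'rV[R]_n := [set moment g | g in Gplus].

Definition face_of a : set 'rV[R]_n := face_at phi_cone a.

Definition on_face F : set Z := phi @^-1` closure F.

Definition K_dual F vt : \bar R :=
  uintegral (on_face F) (fun z => conjugate (beta z) (dot vt (phi z))).

Definition K_dual_conj F a : \bar R :=
  ereal_sup (range (fun vt => (dot vt a)%:E - K_dual F vt)%E).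

Definition dual_solution F a vt : Prop :=
  K_dual_conj F a \is a fin_num /\
  ((dot vt a)%:E - K_dual F vt)%E = K_dual_conj F a.

Definition Theta F : set 'rV[R]_n :=
  [set vt | (K_dual F vt < +oo)%E /\
    \forall z \ae mu, on_face F z ->
      \forall r \near dot vt (phi z), conjugate (beta z) r \is a fin_num].

Definition f_dual F vt (z : Z) : R :=
  if `[< on_face F z /\ ediff (conjugate (beta z)) (dot vt (phi z)) >]
  then derive1 (fine \o conjugate (beta z)) (dot vt (phi z)) else 0.

(* The effective solution is a class of functions modulo mu, hence a
   predicate: g represents the class common to all F-dual solutions. *)
Definition effective_dual_solution F a g : Prop :=
  (exists vt, dual_solution F a vt) /\
  (forall vt, dual_solution F a vt ->
     Theta F vt /\ g = f_dual F vt %[ae mu]).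

Definition D_correction F vt g : \bar R :=
  uintegral (on_face F) (fun z =>
    (sgn_deriv (beta z) (g z - f_dual F vt z)%R (f_dual F vt z)
      - (dot vt (phi z))%:E) * (g z - f_dual F vt z)%:E)%E.

(* The common value of D_correction over the F(a)-dual solutions in Theta.  The
   default is met only if there is no such common value; a nonnegative integrand
   never produces it. *)
Definition C_correction a g : \bar R :=
  xget -oo%E [set c |
    (exists vt, Theta (face_of a) vt /\ dual_solution (face_of a) a vt) /\
    (forall vt, Theta (face_of a) vt -> dual_solution (face_of a) a vt ->
       D_correction (face_of a) vt g = c)].

End entropy.

(* Main.v *)
(* Let T be the set where phi lies in the closure of F = F(a). As F is a face,
   every g in G_a^+ vanishes a.e. off T. Starting from g0 in G_a^+ of finite cost,
   one can move half-way towards any nonnegative competitor on a set where its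
   cost is bounded; hence the moments of finite-cost competitors span a dense
   cone in the span of F - a, which is then the whole span because a dense convex
   cone in a finite-dimensional space is everything. So the value function is
   finite around a relative to F, and a Hahn-Banach argument gives a supporting
   vector theta. Replacing a competitor on growing sets by better constants chosen
   from the positive rationals and passing to the limit monotonically shows that
   theta solves the F-dual problem without duality gap. Comparing one-sided
   directional derivatives shows that every dual solution belongs to Theta. At a
   dual solution the Fenchel-Young gap beta(z,g) + beta*(z,r) - r g,
   r = <theta, phi(z)>, is the sum of the Bregman distance of g to f_theta and of
   the integrand of the correction; integrating it gives the identity. If another
   h satisfies the identity, then a minimizing sequence converges to both f_theta
   and h in Bregman distance, and Fatou's lemma forces h = f_theta a.e. *)

(* The integrands need not be differentiable, [beta z 0] may be [+oo], the right derivative at 0 may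
   be [-oo], and each conjugate may be finite only on a half-line. Statements about one integrand
   are therefore phrased through [is_argmax]: that t attains the conjugate at r is all that the
   Fenchel-Young gap needs.

   Infinities must not be subtracted from each other. The gap is the sum of [beta z (g z)], which
   may fail to be integrable, and [dual_gap], which is integrable on T for every competitor, with an
   integral that depends only on the value of the problem. All competitors have the same cost off T,
   so the primal and the dual value differ by the constant [off_cost].

   Finite cost can only be enforced on truncations, so at first the moments are merely known to be
   dense; that a dense convex cone is everything takes the place of a constraint qualification.

   Measurable selections of maximizers are avoided: by right continuity the conjugate is a supremum
   over the positive rationals, the same countable set for every z. *)
Require Import Defs.
From mathcomp Require Import ring lra zify.

Set Implicit Arguments.
Unset Strict Implicit.
Unset Printing Implicit Defensive.

Import Order.TTheory GRing.Theory Num.Theory.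
Import numFieldNormedType.Exports.

Local Open Scope classical_set_scope.
Local Open Scope ring_scope.

(** * Strictly convex integrands *)

Section one_integrand.
Context {R : realType} {gamma : R -> \bar R}.
Hypothesis Gg : is_Gamma gamma.
Implicit Types (s t r x y z : R).

Local Notation c := (fine \o gamma).

Definition slope (f : R -> R) x y : R := (f y - f x) / (y - x).

Lemma integrandE t : 0 < t -> gamma t = (c t)%:E.
Proof. by case: Gg => _ fin _ _ _ t0 /=; rewrite fineK// fin. Qed.

(** Strict convexity with the denominators cleared, so that linear arithmetic applies; the slope
    comparisons below all come from it. *)
Lemma three_chord x y z : 0 < x -> x < y -> y < z ->
  (c y - c x) * (z - y) < (c z - c y) * (y - x).
Proof.
move=> x0 xy yz; case: Gg => _ fin cvx _ _.
have zx0 : 0 < z - x by rewrite subr_gt0 (lt_trans xy).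
pose l := (y - x) / (z - x).
have l0 : 0 < l by rewrite divr_gt0// subr_gt0.
have l1 : l < 1 by rewrite ltr_pdivrMr// mul1r; lra.
have z0 : 0 < z by lra.
have xz : x != z by rewrite lt_eqF// (lt_trans xy).
have := cvx x z l x0 z0 xz l0 l1.
have -> : (1 - l) * x + l * z = y by rewrite /l; field; rewrite gt_eqF.
rewrite !integrandE//; last by lra.
rewrite -!EFinM -EFinD lte_fin /= => H.
have H2 : (z - x) * (c y) < (z - y) * c x + (y - x) * c z.
  have -> : (z - y) * c x + (y - x) * c z = (z - x) * ((1 - l) * c x + l * c z).
    by rewrite /l; field; rewrite gt_eqF.
  by rewrite ltr_pM2l.
by rewrite /= in H2 *; lra.
Qed.

Lemma slope_lt x y z : 0 < x -> x < y -> y < z -> slope c x y < slope c y z.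
Proof.
move=> x0 xy yz; rewrite /slope ltr_pdivrMr ?subr_gt0// mulrAC ltr_pdivlMr ?subr_gt0//.
exact: three_chord.
Qed.

Lemma slope_ltr x y z : 0 < x -> x < y -> y < z -> slope c x y < slope c x z.
Proof.
move=> x0 xy yz; rewrite /slope ltr_pdivrMr ?subr_gt0// mulrAC ltr_pdivlMr ?subr_gt0//; last by lra.
by have := three_chord x0 xy yz; lra.
Qed.

Lemma slope_ltl x y z : 0 < x -> x < y -> y < z -> slope c x z < slope c y z.
Proof.
move=> x0 xy yz; rewrite /slope ltr_pdivrMr ?subr_gt0//; last by lra.
rewrite mulrAC ltr_pdivlMr ?subr_gt0//.
by have := three_chord x0 xy yz; lra.
Qed.

Lemma rquotE t h : h^-1 * (fine (gamma (t + h)) - fine (gamma t)) = slope c t (t + h).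
Proof. by rewrite /slope [t + h - t]addrC addKr mulrC. Qed.

Lemma lquotE t h : h^-1 * (fine (gamma (t + h)) - fine (gamma t)) = slope c (t + h) t.
Proof.
rewrite /slope opprD addrA subrr add0r invrN mulrN -mulNr opprB mulrC.
by [].
Qed.

(** The quotients are monotone in h, and a chord on the other side of t bounds them. *)
Lemma rquot_cvg t : 0 < t ->
  h^-1 * (fine (gamma (t + h)) - fine (gamma t)) @[h --> 0^'+]
    --> right_quotient_lim gamma t.
Proof.
move=> t0; apply: nondecreasing_at_right_is_cvgr.
  near=> e; move=> h k; rewrite !in_itv/= => /andP[h0 he] /andP[k0 ke] hk.
  rewrite !rquotE; move: hk; rewrite le_eqVlt => /predU1P[->//|hk].
  by apply/ltW/slope_ltr => //; lra.
near=> e; exists (slope c (t / 2) t) => _ [h + <-]; rewrite /= in_itv/= => /andP[h0 he].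
by rewrite rquotE; apply/ltW/slope_lt => //; lra.
Unshelve. all: by end_near. Qed.

Lemma lquot_cvg t : 0 < t ->
  h^-1 * (fine (gamma (t + h)) - fine (gamma t)) @[h --> 0^'-]
    --> left_quotient_lim gamma t.
Proof.
move=> t0; apply: nondecreasing_at_left_is_cvgr.
  near=> e; move=> h k; rewrite !in_itv/= => /andP[h0 he] /andP[k0 ke] hk.
  rewrite !lquotE; move: hk; rewrite le_eqVlt => /predU1P[->//|hk].
  have te : - t < e by near: e; apply: nbhs_left_gt; lra.
  by apply/ltW/slope_ltl => //; lra.
near=> e; exists (slope c t (t + 1)) => _ [h + <-]; rewrite /= in_itv/= => /andP[h0 he].
have te : - t < e by near: e; apply: nbhs_left_gt; lra.
by rewrite lquotE; apply/ltW/slope_lt; rewrite ?ltrDl//; lra.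
Unshelve. all: by end_near. Qed.

Local Notation Rd := (right_quotient_lim gamma).
Local Notation Ld := (left_quotient_lim gamma).

Lemma rquot_lim_lt t s : 0 < t -> t < s -> Rd t < slope c t s.
Proof.
(* The limit is compared with the slope up to the midpoint, which leaves a strict inequality up to
   s. *)
move=> t0 ts; pose m := (t + s) / 2.
have mt : t < m by rewrite /m; lra.
have ms : m < s by rewrite /m; lra.
apply: le_lt_trans (slope_ltr t0 mt ms).
apply: (ler_cvg_to (rquot_cvg t0) (cvg_cst (slope c t m))).
near=> h; rewrite /= rquotE; apply/ltW/slope_ltr => //.
  by rewrite ltrDl.
suff : h < m - t by lra.
by near: h; apply: nbhs_right_lt; lra.
Unshelve. all: by end_near. Qed.

Lemma rquot_lim_ge t r : 0 < t -> (forall s, t < s -> r <= slope c t s) -> r <= Rd t.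
Proof.
move=> t0 H; apply: (ler_cvg_to (cvg_cst r) (rquot_cvg t0)).
by near=> h; rewrite /= rquotE; apply: H; rewrite ltrDl.
Unshelve. all: by end_near. Qed.

Lemma lquot_lim_gt t s : 0 < s -> s < t -> slope c s t < Ld t.
Proof.
move=> s0 st; pose m := (s + t) / 2.
have mt : m < t by rewrite /m; lra.
have ms : s < m by rewrite /m; lra.
have t0 : 0 < t by lra.
apply: (lt_le_trans (slope_ltl s0 ms mt)).
apply: (ler_cvg_to (cvg_cst (slope c m t)) (lquot_cvg t0)).
near=> h; rewrite /= lquotE; apply/ltW/slope_ltl => //; first by lra.
  suff : m - t < h by lra.
  by near: h; apply: nbhs_left_gt; lra.
by rewrite gtrDl.
Unshelve. all: by end_near. Qed.

Lemma lquot_lim_le t r : 0 < t -> (forall s, 0 < s -> s < t -> slope c s t <= r) -> Ld t <= r.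
Proof.
move=> t0 H; apply: (ler_cvg_to (lquot_cvg t0) (cvg_cst r)).
near=> h; rewrite /= lquotE; apply: H; last by rewrite gtrDl.
suff : - t < h by lra.
by near: h; apply: nbhs_left_gt; lra.
Unshelve. all: by end_near. Qed.

Lemma rquot_lim_homo : {in Interval (BRight 0) (BInfty _ false) &, {homo Rd : x y / x <= y}}.
Proof.
move=> s t; rewrite !in_itv/= !andbT => s0 t0; rewrite le_eqVlt => /predU1P[->//|st].
apply: (le_trans (ltW (rquot_lim_lt s0 st))).
by apply: rquot_lim_ge => // u tu; apply/ltW/slope_lt.
Qed.

Lemma rderiv_gt0 t : 0 < t -> rderiv gamma t = (Rd t)%:E.
Proof. by rewrite /rderiv => ->. Qed.

Lemma rderiv0_cvg : (Rd u)%:E @[u --> 0^'+] --> rderiv gamma 0.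
Proof.
rewrite /rderiv ltxx; apply: nondecreasing_at_right_is_cvge.
near=> e; move=> h k; rewrite !in_itv/= => /andP[h0 he] /andP[k0 ke] hk.
by rewrite lee_fin; apply: rquot_lim_homo => //; rewrite in_itv/= andbT.
Unshelve. all: by end_near. Qed.

Lemma rderiv0_le t : 0 < t -> (rderiv gamma 0 <= (Rd t)%:E)%E.
Proof.
move=> t0; apply: (lee_cvg_to rderiv0_cvg (cvg_cst (Rd t)%:E)).
near=> h; rewrite /= lee_fin; apply: rquot_lim_homo; rewrite ?in_itv/= ?andbT//.
by near: h; apply: nbhs_right_le.
Unshelve. all: by end_near. Qed.

Lemma rderiv0_ge r : (forall t, 0 < t -> r <= Rd t) -> (r%:E <= rderiv gamma 0)%E.
Proof.
move=> H; apply: (lee_cvg_to (cvg_cst r%:E) rderiv0_cvg).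
by near=> h; rewrite /= lee_fin; apply: H.
Unshelve. all: by end_near. Qed.

Lemma rderiv0_fin_num r : (r%:E <= rderiv gamma 0)%E -> rderiv gamma 0 \is a fin_num.
Proof.
move=> H; rewrite fin_numE; apply/andP; split.
  by rewrite gt_eqF// (lt_le_trans _ H)// ltNyr.
by rewrite lt_eqF// (le_lt_trans (rderiv0_le ltr01))// ltry.
Qed.

(** The value at 0 is accessible only as a limit from the right. An affine minorant near 0 survives
    that limit even if [gamma 0] is [+oo]. *)
Lemma integrand0_ge e x y : 0 < e -> (forall u, 0 < u -> u < e -> x + y * u <= c u) ->
  (x%:E <= gamma 0)%E.
Proof.
move=> e0 H; case: Gg => _ _ _ _ g0.
have lin : (x + y * u)%:E @[u --> 0^'+] --> x%:E.
  apply: cvg_EFin; first by near=> h.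
  apply: cvg_at_right_filter; rewrite -[X in _ --> X]addr0 -[X in _ --> _ + X](mulr0 y).
  apply: cvgD; first exact: cvg_cst.
  by apply: cvgM; [exact: cvg_cst|exact: cvg_id].
apply: (lee_cvg_to lin g0).
near=> h; rewrite integrandE// lee_fin; apply: H => //.
Unshelve. all: by end_near. Qed.
End one_integrand.

Section subgradients.
Context {R : realType} {gamma : R -> \bar R}.
Hypothesis Gg : is_Gamma gamma.
Implicit Types (s t r x y z : R).

Local Notation c := (fine \o gamma).
Local Notation Rd := (right_quotient_lim gamma).
Local Notation Ld := (left_quotient_lim gamma).

Lemma slope_sub (f : R -> R) x y : x < y -> f y = f x + slope f x y * (y - x).
Proof. by move=> xy; rewrite /slope divfK ?subr_eq0 ?gt_eqF// addrC subrK. Qed.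

Lemma integrand0_le e x y : 0 < e -> (forall u, 0 < u -> u < e -> c u <= x + y * u) ->
  (gamma 0 <= x%:E)%E.
Proof.
move=> e0 H; case: (Gg) => _ _ _ _ g0.
have lin : (x + y * u)%:E @[u --> 0^'+] --> x%:E.
  apply: cvg_EFin; first by near=> h.
  apply: cvg_at_right_filter; rewrite -[X in _ --> X]addr0 -[X in _ --> _ + X](mulr0 y).
  apply: cvgD; first exact: cvg_cst.
  by apply: cvgM; [exact: cvg_cst|exact: cvg_id].
apply: (lee_cvg_to g0 lin).
near=> h; rewrite (integrandE Gg)// lee_fin; apply: H => //.
Unshelve. all: by end_near. Qed.

(** The chord inequality down to t = 0, where strictness is lost: left of x the graph lies above the
    line through its points at x and z, and this passes to the limit at 0. *)
Lemma integrand_chord t x z : 0 <= t -> t < x -> x < z -> gamma t \is a fin_num ->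
  (c x - c t) * (z - t) <= (c z - c t) * (x - t).
Proof.
rewrite le_eqVlt => /predU1P[<-|t0] tx xz fg; last first.
  by have := three_chord Gg t0 tx xz; lra.
pose S := slope c x z.
suff H : ((c x - S * x)%:E <= gamma 0)%E.
  move: H; rewrite -(fineK fg) lee_fin => H.
  by have := slope_sub c xz; rewrite -/S /= in H *; nra.
apply: (@integrand0_ge _ _ Gg x _ S) => // u u0 ux.
have := slope_ltl Gg u0 ux xz; have := slope_lt Gg u0 ux xz.
have := slope_sub c ux; rewrite -/S /=; nra.
Qed.

Lemma rderiv_le t s (f := fine (rderiv gamma t)) : 0 <= t -> t < s ->
  rderiv gamma t \is a fin_num -> f <= Rd s.
Proof.
rewrite /f le_eqVlt => /predU1P[<-|t0] ts fr.
  by rewrite -lee_fin fineK// rderiv0_le.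
rewrite rderiv_gt0//=; apply: rquot_lim_homo => //; last exact: ltW.
  by rewrite in_itv/= andbT.
by rewrite in_itv/= andbT (lt_trans t0).
Qed.

(** At t = 0 the finite right derivative is a lower bound for all later slopes, so going back from
    the point 1 bounds [gamma] near 0 from above by an affine function. *)
Lemma rderiv_fin_integrand t : 0 <= t ->
  rderiv gamma t \is a fin_num -> gamma t \is a fin_num.
Proof.
case: (Gg) => gNy gfin _ _ _.
rewrite le_eqVlt => /predU1P[<-|t0] fr; last exact: gfin.
rewrite fin_numE gNy /= lt_eqF//.
apply: (@le_lt_trans _ _ (c 1 - fine (rderiv gamma 0))%:E); last exact: ltry.
apply: (@integrand0_le 1 _ (fine (rderiv gamma 0))) => // u u0 u1.
have := rquot_lim_lt Gg u0 u1; have := rderiv_le (lexx 0) u0 fr.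
by have := slope_sub c u1; rewrite /=; nra.
Qed.

Lemma rderiv_subgradient t s : 0 <= t -> t <= s -> rderiv gamma t \is a fin_num ->
  fine (rderiv gamma t) * (s - t) <= c s - c t.
Proof.
move=> t0; rewrite le_eqVlt => /predU1P[->|ts] fr; first by rewrite !subrr mulr0.
have fg := rderiv_fin_integrand t0 fr.
have s0 : 0 < s by exact: le_lt_trans ts.
move: t0; rewrite le_eqVlt => /predU1P[t0|t0]; last first.
  rewrite rderiv_gt0//=; have := rquot_lim_lt Gg t0 ts.
  by have := slope_sub c ts; rewrite /=; nra.
rewrite -t0 in fr fg ts *.
suff : (gamma 0 <= (c s - fine (rderiv gamma 0) * s)%:E)%E.
  by rewrite -{1}(fineK fg) lee_fin /=; lra.
apply: (@integrand0_le s _ (fine (rderiv gamma 0))) => // u u0 us.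
have := rquot_lim_lt Gg u0 us; have := rderiv_le (lexx 0) u0 fr.
by have := slope_sub c us; rewrite /=; nra.
Qed.

Lemma rderiv_subgradient_strict t s : 0 <= t -> t < s -> rderiv gamma t \is a fin_num ->
  fine (rderiv gamma t) * (s - t) < c s - c t.
Proof.
move=> t0 ts fr; pose m := (t + s) / 2.
have tm : t < m by rewrite /m; lra.
have ms : m < s by rewrite /m; lra.
have := rderiv_subgradient t0 (ltW tm) fr.
have := rquot_lim_lt Gg (le_lt_trans t0 tm) ms; have := rderiv_le t0 tm fr.
by have := slope_sub c ms; rewrite /=; nra.
Qed.

Lemma lderiv_subgradient t s : 0 < s -> s < t -> Ld t * (s - t) < c s - c t.
Proof.
move=> s0 st; have := lquot_lim_gt Gg s0 st.
by have := slope_sub c st; rewrite /=; nra.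
Qed.

Lemma lderiv_subgradient0 t s : 0 <= s -> s < t -> (((c t + Ld t * (s - t))%R)%:E <= gamma s)%E.
Proof.
rewrite le_eqVlt => /predU1P[<-|s0] st; last first.
  by rewrite (integrandE Gg)// lee_fin; have := lderiv_subgradient s0 st; lra.
apply: (@integrand0_ge _ _ Gg t _ (Ld t)) => // u u0 ut.
by have := lderiv_subgradient u0 ut; lra.
Qed.

End subgradients.

(** * Bregman distance of a single integrand *)

Section bregman.
Context {R : realType} {gamma : R -> \bar R}.
Hypothesis Gg : is_Gamma gamma.
Implicit Types (s t r x y z d e : R).

Local Notation c := (fine \o gamma).
Local Notation Rd := (right_quotient_lim gamma).
Local Notation Ld := (left_quotient_lim gamma).

Lemma integrand_fin_right t s : 0 <= t -> t <= s -> rderiv gamma t \is a fin_num ->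
  gamma s \is a fin_num.
Proof.
move=> t0 ts fr; have [s0|s0] := ltP 0 s; first by case: (Gg) => _ + _ _ _; apply.
have -> : s = t by apply/eqP; rewrite eq_le ts andbT (le_trans s0).
exact: (rderiv_fin_integrand Gg).
Qed.

Lemma bregman_right t s : 0 <= t -> t <= s -> rderiv gamma t \is a fin_num ->
  bregman_integrand gamma s t = (c s - c t - fine (rderiv gamma t) * (s - t))%:E.
Proof.
move=> t0 ts fr; rewrite /bregman_integrand !ltNge t0 (le_trans t0 ts)/= fr.
have fg := rderiv_fin_integrand Gg t0 fr.
have fs := integrand_fin_right t0 ts fr.
rewrite /sgn_deriv subr_ge0 ts.
by rewrite -{1}(fineK fr) -{1}(fineK fg) -{1}(fineK fs).
Qed.

Lemma bregman_left t s : 0 <= s -> s < t ->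
  bregman_integrand gamma s t = (gamma s - (c t + Ld t * (s - t))%:E)%E.
Proof.
move=> s0 st; have t0 : 0 < t by exact: le_lt_trans st.
rewrite /bregman_integrand !ltNge s0 (ltW t0) rderiv_gt0//=.
rewrite /sgn_deriv subr_ge0 leNgt st /= /lderiv t0 (integrandE Gg t0) /=.
by rewrite -addeA -EFinD opprD.
Qed.

Lemma bregman_infinite s t : 0 <= s -> 0 <= t -> rderiv gamma t \isn't a fin_num ->
  t = 0 /\ bregman_integrand gamma s t = (s%:E * +oo)%E.
Proof.
move=> s0 t0 fr; split.
  by move: t0; rewrite le_eqVlt => /predU1P[//|t0]; move: fr; rewrite rderiv_gt0.
by rewrite /bregman_integrand !ltNge s0 t0 (negbTE fr).
Qed.

Lemma bregman_integrand_ge0 s t : (0 <= bregman_integrand gamma s t)%E.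
Proof.
have [s0|s0] := ltP s 0; first by rewrite /bregman_integrand s0.
have [t0|t0] := ltP t 0; first by rewrite /bregman_integrand t0 orbT.
have [fr|nfr] := boolP (rderiv gamma t \is a fin_num); last first.
  have [_ ->] := bregman_infinite s0 t0 nfr.
  by rewrite mule_ge0// lee_fin.
have [ts|st] := leP t s.
  rewrite bregman_right// lee_fin.
  by have := rderiv_subgradient Gg t0 ts fr; lra.
rewrite bregman_left// sube_ge0; last by rewrite fin_numE.
exact: (lderiv_subgradient0 Gg).
Qed.

(** As a function of s the distance p is convex and vanishes at t, so p s / (s - t) is nondecreasing
    and the positive value at t + e bounds everything further right. *)
Lemma bregman_integrand_ge_right t e : 0 < e -> 0 <= t -> rderiv gamma t \is a fin_num ->
  exists2 d, 0 < d & forall s, t + e <= s -> (d%:E <= bregman_integrand gamma s t)%E.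
Proof.
move=> e0 t0 fr; pose p s := c s - c t - fine (rderiv gamma t) * (s - t).
have te : t < t + e by rewrite ltrDl.
have pe : 0 < p (t + e).
  by have := rderiv_subgradient_strict Gg t0 te fr; rewrite /p; lra.
exists (p (t + e)) => // s tes.
rewrite bregman_right//; last exact: (le_trans (ltW te)).
rewrite lee_fin -/(p s).
move: tes; rewrite le_eqVlt => /predU1P[<-//|tes].
have := integrand_chord Gg t0 te tes (rderiv_fin_integrand Gg t0 fr).
rewrite addrAC subrr add0r => ch.
have {}ch : p (t + e) * (s - t) <= p s * e by rewrite /p; lra.
have : p (t + e) * e <= p s * e.
  apply: le_trans ch; apply: ler_wpM2l; first exact: ltW.
  lra.
by rewrite ler_pM2r.
Qed.

Lemma bregman_integrand_ge_left t e : 0 < e -> 0 < t ->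
  exists2 d, 0 < d & forall s, 0 <= s -> s <= t - e -> (d%:E <= bregman_integrand gamma s t)%E.
Proof.
(* The cap t / 2 keeps t - e' positive, where [gamma] is finite and the three-chord inequality is
   available. *)
move=> e0 t0; pose e' := Num.min e (t / 2).
have e'0 : 0 < e' by rewrite lt_min e0 divr_gt0.
have e't : e' <= t / 2 by rewrite ge_min lexx orbT.
have e'e : e' <= e by rewrite ge_min lexx.
pose p s := c s - c t - Ld t * (s - t); pose m := t - e'.
have m0 : 0 < m by rewrite /m; lra.
have mt : m < t by rewrite /m; lra.
have pm : 0 < p m by have := lderiv_subgradient Gg m0 mt; rewrite /p; lra.
have H s : 0 < s -> s <= m -> p m <= p s.
  move=> s0; rewrite le_eqVlt => /predU1P[->//|sm].
  have := three_chord Gg s0 sm mt => ch.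
  have {}ch : p m * (t - s) < p s * (t - m) by rewrite /p /= in ch *; lra.
  have : p m * (t - m) < p s * (t - m).
    by apply: le_lt_trans ch; apply: ler_wpM2l; [exact: ltW|lra].
  by rewrite ltr_pM2r ?subr_gt0// => /ltW.
exists (p m) => // s s0 ste.
have st : s < t by lra.
have sm : s <= m by rewrite /m; lra.
rewrite bregman_left// leeBrDr; last by rewrite fin_numE.
rewrite -EFinD; move: s0; rewrite le_eqVlt => /predU1P[s0|s0]; last first.
  by rewrite (integrandE Gg)// lee_fin; have := H s s0 sm; rewrite /p /=; lra.
rewrite -s0; apply: (@integrand0_ge _ _ Gg m _ (Ld t)) => // u u0 um.
by have := H u u0 (ltW um); rewrite /p /=; lra.
Qed.

(** A small distance to t forces closeness to t, with d depending on t and [gamma]; this is what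
    makes limits in Bregman distance unique. If the right derivative at t = 0 is [-oo], the distance
    is infinite at every s other than 0. *)
Lemma bregman_integrand_small t e : 0 < e ->
  exists2 d, 0 < d & forall s, (bregman_integrand gamma s t < d%:E)%E -> `|s - t| < e.
Proof.
move=> e0; have [t0|t0] := ltP t 0.
  by exists 1 => // s; rewrite /bregman_integrand t0 orbT ltNge leey.
have [fr|nfr] := boolP (rderiv gamma t \is a fin_num); last first.
  exists 1 => // s; have [s0|s0] := ltP s 0.
    by rewrite /bregman_integrand s0 ltNge leey.
  have [-> ->] := bregman_infinite s0 t0 nfr; rewrite subr0.
  move: s0; rewrite le_eqVlt => /predU1P[<-|s0]; first by rewrite normr0.
  by rewrite gt0_muley ?lte_fin// ltNge leey.
have [d1 d10 H1] := bregman_integrand_ge_right e0 t0 fr.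
have [d2 d20 H2] : exists2 d, 0 < d & forall s, 0 <= s -> s <= t - e -> (d%:E <= bregman_integrand gamma s t)%E.
  move: t0; rewrite le_eqVlt => /predU1P[<-|t0]; last exact: bregman_integrand_ge_left.
  by exists 1 => // s s0 se; exfalso; lra.
exists (Num.min d1 d2); first by rewrite lt_min d10.
move=> s H; have s0 : 0 <= s.
  by rewrite leNgt; apply/negP => s0; move: H; rewrite /bregman_integrand s0 ltNge leey.
rewrite ltr_norml; apply/andP; split; rewrite ltNge; apply/negP => hs.
  have := lt_le_trans H (_ : (Num.min d1 d2)%:E <= d2%:E)%E.
  rewrite lee_fin ge_min lexx orbT => /(_ isT); apply/negP; rewrite -leNgt.
  by apply: H2 => //; lra.
have := lt_le_trans H (_ : (Num.min d1 d2)%:E <= d1%:E)%E.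
rewrite lee_fin ge_min lexx => /(_ isT); apply/negP; rewrite -leNgt.
by apply: H1; lra.
Qed.

End bregman.

(** Says that t attains the supremum in [conjugate gamma r], without derivatives. Comparing with s >
    0 suffices: s < 0 has infinite cost and s = 0 is a limit of positive s. *)
Definition is_argmax {R : realType} (gamma : R -> \bar R) (r t : R) :=
  [/\ 0 <= t, gamma t \is a fin_num &
   forall s, 0 < s -> (fine \o gamma) t + r * (s - t) <= (fine \o gamma) s].

(** * Conjugates and their maximizers *)

Section conjugate.
Context {R : realType} {gamma : R -> \bar R}.
Hypothesis Gg : is_Gamma gamma.
Implicit Types (s t r x y z d e h l M u : R).

Local Notation c := (fine \o gamma).
Local Notation Rd := (right_quotient_lim gamma).
Local Notation Ld := (left_quotient_lim gamma).
Local Notation conj := (conjugate gamma).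

Lemma conjugate_ge r t : ((r * t)%:E - gamma t <= conj r)%E.
Proof. by apply: ereal_sup_ubound; exists t. Qed.

(** Negative t contribute [-oo], and t = 0 is reached by right continuity. *)
Lemma conjugate_le r M : (forall t, 0 < t -> r * t - c t <= M) -> (conj r <= M%:E)%E.
Proof.
move=> H; apply: ub_ereal_sup => _ [t _ <-].
case: (Gg) => gNy gfin _ gy _.
have [t0|t0|->] := ltgtP t 0; first by rewrite gy// addeNy leNye.
  by rewrite (integrandE Gg)// lee_fin; have := H t t0; lra.
rewrite mulr0 add0e leeNl; apply: (@integrand0_ge _ _ Gg 1 _ r) => // u u0 _.
by have := H u u0; lra.
Qed.

Lemma conjugate_gtNy r : (-oo < conj r)%E.
Proof.
apply: lt_le_trans (conjugate_ge r 1).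
by rewrite (integrandE Gg)// ltNyr.
Qed.

Lemma conjugate_fin_num r M : (conj r <= M%:E)%E -> conj r \is a fin_num.
Proof.
move=> H; rewrite fin_numE gt_eqF ?conjugate_gtNy//=.
by rewrite lt_eqF// (le_lt_trans H)// ltry.
Qed.

Lemma conjugate_fin_numP r : (conj r < +oo)%E -> conj r \is a fin_num.
Proof. by move=> H; rewrite fin_numE gt_eqF ?conjugate_gtNy//= lt_eqF. Qed.

Lemma conjugate_ub r t : conj r \is a fin_num -> 0 < t -> r * t - c t <= fine (conj r).
Proof.
by move=> f t0; have := conjugate_ge r t; rewrite (integrandE Gg)// -{1}(fineK f) lee_fin.
Qed.

(** Monotone because only t >= 0 contribute. Hence finiteness in a neighborhood of r amounts to
    finiteness at a single point to the right of r. *)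
Lemma conjugate_homo r1 r2 : r1 <= r2 -> (conj r1 <= conj r2)%E.
Proof.
move=> r12; have [/eqP ->|] := boolP (conj r2 == +oo%E); first exact: leey.
rewrite -ltey => /conjugate_fin_numP f; rewrite -(fineK f).
apply: conjugate_le => t t0; have := conjugate_ub f t0; nra.
Qed.

Lemma conjugate_convex r1 r2 l M1 M2 : 0 <= l -> l <= 1 ->
  (conj r1 <= M1%:E)%E -> (conj r2 <= M2%:E)%E ->
  (conj ((1 - l) * r1 + l * r2) <= ((1 - l) * M1 + l * M2)%:E)%E.
Proof.
move=> l0 l1 H1 H2; apply: conjugate_le => t t0.
have f1 := conjugate_fin_num H1; have f2 := conjugate_fin_num H2.
have := conjugate_ub f1 t0; have := conjugate_ub f2 t0.
rewrite -(fineK f1) lee_fin in H1; rewrite -(fineK f2) lee_fin in H2 => h2 h1.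
have {}h1 : r1 * t - c t <= M1 by exact: le_trans H1.
have {}h2 : r2 * t - c t <= M2 by exact: le_trans H2.
have := ler_wpM2l l0 h2; have : 0 <= 1 - l by lra.
move=> /ler_wpM2l /(_ _ _ h1); lra.
Qed.

Lemma argmax_conjugate r t : is_argmax gamma r t -> conj r = (r * t - c t)%:E.
Proof.
move=> [t0 fg H]; apply/eqP; rewrite eq_le; apply/andP; split.
  by apply: conjugate_le => s s0; have := H s s0; lra.
by have := conjugate_ge r t; rewrite -{1}(fineK fg).
Qed.

(** Were equality to hold at u, points between t and u would fall below the supporting line by
    strict convexity. *)
Lemma argmax_strict r t u : is_argmax gamma r t -> 0 < u -> u != t ->
  c t + r * (u - t) < c u.
Proof.
move=> [t0 fg H] u0 ut; rewrite lt_neqAle H// andbT; apply/negP => /eqP E.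
move: ut; rewrite neq_lt => /orP[ut|tu].
  pose m := (u + t) / 2.
  have um : u < m by rewrite /m; lra.
  have mt : m < t by rewrite /m; lra.
  have ch := three_chord Gg u0 um mt; have h := H m (lt_trans u0 um).
  have E1 : m - u = (t - u) / 2 by rewrite /m; lra.
  have E2 : t - m = (t - u) / 2 by rewrite /m; lra.
  have E3 : m - t = (u - t) / 2 by rewrite /m; lra.
  have ut2 : 0 < (t - u) / 2 by lra.
  rewrite E1 E2 ltr_pM2r// -E in ch; rewrite E3 in h; lra.
(* Here t may be 0, where the chord inequality is not strict; the second midpoint supplies the
   strict inequality on the part (m1, u), away from 0. *)
pose m1 := (t + u) / 2; pose m2 := (m1 + u) / 2.
have tm1 : t < m1 by rewrite /m1; lra.
have m1u : m1 < u by rewrite /m1; lra.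
have m12 : m1 < m2 by rewrite /m2; lra.
have m2u : m2 < u by rewrite /m2; lra.
have m10 : 0 < m1 by lra.
have ch1 := integrand_chord Gg t0 tm1 m1u fg.
have ch2 := three_chord Gg m10 m12 m2u.
have h1 := H m1 m10; have h2 := H m2 (lt_trans m10 m12).
have E1 : m1 - t = (u - t) / 2 by rewrite /m1; lra.
have E2 : u - m2 = (u - t) / 4 by rewrite /m2 /m1; lra.
have E3 : m2 - m1 = (u - t) / 4 by rewrite /m2 /m1; lra.
have ut0 : 0 < u - t by lra.
have : c m1 <= c t + r * (m1 - t).
  rewrite -(ler_pM2r ut0); move: ch1; rewrite -E E1; lra.
have : c m2 - c m1 < c u - c m2.
  have u4 : 0 < (u - t) / 4 by lra.
  by rewrite -(ltr_pM2r u4) -{1}E2 -E3.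
have E4 : m2 - t = (u - t) * 3 / 4 by rewrite /m2 /m1; lra.
rewrite -E E4 in h2 *; rewrite E1 in h1 *; lra.
Qed.

(** The number d is the slope from t to u = t + e in excess of r. Beyond u the excess slope is at
    least d, so tilting by h < d does not let points beyond u win, and the points up to u gain at
    most h u. *)
Lemma argmax_incr_right r t e : is_argmax gamma r t -> 0 < e ->
  exists2 d, 0 < d & forall h, 0 < h -> h < d ->
    (conj (r + h) <= (fine (conj r) + h * (t + e))%:E)%E.
Proof.
move=> am e0; have E := argmax_conjugate am.
have [t0 fg H] := am; pose u := t + e.
have tu : t < u by rewrite ltrDl.
have u0 : 0 < u by lra.
have gap := argmax_strict am u0 (negbT (gt_eqF tu)).
pose d := (c u - (c t + r * (u - t))) / e.
have d0 : 0 < d by rewrite divr_gt0// subr_gt0.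
have dE : c u = c t + (r + d) * e.
  have : d * e = c u - (c t + r * (u - t)) by rewrite divfK// gt_eqF.
  by rewrite /u; lra.
exists d => // h h0 hd; apply: conjugate_le => s s0.
rewrite E /=; have [su|us] := leP s u.
  have := H s s0; have : h * s <= h * u by rewrite ler_pM2l.
  by rewrite /u /=; lra.
have ch := integrand_chord Gg t0 tu us fg.
have {}ch : (r + d) * (s - t) <= c s - c t.
  rewrite -(ler_pM2r e0); move: ch; rewrite dE /u; lra.
have : h * (s - t) <= d * (s - t) by rewrite ler_pM2r//; lra.
have : 0 < h * e by rewrite mulr_gt0.
rewrite /= in ch *; lra.
Qed.

Lemma argmax_incr_left r t e : is_argmax gamma r t -> 0 < e ->
  exists2 d, 0 < d & forall h, 0 < h -> h < d ->
    (conj (r - h) <= (fine (conj r) - h * (t - e))%:E)%E.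
Proof.
move=> am e0; have E := argmax_conjugate am.
have [t0 fg H] := am; move: (t0); rewrite le_eqVlt => /predU1P[t00|t00].
  exists 1 => // h h0 _; apply: conjugate_le => s s0.
  have := H s s0; rewrite E /= -t00.
  have := mulr_gt0 h0 s0; have := mulr_gt0 h0 e0; lra.
pose e' := Num.min e (t / 2).
have e'0 : 0 < e' by rewrite lt_min e0 divr_gt0.
have e't : e' <= t / 2 by rewrite ge_min lexx orbT.
have e'e : e' <= e by rewrite ge_min lexx.
pose m := t - e'.
have m0 : 0 < m by rewrite /m; lra.
have mt : m < t by rewrite /m; lra.
have gap := argmax_strict am m0 (negbT (lt_eqF mt)).
pose d := (c m - (c t + r * (m - t))) / e'.
have d0 : 0 < d by rewrite divr_gt0// subr_gt0.
have dE : c m = c t - (r - d) * e'.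
  have : d * e' = c m - (c t + r * (m - t)) by rewrite divfK// gt_eqF.
  by rewrite /m; lra.
exists d => // h h0 hd; apply: conjugate_le => s s0.
have he : h * e' <= h * e by rewrite ler_pM2l.
rewrite E /=; have [ms|sm] := leP m s.
  have := H s s0; have : h * m <= h * s by rewrite ler_pM2l.
  by rewrite /m /=; lra.
have ch := three_chord Gg s0 sm mt.
have {}ch : (r - d) * (s - t) <= c s - c t.
  rewrite -(ler_pM2r e'0); move: ch; rewrite dE /m; lra.
have : h * (t - s) <= d * (t - s) by rewrite ler_pM2r//; lra.
have : 0 < h * e by rewrite mulr_gt0.
rewrite /= in ch *; lra.
Qed.

End conjugate.

Section conjugate_derivative.
Context {R : realType} {gamma : R -> \bar R}.
Hypothesis Gg : is_Gamma gamma.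
Implicit Types (s t r x y z d e h l M T u w : R).

Local Notation c := (fine \o gamma).
Local Notation Rd := (right_quotient_lim gamma).
Local Notation Ld := (left_quotient_lim gamma).
Local Notation conj := (conjugate gamma).

(** S consists of the points from which some later chord has slope below r, that is, where [gamma]
    minus the line of slope r still decreases to a later point. The maximizer is sup S, or 0 if S is
    empty. *)
Lemma argmax_exists r e : 0 < e -> (conj (r + e) < +oo)%E -> exists t, is_argmax gamma r t.
Proof.
move=> e0 /(conjugate_fin_numP Gg) fe.
pose S := [set t | 0 < t /\ exists2 s, t < s & c s - c t < r * (s - t)].
have nS u s : 0 < u -> u < s -> ~ S u -> r * (s - u) <= c s - c u.
  move=> u0 us nSu; rewrite leNgt; apply/negP => H; apply: nSu; split=> //.
  by exists s.
have [S0|/set0P S0] := eqVneq S set0.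
  exists 0; split=> //.
    case: (Gg) => gNy _ _ _ _; rewrite fin_numE gNy /= lt_eqF//.
    apply: (@le_lt_trans _ _ (c 1 - r)%:E); last exact: ltry.
    apply: (@integrand0_le _ _ Gg 1 _ r) => // u u0 u1.
    by have := nS u 1 u0 u1; rewrite S0 => /(_ id); lra.
  move=> s s0; rewrite subr0.
  have H : (gamma 0 <= (c s - r * s)%:E)%E.
    apply: (@integrand0_le _ _ Gg s _ r) => // u u0 us.
    by have := nS u s u0 us; rewrite S0 => /(_ id); lra.
  have : (fine (gamma 0) <= c s - r * s).
    rewrite -lee_fin fineK//; case: (Gg) => gNy _ _ _ _.
    by rewrite fin_numE gNy /= lt_eqF// (le_lt_trans H)// ltry.
  by rewrite /=; lra.
have Sdown u v : S u -> 0 < v -> v < u -> c u - c v < r * (u - v).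
  move=> [u0 [s us H]] v0 vu; have := slope_lt Gg v0 vu us.
  have := slope_sub c vu; have := slope_sub c us => E1 E2 sl.
  have : slope c u s < r.
    by rewrite /slope ltr_pdivrMr ?subr_gt0.
  move=> /(lt_trans sl); rewrite /slope ltr_pdivrMr ?subr_gt0//.
have Sub : has_ubound S.
  (* A point u > 1 of S has c u - c 1 < r (u - 1), while finiteness of the conjugate at r + e gives
     c u >= (r + e) u - K; together they bound u. *)
  pose K := fine (conj (r + e)); exists (Num.max 1 ((K + c 1 - r) / e)) => u Su.
  have [u1|u1] := leP u 1; first by rewrite le_max u1.
  rewrite le_max; apply/orP; right; rewrite ler_pdivlMr//.
  have := Sdown u 1 Su ltr01 u1; have := conjugate_ub Gg fe (lt_trans ltr01 u1).
  by rewrite /K /=; lra.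
have Ss : has_sup S by split.
pose t := sup S.
have t0 : 0 < t.
  by case: (S0) => u Su; apply: (@lt_le_trans _ _ u); [case: Su|exact: ub_le_sup].
have right_of u s : t < u -> u < s -> r * (s - u) <= c s - c u.
  move=> tu us; apply: nS => //; first exact: lt_trans tu.
  by move=> /(ub_le_sup Sub); rewrite leNgt tu.
(* Replaces continuity at sup S: there the errors are a chord slope times h, hence linear in h. *)
have lin_le x y a d : 0 < d -> (forall h, 0 < h -> h < d -> x <= y + a * h) -> x <= y.
  move=> d0 H; rewrite leNgt; apply/negP => yx.
  pose k := `|a| + 1; have k0 : 0 < k by rewrite ltr_wpDl.
  pose h := Num.min (d / 2) ((x - y) / 2 / k).
  have h0 : 0 < h by rewrite lt_min; apply/andP; split; rewrite ?divr_gt0// subr_gt0.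
  have h1 : h < d by rewrite gt_min; apply/orP; left; lra.
  have hk : h * k <= (x - y) / 2 by rewrite -ler_pdivlMr// ge_min lexx orbT.
  have := H h h0 h1; have := ler_wpM2r (ltW h0) (ler_norm a).
  by rewrite /k in hk; lra.
exists t; split; first exact: ltW.
  by rewrite (integrandE Gg t0).
move=> s s0; have [ts|st|->] := ltgtP t s; last by rewrite subrr mulr0 addr0.
  have t20 : 0 < t / 2 by rewrite divr_gt0.
  have t2t : t / 2 < t by lra.
  pose A := slope c (t / 2) t.
  apply: (lin_le _ _ (r - A) (s - t)); first by rewrite subr_gt0.
  move=> h h0 hs; pose u := t + h.
  have tu : t < u by rewrite /u; lra.
  have us : u < s by rewrite /u; lra.
  have H1 := right_of u s tu us.
  have := slope_lt Gg t20 t2t tu; rewrite -/A => H2.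
  have := slope_sub c tu => H3.
  have : A * (u - t) < slope c t u * (u - t) by rewrite ltr_pM2r// subr_gt0.
  by rewrite /u /= in H1 H3 *; lra.
have SL u : 0 < u -> u < t -> S u.
  move=> u0 ut; have [v Sv uv] := sup_gt (proj1 Ss) ut.
  split=> //; exists v => //; exact: Sdown.
pose M := slope c t (t + 1).
have tt1 : t < t + 1 by rewrite ltrDl.
suff : c t <= c s + r * (t - s) by rewrite /=; lra.
apply: (lin_le _ _ (M - r) (t - s)); first by rewrite subr_gt0.
move=> h h0 hs; pose u := t - h.
have su : s < u by rewrite /u; lra.
have ut : u < t by rewrite /u; lra.
have u0 : 0 < u by exact: lt_trans su.
have H1 := Sdown u s (SL u u0 ut) s0 su.
have H2 := slope_lt Gg u0 ut tt1; rewrite -/M in H2.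
have H3 := slope_sub c ut.
have : slope c u t * (t - u) < M * (t - u) by rewrite ltr_pM2r// subr_gt0.
by rewrite /u /= in H1 H3 *; lra.
Qed.

End conjugate_derivative.

Section fenchel_young.
Context {R : realType} {gamma : R -> \bar R}.
Hypothesis Gg : is_Gamma gamma.
Implicit Types (s t r x y z d e h l M T u w : R).

Local Notation c := (fine \o gamma).
Local Notation Rd := (right_quotient_lim gamma).
Local Notation Ld := (left_quotient_lim gamma).
Local Notation conj := (conjugate gamma).

Lemma conjugate_fin_nearP r :
  (\forall u \near r, conj u \is a fin_num) <-> exists2 e, 0 < e & (conj (r + e) < +oo)%E.
Proof.
split=> [/nbhs_ballP[e /= e0 H]|[e e0 H]].
  exists (e / 2); first by rewrite divr_gt0.
  have /H : ball r e (r + e / 2).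
    by rewrite /ball/= opprD addrA subrr add0r normrN gtr0_norm ?divr_gt0//; lra.
  by rewrite ltey_eq => ->.
exists e => //= u; rewrite /ball/= ltr_norml => /andP[h1 h2].
apply: (conjugate_fin_numP Gg).
by apply: (le_lt_trans _ H); apply: (conjugate_homo Gg); lra.
Qed.

(** The trial point t bounds the increments of the conjugate from below by t h; the two lemmas on
    tilting bound them from above up to an error e |h|. *)
Lemma conjugate_diff_cvg r t : is_argmax gamma r t ->
  (h^-1 * (fine (conj (h + r)) - fine (conj r))) @[h --> 0^'] --> t.
Proof.
move=> am; apply/cvgrPdist_le => e e0.
have [d1 d10 H1] := argmax_incr_right Gg am e0.
have [d2 d20 H2] := argmax_incr_left Gg am e0.
have E := argmax_conjugate Gg am.
have low h : conj (h + r) \is a fin_num -> fine (conj r) + t * h <= fine (conj (h + r)).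
  move=> fh; have := @conjugate_ge _ gamma (h + r) t; have [t0 fg _] := am.
  rewrite -(fineK fg) -{1}(fineK fh) lee_fin E /=; lra.
near=> h.
have h0 : h != 0 by near: h; exact: nbhs_dnbhs_neq.
have : `|h| < Num.min d1 d2.
  near: h; apply: dnbhs0_lt; by rewrite lt_min d10.
rewrite lt_min => /andP[hd1 hd2]; move: h0; rewrite neq_lt => /orP[h0|h0].
  have h0' : 0 < - h by rewrite oppr_gt0.
  rewrite ltr0_norm// in hd1 hd2.
  have := H2 (- h) h0' hd2; rewrite opprK [r + h]addrC => U.
  have fh := conjugate_fin_num Gg U.
  have := low h fh; rewrite -(fineK fh) lee_fin in U => L.
  pose D := fine (conj (h + r)) - fine (conj r).
  have -> : h^-1 * (fine (conj (h + r)) - fine (conj r)) = (- D) / (- h).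
    by rewrite invrN mulrNN mulrC.
  rewrite ler_distl; apply/andP; split; rewrite ?lerBlDr ?lerBrDr.
    by rewrite ler_pdivrMr//; rewrite /D; lra.
  by rewrite -lerBlDr ler_pdivlMr//; rewrite /D; lra.
rewrite gtr0_norm// in hd1 hd2.
have := H1 h h0 hd1; rewrite [r + h]addrC => U.
have fh := conjugate_fin_num Gg U.
have := low h fh; rewrite -(fineK fh) lee_fin in U => L.
rewrite mulrC ler_distl; apply/andP; split; rewrite ?lerBlDr ?lerBrDr.
  by rewrite ler_pdivrMr//; lra.
by rewrite -lerBlDr ler_pdivlMr//; lra.
Unshelve. all: by end_near. Qed.

Lemma conjugate_ediff r e : 0 < e -> (conj (r + e) < +oo)%E ->
  ediff conj r /\ is_argmax gamma r (derive1 (fine \o conj) r).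
Proof.
move=> e0 fe; have [t am] := argmax_exists Gg e0 fe.
have D := conjugate_diff_cvg am.
have D' : h^-1 *: ((fine \o conj) (h *: 1 + r) - (fine \o conj) r) @[h --> 0^'] --> t.
  by rewrite /GRing.scale/=; under eq_fun do rewrite mulr1.
split.
  split; first by apply/conjugate_fin_nearP; exists e.
  by apply/cvg_ex; exists t; exact: D'.
suff -> : derive1 (fine \o conj) r = t by [].
rewrite derive1E; exact: (cvg_lim _ D').
Qed.

(** At t = 0 maximality bounds every right derivative below by r. This excludes the limit [-oo], and
    with it the degenerate branch of the Bregman integrand. *)
Lemma argmax_rderiv r t : is_argmax gamma r t ->
  rderiv gamma t \is a fin_num /\ r <= fine (rderiv gamma t).
Proof.
move=> [t0 fg H]; move: (t0); rewrite le_eqVlt => /predU1P[t00|t00]; last first.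
  rewrite rderiv_gt0//; split=> //=; apply: (rquot_lim_ge Gg) => // s ts.
  rewrite /slope ler_pdivlMr ?subr_gt0//.
  by have := H s (lt_trans t00 ts); lra.
rewrite -t00 in fg H *.
suff H2 : (r%:E <= rderiv gamma 0)%E.
  have fr := rderiv0_fin_num Gg H2; split=> //.
  by rewrite -lee_fin fineK.
apply: (rderiv0_ge Gg) => u u0; apply: (rquot_lim_ge Gg) => // s us.
rewrite /slope ler_pdivlMr ?subr_gt0//.
have ch := integrand_chord Gg (lexx 0) u0 us fg; rewrite !subr0 in ch.
have := H u u0; rewrite subr0 => h.
have : r * u * (s - u) <= (c u - c 0) * (s - u).
  by apply: ler_wpM2r; [rewrite subr_ge0 ltW|lra].
move=> h2; rewrite -(ler_pM2r u0); lra.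
Qed.

Lemma argmax_lderiv r t : is_argmax gamma r t -> 0 < t -> Ld t <= r.
Proof.
move=> [_ fg H] t0; apply: (lquot_lim_le Gg) => // s s0 st.
rewrite /slope ler_pdivrMr ?subr_gt0//.
by have := H s s0; lra.
Qed.

Lemma correction_ge0 r t s : is_argmax gamma r t -> 0 <= s ->
  (0 <= (sgn_deriv gamma (s - t) t - r%:E) * (s - t)%:E)%E.
Proof.
move=> am s0; have [fr rr] := argmax_rderiv am; have [t0 _ _] := am.
rewrite /sgn_deriv subr_ge0; have [ts|st] := leP t s.
  rewrite -(fineK fr) -EFinB -EFinM lee_fin.
  by rewrite mulr_ge0// subr_ge0.
have t00 : 0 < t by exact: le_lt_trans st.
rewrite /lderiv t00 -EFinB -EFinM lee_fin mulr_le0// subr_le0 ?(ltW st)//.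
exact: argmax_lderiv.
Qed.

(* The gap in the Fenchel-Young inequality at an arbitrary s, split at the
   maximizer t into a Bregman distance and a correction. *)
Lemma fenchel_young_gap r t s : is_argmax gamma r t -> 0 <= s ->
  (gamma s + (fine (conj r) - r * s)%:E =
   bregman_integrand gamma s t + (sgn_deriv gamma (s - t) t - r%:E) * (s - t)%:E)%E.
Proof.
move=> am s0; have [fr rr] := argmax_rderiv am; have [t0 fg _] := am.
rewrite (argmax_conjugate Gg am) /= /sgn_deriv subr_ge0.
have [ts|st] := leP t s.
  have fs := integrand_fin_right Gg t0 ts fr.
  rewrite (bregman_right Gg)// -{1}(fineK fs) -{2}(fineK fr) -EFinB -EFinM -!EFinD /=.
  by congr (_%:E); ring.
have t00 : 0 < t by exact: le_lt_trans st.
rewrite (bregman_left Gg)// /lderiv t00 -EFinB -EFinM -addeA -EFinN -EFinD.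
by congr (_ + _%:E)%E; rewrite /=; ring.
Qed.

(** At a right endpoint r of its domain where it is finite, the conjugate has left derivative [+oo]:
    all unit chords of [gamma] have slope below r, so the supremum at r is not attained at any
    finite point and every s < T loses a fixed amount g against T + 1. *)
Lemma conjugate_steep r T : 0 < T -> conj r \is a fin_num ->
  (forall e, 0 < e -> conj (r + e) = +oo%E) ->
  exists2 d, 0 < d & forall h, 0 < h -> h < d ->
    (conj (r - h) <= (fine (conj r) - h * T)%:E)%E.
Proof.
move=> T0 fr Hoo.
(* Otherwise the slopes beyond T + 1 exceed r by a fixed e > 0, which makes the conjugate finite at
   r + e / 2. *)
have rising : c (T + 1) - c T < r.
  rewrite ltNge; apply/negP => H.
  have T01 : 0 < T + 1 by lra.
  have T12 : T + 1 < T + 2 by lra.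
  have TT : T < T + 1 by lra.
  have H12 := three_chord Gg T0 TT T12.
  pose e := c (T + 2) - c (T + 1) - r.
  have e0 : 0 < e by rewrite /e; lra.
  have /(Hoo _) : 0 < e / 2 by rewrite divr_gt0.
  have : (conj (r + e / 2) <= (Num.max (fine (conj r) + e / 2 * (T + 2))
       ((r + e / 2) * (T + 2) - c (T + 2)))%:E)%E.
    apply: (conjugate_le Gg) => s s0; rewrite le_max.
    have [sT|Ts] := leP s (T + 2).
      have := conjugate_ub Gg fr s0.
      have : e / 2 * s <= e / 2 * (T + 2) by rewrite ler_pM2l// divr_gt0.
      by move=> h1 h2; apply/orP; left; rewrite /= in h2 *; lra.
    have := three_chord Gg T01 T12 Ts => ch; apply/orP; right.
    have E : c (T + 1) = c (T + 2) - r - e by rewrite /e; lra.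
    rewrite E in ch.
    have : 0 < e * (s - (T + 2)) by rewrite mulr_gt0// subr_gt0.
    by rewrite /= in ch *; lra.
  by move=> + E; rewrite E leNgt ltry.
pose g := r - (c (T + 1) - c T).
have g0 : 0 < g by rewrite /g; lra.
have T01 : 0 < T + 1 by lra.
have TT : T < T + 1 by lra.
exists (g / T); first by rewrite divr_gt0.
move=> h h0; rewrite ltr_pdivlMr// => hg.
apply: (conjugate_le Gg) => s s0.
have [Ts|sT] := leP T s.
  have := conjugate_ub Gg fr s0; have : h * T <= h * s by rewrite ler_pM2l.
  by rewrite /=; lra.
have ch := three_chord Gg s0 sT TT.
have := conjugate_ub Gg fr T01 => K.
have : 0 < g * (T - s) by rewrite mulr_gt0// subr_gt0.
have : 0 < h * s by rewrite mulr_gt0.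
have E : c T = c (T + 1) - r + g by rewrite /g; lra.
by rewrite E in ch *; rewrite /= in ch K E *; lra.
Qed.

End fenchel_young.

(* Codes of no positive rational get the junk value 1; only surjectivity onto the
   positive rationals matters. *)
Definition posrat {R : realType} (i : nat) : R :=
  if unpickle i is Some q then if 0 < ratr q :> R then ratr (q : rat) else 1 else 1.

(** * Countable suprema and limits along sequences, for measurability *)

Section sequential.
Context {R : realType} {gamma : R -> \bar R}.
Hypothesis Gg : is_Gamma gamma.
Implicit Types (s t r x y z d e h l M T u w : R).

Local Notation c := (fine \o gamma).
Local Notation Rd := (right_quotient_lim gamma).
Local Notation Ld := (left_quotient_lim gamma).
Local Notation conj := (conjugate gamma).

Lemma posrat_gt0 i : 0 < posrat i :> R.
Proof. by rewrite /posrat; case: unpickle => // q; case: ifP. Qed.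

Lemma posrat_dense x y : 0 <= x -> x < y -> exists i, x < posrat i < y.
Proof.
move=> x0 /rat_in_itvoo[q]; rewrite in_itv/= => /andP[xq qy].
exists (pickle q); rewrite /posrat pickleK.
by rewrite (le_lt_trans x0 xq) xq qy.
Qed.

Lemma cvg_harmonic_at_right : (@harmonic R) n @[n --> \oo] --> 0^'+.
Proof.
move=> A [e /= e0 H]; have /cvgrPdist_lt/(_ e e0) := @cvg_harmonic R.
apply: filterS => n h; apply: H => //=.
Qed.

Lemma cvg_harmonic_at_left : - (@harmonic R) n @[n --> \oo] --> 0^'-.
Proof.
move=> A [e /= e0 H]; have /cvgrPdist_lt/(_ e e0) := @cvg_harmonic R.
apply: filterS => n h; apply: H; last by rewrite /= oppr_lt0.
by rewrite /= opprK add0r; move: h; rewrite /= sub0r normrN.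
Qed.

Lemma integrand_right_bound t : 0 < t -> exists2 M, 0 <= M &
  forall x, t < x -> x < t + 1 -> `|c x - c t| <= M * (x - t).
Proof.
move=> t0; exists (`|slope c (t / 2) t| + `|slope c t (t + 1)|); first exact: addr_ge0.
move=> x tx xt.
have t20 : 0 < t / 2 by rewrite divr_gt0.
have t2t : t / 2 < t by lra.
have H1 := slope_lt Gg t20 t2t tx; have H2 := slope_ltr Gg t0 tx xt.
have H3 := slope_sub c tx.
have xt0 : 0 < x - t by rewrite subr_gt0.
have H4 : slope c (t / 2) t * (x - t) <= c x - c t.
  by rewrite H3 [c t + _]addrC addrK ler_pM2r// ltW.
have H5 : c x - c t <= slope c t (t + 1) * (x - t).
  by rewrite H3 [c t + _]addrC addrK ler_pM2r// ltW.
have := ler_norm (slope c t (t + 1)); have := ler_norm (- slope c (t / 2) t).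
rewrite normrN => n1 n2.
have n1' := normr_ge0 (slope c (t / 2) t); have n2' := normr_ge0 (slope c t (t + 1)).
rewrite ler_norml; apply/andP; split.
  apply: le_trans H4; rewrite -mulNr ler_pM2r//; lra.
apply: (le_trans H5); rewrite ler_pM2r//; lra.
Qed.

Lemma integrand_cvg_right t : 0 <= t -> gamma x @[x --> t^'+] --> gamma t.
Proof.
rewrite le_eqVlt => /predU1P[<-|t0]; first by case: (Gg).
have [M M0 H] := integrand_right_bound t0.
rewrite (integrandE Gg t0); apply: cvg_EFin.
  near=> x; case: (Gg) => _ + _ _ _; apply.
  by apply: (lt_trans t0); near: x; exact: nbhs_right_gt.
apply/cvgrPdist_le => e e0; near=> x.
have tx : t < x by near: x; exact: nbhs_right_gt.
have x1 : x < t + 1 by near: x; apply: nbhs_right_lt; rewrite ltrDl.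
have xe : x < t + e / (M + 1).
  by near: x; apply: nbhs_right_lt; rewrite ltrDl divr_gt0// ltr_wpDl.
rewrite distrC; apply: (le_trans (H x tx x1)).
have M1 : 0 < M + 1 by rewrite ltr_wpDl.
have : (x - t) * (M + 1) < e by rewrite -ltr_pdivlMr//; lra.
have : 0 < x - t by rewrite subr_gt0.
nra.
Unshelve. all: by end_near. Qed.

Lemma conjugate_le_posrat r M :
  (forall i, r * posrat i - c (posrat i) <= M) -> (conj r <= M%:E)%E.
Proof.
move=> H; apply: (conjugate_le Gg) => t t0; rewrite leNgt; apply/negP => lt.
have [K K0 HK] := integrand_right_bound t0.
pose e := r * t - c t - M; pose k := K + `|r| + 1.
have e0 : 0 < e by rewrite subr_gt0.
have k0 : 0 < k by rewrite ltr_wpDl// addr_ge0.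
pose d := Num.min 1 (e / k).
have d0 : 0 < d by rewrite lt_min ltr01 divr_gt0.
have [i /andP[ti id]] := @posrat_dense t (t + d) (ltW t0) (ltr_pwDr d0 (lexx t)).
have i1 : posrat i < t + 1 by rewrite (lt_le_trans id)// lerD2l ge_min lexx.
have := HK _ ti i1; rewrite ler_norml => /andP[_ h].
have it0 : 0 < posrat i - t by rewrite subr_gt0.
have : (posrat i - t) * k < e.
  rewrite -ltr_pdivlMr// ltrBlDl (lt_le_trans id)// lerD2l ge_min lexx orbT//.
have := H i; have := ler_wpM2r (ltW it0) (ler_norm (- r)); rewrite normrN /k /e /=.
rewrite /= in h *; nra.
Qed.

(** The index set does not depend on [gamma]. This gives measurability of the conjugate in z, and
    later allows competitors to be improved by constants. *)
Lemma conjugate_posrat r :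
  conj r = ereal_sup (range (fun i => (r * posrat i)%:E - gamma (posrat i))%E).
Proof.
apply/eqP; rewrite eq_le; apply/andP; split; last first.
  by apply: ub_ereal_sup => _ [i _ <-]; exact: conjugate_ge.
case E : (ereal_sup _) => [M||]; last 2 first.
- exact: leey.
- exfalso; have : (-oo < (r * posrat 0)%:E - gamma (posrat 0))%E.
    by rewrite (integrandE Gg) ?posrat_gt0// ltNyr.
  rewrite ltNge => /negP; apply; rewrite -E; apply: ereal_sup_ubound; by exists 0%N.
- apply: conjugate_le_posrat => i.
  rewrite -lee_fin -E; apply: ereal_sup_ubound; exists i => //.
  by rewrite (integrandE Gg)// posrat_gt0.
Qed.

Lemma rquot_seq_cvg t : 0 < t ->
  n.+1%:R * (fine (gamma (t + harmonic n)) - fine (gamma t)) @[n --> \oo] --> Rd t.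
Proof.
move=> t0; have := cvg_comp _ _ cvg_harmonic_at_right (rquot_cvg Gg t0).
by rewrite /comp/=; under eq_fun do rewrite invrK.
Qed.

Lemma lquot_seq_cvg t : 0 < t ->
  - n.+1%:R * (fine (gamma (t - harmonic n)) - fine (gamma t)) @[n --> \oo] --> Ld t.
Proof.
move=> t0; have := cvg_comp _ _ cvg_harmonic_at_left (lquot_cvg Gg t0).
by rewrite /comp/=; under eq_fun do rewrite invrN invrK.
Qed.

Lemma rderiv0_seq_cvg : (Rd (harmonic n))%:E @[n --> \oo] --> rderiv gamma 0.
Proof. exact: (cvg_comp _ _ cvg_harmonic_at_right (rderiv0_cvg Gg)). Qed.

End sequential.

(** * Measurable selections from the integrand *)

Section measurable_integrands.
Context {d : measure_display} {Z : measurableType d} {R : realType}.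
Variable beta : Z -> R -> \bar R.
Hypothesis hbeta : is_B beta.
Implicit Types (f s t r : Z -> R).

Let Gg z : is_Gamma (beta z). Proof. by case: hbeta. Qed.

(** The integrand is measurable in z only for constant second argument, so f is replaced by
    countably many grid values. The successor in the numerator puts them strictly above f, as
    continuity is used from the right. *)
Lemma measurable_grid (u : Z -> R -> \bar R) (k : nat) f : (forall x, measurable_fun setT (u ^~ x)) ->
  measurable_fun setT f -> (forall z, 0 <= f z) ->
  measurable_fun setT (fun z => u z ((Num.truncn (k.+1%:R * f z)).+1%:R / k.+1%:R)).
Proof.
move=> mu mf f0.
have mkf : measurable_fun setT (fun z => k.+1%:R * f z) by exact: measurable_funM.
pose E (j : nat) := (fun z => k.+1%:R * f z) @^-1` `[j%:R, j.+1%:R[%classic.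
have mE j : measurable (E j) by rewrite -[E j]setTI; exact: mkf.
have -> : [set: Z] = \bigcup_j E j.
  apply/seteqP; split=> // z _; exists (Num.truncn (k.+1%:R * f z)) => //=.
  by rewrite /E /= in_itv/=; apply: Num.Theory.truncn_itv; rewrite mulr_ge0.
apply/measurable_fun_bigcup => // j.
apply: (eq_measurable_fun (fun z => u z (j.+1%:R / k.+1%:R))); last exact: measurable_funTS.
move=> z; rewrite inE /E /= in_itv/= => h.
by rewrite (truncn_def h).
Qed.

Lemma grid_cvg (x : R) : 0 <= x ->
  (Num.truncn (k.+1%:R * x)).+1%:R / k.+1%:R @[k --> \oo] --> x^'+.
Proof.
move=> x0 A [e /= e0 H].
have /cvgrPdist_lt/(_ e e0) := @cvg_harmonic R.
apply: filterS => k; rewrite /= sub0r normrN gtr0_norm// => he.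
have /Num.Theory.truncn_itv/andP[h1 h2] : 0 <= k.+1%:R * x by rewrite mulr_ge0.
have k0 : (0 : R) < k.+1%:R by [].
have gt : x < (Num.truncn (k.+1%:R * x)).+1%:R / k.+1%:R by rewrite ltr_pdivlMr// mulrC.
apply: H => //=; rewrite distrC gtr0_norm ?subr_gt0//; apply: le_lt_trans he.
rewrite lerBlDr ler_pdivrMr// mulrDl mulVf ?gt_eqF// [x * _]mulrC -natr1.
by rewrite [1 + _]addrC lerD2r.
Qed.

Lemma measurable_integrand_ge0 f : measurable_fun setT f -> (forall z, 0 <= f z) ->
  measurable_fun setT (fun z => beta z (f z)).
Proof.
move=> mf f0.
apply: (emeasurable_fun_cvg (fun k z => beta z ((Num.truncn (k.+1%:R * f z)).+1%:R / k.+1%:R))).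
  by move=> k; apply: measurable_grid => //; case: hbeta.
move=> z _; exact: (cvg_comp _ _ (grid_cvg (f0 z)) (integrand_cvg_right (Gg z) (f0 z))).
Qed.

Lemma measurable_integrand f : measurable_fun setT f ->
  measurable_fun setT (fun z => beta z (f z)).
Proof.
move=> mf.
rewrite (_ : (fun z => _) = (fun z => if f z < 0 then +oo%E else beta z (Num.max (f z) 0))).
  apply: measurable_fun_ifT => //; first exact: measurable_fun_ltr.
  apply: measurable_integrand_ge0; first exact: measurable_maxr.
  by move=> z; rewrite le_max lexx orbT.
apply/funext => z; case: ltP => // fz.
by case: (Gg z) => _ _ _ + _; apply.
Qed.

Lemma measurable_rquot_lim t : measurable_fun setT t -> (forall z, 0 < t z) ->
  measurable_fun setT (fun z => right_quotient_lim (beta z) (t z)).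
Proof.
move=> mt t0.
apply: (@measurable_fun_cvg _ _ _ _ (fun k z =>
  k.+1%:R * (fine (beta z (t z + harmonic k)) - fine (beta z (t z))))).
  move=> k; apply: measurable_funM => //; apply: measurable_funB.
    apply: measurableT_comp => //; apply: measurable_integrand.
    exact: measurable_funD.
  by apply: measurableT_comp => //; exact: measurable_integrand.
by move=> z _; exact: (rquot_seq_cvg (Gg z)).
Qed.

Lemma measurable_lquot_lim t : measurable_fun setT t -> (forall z, 0 < t z) ->
  measurable_fun setT (fun z => left_quotient_lim (beta z) (t z)).
Proof.
move=> mt t0.
apply: (@measurable_fun_cvg _ _ _ _ (fun k z =>
  - k.+1%:R * (fine (beta z (t z - harmonic k)) - fine (beta z (t z))))).
  move=> k; apply: measurable_funM => //; apply: measurable_funB.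
    apply: measurableT_comp => //; apply: measurable_integrand.
    exact: measurable_funB.
  by apply: measurableT_comp => //; exact: measurable_integrand.
by move=> z _; exact: (lquot_seq_cvg (Gg z)).
Qed.

(** The value 1 where t is not positive meets the positivity hypotheses of the two lemmas above; it
    is discarded afterwards. *)
Let pos t z := if 0 < t z then t z else 1.

Let mpos t : measurable_fun setT t -> measurable_fun setT (pos t).
Proof. by move=> mt; apply: measurable_fun_ifT => //; exact: measurable_fun_ltr. Qed.

Let pos_gt0 t z : 0 < pos t z. Proof. by rewrite /pos; case: ifP. Qed.

Lemma measurable_rderiv t : measurable_fun setT t ->
  measurable_fun setT (fun z => rderiv (beta z) (t z)).
Proof.
move=> mt.
rewrite (_ : (fun z => _) = (fun z => if 0 < t z then
    (right_quotient_lim (beta z) (pos t z))%:E else rderiv (beta z) 0)); last first.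
  by apply/funext => z; rewrite /rderiv /pos ltxx; case: ifP.
apply: measurable_fun_ifT; first exact: measurable_fun_ltr.
  apply/measurable_EFinP; apply: measurable_rquot_lim; [exact: mpos|exact: pos_gt0].
apply: (emeasurable_fun_cvg (fun k z => (right_quotient_lim (beta z) (harmonic k))%:E)).
  by move=> k; apply/measurable_EFinP; apply: measurable_rquot_lim => // z; exact: harmonic_gt0.
by move=> z _; exact: rderiv0_seq_cvg.
Qed.

Lemma measurable_lderiv t : measurable_fun setT t ->
  measurable_fun setT (fun z => lderiv (beta z) (t z)).
Proof.
move=> mt.
rewrite (_ : (fun z => _) = (fun z => if 0 < t z then
    (left_quotient_lim (beta z) (pos t z))%:E else -oo%E)); last first.
  by apply/funext => z; rewrite /lderiv /pos; case: ifP.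
apply: measurable_fun_ifT => //; first exact: measurable_fun_ltr.
by apply/measurable_EFinP; apply: measurable_lquot_lim; [exact: mpos|exact: pos_gt0].
Qed.

Lemma measurable_sgn_deriv r t : measurable_fun setT r -> measurable_fun setT t ->
  measurable_fun setT (fun z => sgn_deriv (beta z) (r z) (t z)).
Proof.
move=> mr mt; apply: measurable_fun_ifT; first exact: measurable_fun_ler.
  exact: measurable_rderiv.
exact: measurable_lderiv.
Qed.

Lemma measurable_bregman s t : measurable_fun setT s -> measurable_fun setT t ->
  measurable_fun setT (fun z => bregman_integrand (beta z) (s z) (t z)).
Proof.
move=> ms mt; apply: measurable_fun_ifT => //.
  by apply: measurable_or; exact: measurable_fun_ltr.
apply: measurable_fun_ifT.
- move=> mT; apply: (measurable_fun_bool true) => //; rewrite preimage_true.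
  by apply: emeasurable_fin_num => //; exact: measurable_rderiv.
- have mst : measurable_fun setT (fun z => s z - t z) by exact: measurable_funB.
  apply: emeasurable_funB.
    by apply: emeasurable_funB; exact: measurable_integrand.
  by apply: emeasurable_funM; [exact: measurable_sgn_deriv|exact/measurable_EFinP].
- by apply: emeasurable_funM => //; exact/measurable_EFinP.
Qed.

Lemma measurable_conjugate r : measurable_fun setT r ->
  measurable_fun setT (fun z => conjugate (beta z) (r z)).
Proof.
move=> mr.
rewrite (_ : (fun z => _) = (fun z => esups (fun i => (r z * posrat i)%:E - beta z (posrat i))%E 0%N)).
  apply: measurable_fun_esups => i; apply: emeasurable_funB.
    by apply/measurable_EFinP; exact: measurable_funM.
  by case: hbeta => + _; apply.
apply/funext => z; rewrite (conjugate_posrat (Gg z)) /esups/=; congr ereal_sup.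
by apply/seteqP; split=> x [i _ <-]; exists i.
Qed.

(** By monotonicity of the conjugate, differentiability at r means finiteness at r + 1/(k+1) for
    some k, which makes E measurable; on E the derivative is a sequential limit of quotients. *)
Lemma measurable_derive_conjugate r (D : set Z) : measurable_fun setT r -> measurable D ->
  measurable_fun setT (fun z => if `[< D z /\ ediff (conjugate (beta z)) (r z) >]
    then derive1 (fine \o conjugate (beta z)) (r z) else 0).
Proof.
move=> mr mD.
pose E := D `&` \bigcup_k [set z | (conjugate (beta z) (r z + harmonic k) < +oo)%E].
have mE : measurable E.
  apply: measurableI => //; apply: bigcup_measurable => k _.
  rewrite -[X in measurable X]setTI; apply: emeasurable_fun_infty_o => //.
  by apply: measurable_conjugate; exact: measurable_funD.
have EP z : E z <-> D z /\ ediff (conjugate (beta z)) (r z).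
  split=> [[Dz [k _ fk]]|[Dz [/(conjugate_fin_nearP (Gg z))[e e0 fe] _]]].
    by split=> //; have [] := conjugate_ediff (Gg z) (harmonic_gt0 k) fk.
  split=> //; have /cvgrPdist_lt/(_ e e0)[k _ /(_ k (leqnn k))] := @cvg_harmonic R.
  rewrite /= sub0r normrN gtr0_norm// => he; exists k => //=.
  by apply: le_lt_trans fe; apply: (conjugate_homo (Gg z)); rewrite lerD2l ltW.
have -> : (fun z => if `[< D z /\ ediff (conjugate (beta z)) (r z) >]
    then derive1 (fine \o conjugate (beta z)) (r z) else 0) =
  (fun z => derive1 (fine \o conjugate (beta z)) (r z)) \_ E.
  apply/funext => z; rewrite patchE; case: asboolP => [/EP Ez|nEz].
    by rewrite mem_set.
  by rewrite memNset// => /EP.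
apply/(measurable_restrictT _ mE).
pose q k z := k.+1%:R * (fine (conjugate (beta z) (harmonic k + r z)) - fine (conjugate (beta z) (r z))).
apply: (@measurable_fun_cvg _ _ _ _ q).
  move=> k; apply: measurable_funTS; apply: measurable_funM => //; apply: measurable_funB.
    apply: measurableT_comp => //; apply: measurable_conjugate.
    exact: measurable_funD.
  by apply: measurableT_comp => //; exact: measurable_conjugate.
move=> z Ez; have [_ [/(conjugate_fin_nearP (Gg z))[e e0 fe] _]] := (EP z).1 Ez.
have [_ am] := conjugate_ediff (Gg z) e0 fe.
have /cvg_dnbhs_at_right H := conjugate_diff_cvg (Gg z) am.
have := cvg_comp _ _ (@cvg_harmonic_at_right R) H.
by rewrite /comp/=; under eq_fun do rewrite invrK.
Qed.

End measurable_integrands.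

(** * Cones and faces in finite dimension *)

Section finite_dimension.
Context {R : realType} {n : nat}.
Implicit Types (x y u v : 'rV[R]_n) (L K C : set 'rV[R]_n).

Lemma dotDr x u v : dot x (u + v) = dot x u + dot x v.
Proof. by rewrite /dot -big_split; apply: eq_bigr => i _; rewrite mxE mulrDr. Qed.

Lemma dotZr x u (t : R) : dot x (t *: u) = t * dot x u.
Proof. by rewrite /dot mulr_sumr; apply: eq_bigr => i _; rewrite mxE mulrCA. Qed.

Lemma dotDl x u v : dot (u + v) x = dot u x + dot v x.
Proof. by rewrite /dot -big_split; apply: eq_bigr => i _; rewrite mxE mulrDl. Qed.

Lemma dotZl x u (t : R) : dot (t *: u) x = t * dot u x.
Proof. by rewrite /dot mulr_sumr; apply: eq_bigr => i _; rewrite mxE mulrA. Qed.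

Lemma dotNr x u : dot x (- u) = - dot x u.
Proof. by rewrite -scaleN1r dotZr mulN1r. Qed.

Lemma dotBr x u v : dot x (u - v) = dot x u - dot x v.
Proof. by rewrite dotDr dotNr. Qed.

Definition subspace L := L 0 /\ forall (t : R) u v, L u -> L v -> L (t *: u + v).

Lemma subspaceZ L t u : subspace L -> L u -> L (t *: u).
Proof. by move=> [L0 H] Lu; rewrite -[t *: u]addr0; exact: H. Qed.

Lemma subspaceD L u v : subspace L -> L u -> L v -> L (u + v).
Proof. by move=> [L0 H] Lu Lv; rewrite -[u]scale1r; exact: H. Qed.

Lemma subspaceB L u v : subspace L -> L u -> L v -> L (u - v).
Proof. by move=> sL Lu Lv; apply: subspaceD => //; rewrite -scaleN1r; exact: subspaceZ. Qed.

Lemma subspace_sum L (I : Type) (s : seq I) (P : pred I) (f : I -> 'rV[R]_n) :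
  subspace L -> (forall i, L (f i)) -> L (\sum_(i <- s | P i) f i).
Proof.
by move=> sL H; elim/big_ind: _ => //; [case: sL|move=> ? ?; exact: subspaceD].
Qed.

(** A matrix of maximal rank with rows in L has row space L, since a vector of L outside it could be
    appended and raise the rank. Its cokernel matrix gives the equations of L. *)
Lemma subspace_kernel L : subspace L -> exists A : 'M[R]_n, forall x, L x <-> x *m A = 0.
Proof.
move=> sL; pose P k := `[< exists M : 'M[R]_n, (forall i, L (row i M)) /\ \rank M = k >].
have P0 : exists k, P k.
  exists 0%N; apply/asboolP; exists 0; split; last exact: mxrank0.
  by move=> i; rewrite row0; case: sL.
have Pn k : P k -> (k <= n)%N by move=> /asboolP[M [_ <-]]; exact: rank_leq_row.
case: (ex_maxnP P0 Pn) => k /asboolP[M [LM rM]] kmax.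
have sub p (N : 'M[R]_(p, n)) v : (forall i, L (row i N)) -> (v <= N)%MS -> L v.
  move=> LN /submxP[D ->]; rewrite mulmx_sum_row.
  by apply: subspace_sum => // i; exact: subspaceZ.
exists (cokermx M) => x; split=> [Lx|/eqP]; last by rewrite -submxE; exact: sub.
apply/eqP; rewrite -submxE; apply: contraT => xM.
have : (\rank <<col_mx M x>> <= k)%N.
  apply: kmax; apply/asboolP; exists <<col_mx M x>>%MS; split=> // i.
  apply: (sub _ (col_mx M x)); last by rewrite (submx_trans (row_sub _ _))// genmxE.
  move=> j; case: (split_ordP j) => j' ->.
    by rewrite rowKu.
  by rewrite rowKd row_id.
rewrite leqNgt => /negP[]; rewrite genmxE -rM ltn_neqAle.
have MS : (M <= col_mx M x)%MS by rewrite -addsmxE addsmxSl.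
rewrite mxrankS// andbT (mxrank_leqif_sup MS).2.
by apply: contra xM; apply: submx_trans; rewrite -addsmxE addsmxSr.
Qed.

(** The flag of coordinate subspaces; it carries the inductions that would otherwise run over the
    dimension. *)
Definition vanish_from (k : nat) x := forall i : 'I_n, (k <= i)%N -> x 0 i = 0.

Lemma vanish_from0 x : vanish_from 0 x -> x = 0.
Proof. by move=> H; apply/rowP => i; rewrite H// mxE. Qed.

Lemma vanish_fromS (i : 'I_n) x : vanish_from i.+1 x -> x 0 i = 0 -> vanish_from i x.
Proof.
move=> H xi j; rewrite leq_eqVlt => /predU1P[ij|]; last exact: H.
by rewrite -xi; congr (x 0 _); exact/val_inj.
Qed.

Lemma vanish_fromD k (t s : R) x y : vanish_from k x -> vanish_from k y ->
  vanish_from k (t *: x + s *: y).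
Proof. by move=> hx hy i ki; rewrite !mxE hx// hy// !mulr0 addr0. Qed.

Definition convex_cone K := (forall u v, K u -> K v -> K (u + v)) /\
  (forall (t : R) u, 0 < t -> K u -> K (t *: u)).

(* Clearing the coordinates one at a time: elements of K near u, e and -e, where
   e has k-th coordinate 1, combine to an element of K near u with k-th
   coordinate 0. *)
Lemma dense_cone_slices K L : convex_cone K -> subspace L -> K `<=` L ->
  (forall u, L u -> forall e : R, 0 < e -> exists2 v, K v & forall i, `|u 0 i - v 0 i| < e) ->
  forall k, (k <= n)%N -> forall u, L u -> vanish_from (n - k) u -> forall e : R, 0 < e ->
    exists2 v, K v /\ vanish_from (n - k) v & forall i, `|u 0 i - v 0 i| < e.
Proof.
move=> [KD KZ] sL KL dK; elim=> [|k IH] kn u Lu vu e e0.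
  have [v Kv uv] := dK u Lu e e0; exists v => //; split=> // i; rewrite subn0.
  by rewrite leqNgt ltn_ord.
have mk : (n - k.+1 < n)%N by lia.
pose m := Ordinal mk.
have mE : (n - k = m.+1)%N by rewrite /=; lia.
have {}IH : forall u, L u -> vanish_from m.+1 u -> forall e : R, 0 < e ->
    exists2 v, K v /\ vanish_from m.+1 v & forall i, `|u 0 i - v 0 i| < e.
  by rewrite -mE; apply: IH; exact: ltnW.
rewrite -[(n - k.+1)%N]/(m : nat) in vu *.
have vu' : vanish_from m.+1 u by move=> i mi; apply: vu; exact: ltnW.
have [[w [Lw vw wm]]|noe] := pselect (exists w, [/\ L w, vanish_from m.+1 w & w 0 m != 0]);
    last first.
  have [v [Kv vv] uv] := IH u Lu vu' e e0; exists v => //; split=> //.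
  apply: vanish_fromS => //; apply: contrapT => /eqP vm; apply: noe; exists v.
  by split=> //; exact: KL.
pose e1 := (w 0 m)^-1 *: w.
have Le1 : L e1 by exact: subspaceZ.
have ve1 : vanish_from m.+1 e1 by move=> i mi; rewrite mxE (vw i mi) mulr0.
have e1m : e1 0 m = 1 by rewrite mxE mulVf.
have half0 : (0 : R) < 1 / 2 by rewrite divr_gt0.
have [vp [Kp vvp] hp] := IH e1 Le1 ve1 _ half0.
have Lm : L (- e1) by rewrite -scaleN1r; exact: subspaceZ.
have vm1 : vanish_from m.+1 (- e1) by move=> i mi; rewrite mxE ve1// oppr0.
have [vn [Kn vvn] hn] := IH _ Lm vm1 _ half0.
have pm : 1 / 2 < vp 0 m by have := hp m; rewrite e1m ltr_norml => /andP[]; lra.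
have nm : vn 0 m < - (1 / 2) by have := hn m; rewrite mxE e1m ltr_norml => /andP[]; lra.
pose B := \sum_i (`|vp 0 i| + `|vn 0 i|).
have B0 : 0 <= B by apply: sumr_ge0 => i _; exact: addr_ge0.
have HB i : `|vp 0 i| <= B /\ `|vn 0 i| <= B.
  suff : `|vp 0 i| + `|vn 0 i| <= B.
    by have := normr_ge0 (vp 0 i); have := normr_ge0 (vn 0 i); split; lra.
  rewrite /B (bigD1 i)//= lerDl; apply: sumr_ge0 => j _; exact: addr_ge0.
(* The error is eta from v plus at most 2 eta B from the correction: its coefficient is at most 2
   eta because |v_m| < eta while the m-th coordinates of vp and vn exceed 1/2 in absolute value. *)
pose eta := e / (1 + 2 * B).
have B1 : 0 < 1 + 2 * B by lra.
have eta0 : 0 < eta by rewrite divr_gt0.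
have etaE : eta + 2 * eta * B = e by rewrite /eta; field; rewrite gt_eqF.
have [v [Kv vv] uv] := IH u Lu vu' eta eta0.
have vmeta : `|v 0 m| < eta by have := uv m; rewrite (vu m (leqnn _)) sub0r normrN.
have key w' (t : R) : K w' -> vanish_from m.+1 w' -> 0 < t -> t <= 2 * eta ->
    (forall i, `|w' 0 i| <= B) -> v 0 m + t * w' 0 m = 0 ->
    exists2 v0, K v0 /\ vanish_from m v0 & forall i, `|u 0 i - v0 0 i| < e.
  move=> Kw' vw' t0 te wB E; exists (v + t *: w').
    split; first by apply: KD => //; exact: KZ.
    apply: vanish_fromS; last by rewrite !mxE.
    by rewrite -[v]scale1r; exact: vanish_fromD.
  move=> i; rewrite !mxE -etaE opprD addrA; apply: (le_lt_trans (ler_normB _ _)).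
  apply: ltr_leD => //; rewrite normrM gtr0_norm//; apply: ler_pM => //.
  exact: ltW.
have [v0|v0|v0] := ltgtP (v 0 m) 0.
- apply: (key vp (- v 0 m / vp 0 m)) => //.
  + by apply: divr_gt0; [rewrite oppr_gt0|lra].
  + rewrite ltr0_norm// in vmeta; rewrite ler_pdivrMr; nra.
  + by move=> i; exact: (HB i).1.
  + by rewrite divfK ?subrr// gt_eqF//; lra.
- apply: (key vn (v 0 m / - vn 0 m)) => //.
  + by apply: divr_gt0 => //; lra.
  + rewrite gtr0_norm// in vmeta; rewrite ler_pdivrMr; nra.
  + by move=> i; exact: (HB i).2.
  + by rewrite invrN mulrN mulNr divfK ?subrr// lt_eqF//; lra.
- exists v; first by split=> //; exact: vanish_fromS.
  move=> i; apply: (lt_le_trans (uv i)); rewrite -etaE lerDl.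
  by rewrite mulr_ge0// mulr_ge0// ltW.
Qed.

(** Induction on the number of possibly nonzero coordinates. Approximating u within |u_m| in its
    slice gives v in K whose m-th coordinate has the sign of u_m; subtracting a positive multiple of
    v clears that coordinate, and the rest is in K by induction. *)
Lemma dense_cone K L : convex_cone K -> subspace L -> K `<=` L ->
  (forall u, L u -> forall e : R, 0 < e -> exists2 v, K v & forall i, `|u 0 i - v 0 i| < e) ->
  L `<=` K.
Proof.
move=> cK sL KL dK; have slices := dense_cone_slices cK sL KL dK.
have [KD KZ] := cK.
suff H k : (k <= n)%N -> forall u, L u -> vanish_from k u -> K u.
  by move=> u Lu; apply: (H n) => // i; rewrite leqNgt ltn_ord.
elim: k => [|k IH] kn u Lu vu.
  have [v [Kv vv] _] : exists2 v, K v /\ vanish_from 0 v & forall i, `|u 0 i - v 0 i| < 1.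
    by have := slices n (leqnn n) u Lu; rewrite subnn => /(_ vu 1 ltr01).
  by rewrite (vanish_from0 vu) -(vanish_from0 vv).
pose m := Ordinal kn.
have [um|um] := eqVneq (u 0 m) 0.
  by apply: IH => //; [exact: ltnW|exact: (@vanish_fromS m)].
have um0 : 0 < `|u 0 m| by rewrite normr_gt0.
have [v [Kv vv] uv] : exists2 v, K v /\ vanish_from k.+1 v &
    forall i, `|u 0 i - v 0 i| < `|u 0 m|.
  by have := slices (n - k.+1)%N (leq_subr _ _) u Lu; rewrite subKn// => /(_ vu _ um0).
have s0 : 0 < u 0 m / v 0 m.
  have := uv m; rewrite ltr_norml; move: um; rewrite neq_lt => /orP[h|h] /andP[h1 h2].
    rewrite ltr0_norm// in h1 h2.
    by rewrite -mulrNN -invrN; apply: divr_gt0; lra.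
  rewrite gtr0_norm// in h1 h2.
  by apply: divr_gt0; lra.
rewrite -[u](subrK ((u 0 m / v 0 m) *: v)); apply: KD; last exact: KZ.
apply: IH; first exact: ltnW.
  by apply: subspaceB => //; apply: subspaceZ => //; exact: KL.
apply: (@vanish_fromS m).
  by rewrite -[u]scale1r -scaleNr; exact: vanish_fromD.
rewrite !mxE divfK ?subrr//; apply: contraTneq s0 => ->.
by rewrite invr0 mulr0 ltxx.
Qed.

(* Hahn-Banach for a cone in R^n x R, extending over one coordinate at a time;
   the symmetry hypothesis makes the interval of admissible slopes nonempty. *)
Lemma cone_minorant (E : 'rV[R]_n -> R -> Prop) :
  (forall x y s t, E x s -> E y t -> E (x + y) (s + t)) ->
  (forall x s t, 0 < t -> E x s -> E (t *: x) (t * s)) ->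
  (forall s, E 0 s -> 0 <= s) ->
  (forall x s, E x s -> exists t, E (- x) t) ->
  exists vt, forall x s, E x s -> dot vt x <= s.
Proof.
move=> ED EZ E0 Esym.
suff H k : (k <= n)%N -> exists vt, forall x s, vanish_from k x -> E x s -> dot vt x <= s.
  have [vt Hvt] := H n (leqnn n).
  by exists vt => x s; apply: Hvt => i; rewrite leqNgt ltn_ord.
elim: k => [_|k IH kn].
  exists 0 => x s /vanish_from0 -> /E0; rewrite -(scale0r (0 : 'rV[R]_n)) dotZl.
  by rewrite mul0r.
have [vt Hvt] := IH (ltnW kn); pose m := Ordinal kn.
pose A := [set r | exists x s, [/\ vanish_from k.+1 x, E x s, 0 < x 0 m & r = (s - dot vt x) / x 0 m]].
have cross x y s t : vanish_from k.+1 x -> vanish_from k.+1 y -> E x s -> E y t ->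
    0 < x 0 m -> y 0 m < 0 -> (t - dot vt y) / y 0 m <= (s - dot vt x) / x 0 m.
  move=> vx vy Ex Ey x0 y0.
  have Exy : E (- y 0 m *: x + x 0 m *: y) (- y 0 m * s + x 0 m * t).
    by apply: ED; apply: EZ => //; rewrite oppr_gt0.
  have /Hvt /(_ Exy) : vanish_from k (- y 0 m *: x + x 0 m *: y).
    by apply: (@vanish_fromS m); [exact: vanish_fromD|rewrite !mxE mulNr mulrC addNr].
  rewrite dotDr !dotZr => h.
  rewrite ler_pdivlMr// mulrAC ler_ndivrMr//; lra.
(* If some vector of E in the slice has nonzero m-th coordinate, symmetry provides both signs, so A
   is nonempty and bounded below. Otherwise c is never tested. *)
pose c := inf A.
exists (vt + c *: delta_mx 0 m) => x s vx Ex.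
have -> : dot (vt + c *: delta_mx 0 m) x = dot vt x + c * x 0 m.
  rewrite dotDl dotZl; congr (_ + c * _).
  rewrite /dot (bigD1 m)//= mxE !eqxx mul1r big1 ?addr0// => i im.
  by rewrite mxE (negbTE im) andbF mul0r.
have neg_of y t : vanish_from k.+1 y -> E y t -> exists2 t', vanish_from k.+1 (- y) & E (- y) t'.
  move=> vy Ey; have [t' Et'] := Esym _ _ Ey; exists t' => // i ki.
  by rewrite mxE vy// oppr0.
have [x0|x0|x0] := ltgtP (x 0 m) 0.
- have [t vNx ENx] := neg_of x s vx Ex.
  have Nx0 : 0 < (- x) 0 m by rewrite mxE oppr_gt0.
  have : (s - dot vt x) / x 0 m <= c.
    apply: lb_le_inf; first by exists ((t - dot vt (- x)) / (- x) 0 m), (- x), t.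
    by move=> _ [y [r [vy Ey y0 ->]]]; exact: cross.
  by rewrite ler_ndivrMr//; lra.
- have [t vNx ENx] := neg_of x s vx Ex.
  have Nx0 : (- x) 0 m < 0 by rewrite mxE oppr_lt0.
  have : c <= (s - dot vt x) / x 0 m.
    apply: ge_inf; last by exists x, s.
    exists ((t - dot vt (- x)) / (- x) 0 m) => _ [y [r [vy Ey y0 ->]]].
    exact: cross.
  by rewrite ler_pdivlMr//; lra.
- by rewrite x0 mulr0 addr0; apply: Hvt => //; exact: (@vanish_fromS m).
Qed.

End finite_dimension.

(** * Faces of convex sets and of cones *)

Section faces.
Context {R : realType} {n : nat}.
Implicit Types (x y u v : 'rV[R]_n) (F L K C : set 'rV[R]_n).

Lemma nbhs_rVP x (A : set 'rV[R]_n) :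
  nbhs x A <-> exists2 e : R, 0 < e & forall y, (forall i, `|x 0 i - y 0 i| < e) -> A y.
Proof.
split=> [/nbhs_ballP[e /= e0 H]|[e e0 H]].
  by exists e => // y xy; apply: H; split=> // i j; rewrite ord1; exact: xy.
apply/nbhs_ballP; exists e => //= y [_ xy]; apply: H => i; exact: xy.
Qed.

Definition cvx C := forall x y (t : R), 0 <= t -> t <= 1 -> C x -> C y ->
  C ((1 - t) *: x + t *: y).

Lemma cvxP C : @convex_set R 'rV[R]_n C <-> cvx C.
Proof.
split=> [H x y t t0 t1 Cx Cy|H x y l].
  have := H y x (Itv01 t0 t1); rewrite !inE => /(_ Cy Cx).
  by rewrite addrC.
rewrite !inE => Cx Cy.
have l0 : 0 <= l%:num by [].
have l1 : l%:num <= 1 by [].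
by have := H y x l%:num l0 l1 Cy Cx; rewrite addrC.
Qed.

(** The directions in which C extends both ways from a; convexity makes them a linear space, since a
    small combination of two such moves is the midpoint of longer ones. *)
Lemma cvx_subspace C a : cvx C -> C a ->
  subspace [set u | exists2 e : R, 0 < e & C (a + e *: u) /\ C (a - e *: u)].
Proof.
move=> cC Ca.
have shrink e d u : 0 < d -> d <= e -> C (a + e *: u) -> C (a + d *: u).
  move=> d0 de H; have e0 : 0 < e by exact: lt_le_trans de.
  have -> : a + d *: u = (1 - d / e) *: a + (d / e) *: (a + e *: u).
    by apply/rowP => i; rewrite !mxE; field; rewrite gt_eqF.
  by apply: (cC) => //; [rewrite divr_ge0// ltW|rewrite ler_pdivrMr// mul1r].
split; first by exists 1 => //; rewrite !scaler0 subr0 addr0.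
move=> t u v [e e0 [up um]] [d d0 [vp vm]].
(* The point a + s (t u + v) is the midpoint of a + 2 s t u and a + 2 s v; s is such that both lie
   within the ranges e and d. *)
pose s := Num.min (e / (`|t| + 1)) d / 2.
have t1 : 0 < `|t| + 1 by rewrite ltr_wpDl.
have s0 : 0 < s by rewrite divr_gt0// lt_min d0 divr_gt0.
have sd : 2 * s <= d by rewrite /s mulrC divfK// ge_min lexx orbT.
have se : 2 * s * (`|t| + 1) <= e.
  by rewrite -ler_pdivlMr// /s mulrC divfK// ge_min lexx.
have H w (r : R) : C (a + e *: w) -> C (a - e *: w) -> `|r| <= e -> C (a + r *: w).
  move=> wp wm re; have [r0|r0|->] := ltgtP r 0; last by rewrite scale0r addr0.
    rewrite ltr0_norm// in re; rewrite -[r]opprK scaleNr -scalerN.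
    by apply: (@shrink e) => //; [lra|rewrite scalerN].
  by rewrite gtr0_norm// in re; apply: (@shrink e).
have st : `|2 * s * t| <= e.
  rewrite normrM gtr0_norm; last by rewrite mulr_gt0.
  by apply: le_trans se; rewrite mulrDr mulr1 lerDl mulr_ge0// ltW.
have H2 (r : R) : `|r| <= 2 * s -> C (a + r *: v).
  move=> rs; have [r0|r0|->] := ltgtP r 0; last by rewrite scale0r addr0.
    rewrite ltr0_norm// in rs; rewrite -[r]opprK scaleNr -scalerN.
    by apply: (@shrink d) => //; [lra|lra|rewrite scalerN].
  by rewrite gtr0_norm// in rs; apply: (@shrink d) => //; lra.
exists s => //; split.
  have -> : a + s *: (t *: u + v) =
     (1 - 1 / 2) *: (a + (2 * s * t) *: u) + (1 / 2) *: (a + (2 * s) *: v).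
    by apply/rowP => i; rewrite !mxE; field.
  apply: (cC); rewrite ?divr_ge0 ?ler_pdivrMr ?mul1r ?ler1n//; first exact: H.
  by apply: H2; rewrite gtr0_norm// mulr_gt0.
have -> : a - s *: (t *: u + v) =
   (1 - 1 / 2) *: (a + (- (2 * s * t)) *: u) + (1 / 2) *: (a + (- (2 * s)) *: v).
  by apply/rowP => i; rewrite !mxE; field.
apply: (cC); rewrite ?divr_ge0 ?ler_pdivrMr ?mul1r ?ler1n//.
  by apply: H; rewrite ?normrN.
by apply: H2; rewrite normrN gtr0_norm// mulr_gt0.
Qed.

(** Makes the radius uniform over all directions of L without compactness: a + u is the midpoint of
    a move along e1, which carries the m-th coordinate, and a move whose m-th coordinate
    vanishes. *)
Lemma cvx_ball C a L : cvx C -> C a -> subspace L ->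
  (forall u, L u -> exists2 e : R, 0 < e & C (a + e *: u) /\ C (a - e *: u)) ->
  exists2 e : R, 0 < e & forall u, L u -> (forall i, `|u 0 i| < e) -> C (a + u).
Proof.
move=> cC Ca sL LC.
suff H k : (k <= n)%N -> exists2 e : R, 0 < e &
    forall u, L u -> vanish_from k u -> (forall i, `|u 0 i| < e) -> C (a + u).
  have [e e0 He] := H n (leqnn n); exists e => // u Lu; apply: (He) => // i.
  by rewrite leqNgt ltn_ord.
elim: k => [_|k IH kn].
  by exists 1 => // u _ /vanish_from0 ->; rewrite addr0.
have [e e0 He] := IH (ltnW kn); pose m := Ordinal kn.
have [[w [Lw vw wm]]|noe] := pselect (exists w, [/\ L w, vanish_from m.+1 w & w 0 m != 0]);
    last first.
  exists e => // u Lu vu ue; apply: (He) => //; apply: (@vanish_fromS _ _ m u vu).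
  by apply: contrapT => /eqP um; apply: noe; exists u.
have [e1 [Le1 ve1 e1m]] : exists e1, [/\ L e1, vanish_from m.+1 e1 & e1 0 m = 1].
  exists ((w 0 m)^-1 *: w); split; first exact: subspaceZ.
    by move=> i mi; rewrite mxE (vw i mi) mulr0.
  by rewrite mxE mulVf.
have [d d0 [dp dm]] := LC e1 Le1.
pose B := \sum_i `|e1 0 i|.
have B0 : 0 <= B by exact: sumr_ge0.
have HB i : `|e1 0 i| <= B by rewrite /B (bigD1 i)//= lerDl sumr_ge0.
have B1 : 0 < 1 + B by lra.
pose r := Num.min (d / 2) (e / 2 / (1 + B)).
have r0 : 0 < r by rewrite lt_min !divr_gt0.
have rd : 2 * r <= d.
  have : r <= d / 2 by rewrite ge_min lexx.
  lra.
have re : 2 * r * (1 + B) <= e.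
  have : r <= e / 2 / (1 + B) by rewrite ge_min lexx orbT.
  by rewrite ler_pdivlMr//; lra.
exists r => // u Lu vu ur.
have -> : a + u = (1 - 1 / 2) *: (a + (2 * u 0 m) *: e1) +
    (1 / 2) *: (a + (2 *: u + (- (2 * u 0 m)) *: e1)).
  by apply/rowP => i; rewrite !mxE; field.
apply: (cC); rewrite ?divr_ge0 ?ler_pdivrMr ?mul1r ?ler1n//.
  have um : `|2 * u 0 m| <= d.
    by rewrite normrM gtr0_norm//; apply: le_trans rd; rewrite ler_pM2l// ltW.
  move: um; rewrite ler_norml => /andP[u1 u2].
  have -> : a + (2 * u 0 m) *: e1 =
      (1 - (d + 2 * u 0 m) / (2 * d)) *: (a - d *: e1) + ((d + 2 * u 0 m) / (2 * d)) *: (a + d *: e1).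
    by apply/rowP => i; rewrite !mxE; field; rewrite gt_eqF.
  apply: (cC) => //; first by rewrite divr_ge0//; lra.
  by rewrite ler_pdivrMr ?mulr_gt0//; lra.
apply: (He).
- by apply: subspaceD => //; exact: subspaceZ.
- apply: (@vanish_fromS _ _ m); first exact: vanish_fromD.
  by rewrite mxE [X in X + _]mxE [X in _ + X]mxE e1m mulr1 subrr.
- move=> i; rewrite !mxE; apply: (le_lt_trans (ler_normD _ _)).
  rewrite !normrM normrN normrM gtr0_norm//.
  have := ur i; have := ur m; have := HB i.
  have : `|u 0 m| * `|e1 0 i| <= r * B by apply: ler_pM => //; exact: ltW.
  lra.
Qed.

(** The face is the set of x in C for which the segment from x to a can be prolonged inside C beyond
    a. *)
Lemma face_exists C a : cvx C -> C a -> exists F, is_face C F /\ relint F a.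
Proof.
move=> cC Ca.
pose F := [set x | C x /\ exists2 e : R, 0 < e & C (a - e *: (x - a))].
have shrink e d u : 0 < d -> d <= e -> C (a + e *: u) -> C (a + d *: u).
  move=> d0 de H; have e0 : 0 < e by exact: lt_le_trans de.
  have -> : a + d *: u = (1 - d / e) *: a + (d / e) *: (a + e *: u).
    by apply/rowP => i; rewrite !mxE; field; rewrite gt_eqF.
  by apply: (cC) => //; [rewrite divr_ge0// ltW|rewrite ler_pdivrMr// mul1r].
have Fa : F a by split=> //; exists 1 => //; rewrite subrr scaler0 subr0.
have cF : cvx F.
  move=> x y t t0 t1 [Cx [e e0 xe]] [Cy [d d0 yd]]; split; first exact: cC.
  exists (Num.min e d); first by rewrite lt_min e0.
  set s := Num.min e d; have s0 : 0 < s by rewrite lt_min e0.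
  have -> : a - s *: ((1 - t) *: x + t *: y - a) =
     (1 - t) *: (a + s *: - (x - a)) + t *: (a + s *: - (y - a)).
    by apply/rowP => i; rewrite !mxE; ring.
  apply: (cC) => //.
    by apply: (@shrink e) => //; [rewrite ge_min lexx|rewrite scalerN].
  by apply: (@shrink d) => //; [rewrite ge_min lexx orbT|rewrite scalerN].
exists F; split.
  split; [by exists a|exact/cvxP|by move=> x []|].
  move=> x y seg [t /andP[t0 t1] [Cw [e e0 we]]].
  have Cx : C x.
    have := seg 0; rewrite lexx ler01 => /(_ isT).
    by rewrite /segment_point subr0 scale1r scale0r addr0.
  have Cy : C y.
    have := seg 1; rewrite lexx ler01 => /(_ isT).
    by rewrite /segment_point subrr scale1r scale0r add0r.
  have et : 0 < 1 + e * t by rewrite ltr_wpDr// mulr_ge0// ltW.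
  have et' : 0 < 1 + e * (1 - t) by rewrite ltr_wpDr// mulr_ge0 ?ltW// subr_gt0.
  have Fx : F x.
    split=> //; exists (e * (1 - t) / (1 + e * t)).
      by rewrite divr_gt0// mulr_gt0// subr_gt0.
    (* The weight of y is chosen to cancel the contribution of y to the prolongation through the
       intermediate point, which leaves a prolongation from x. *)
    have -> : a - (e * (1 - t) / (1 + e * t)) *: (x - a) =
        (1 - e * t / (1 + e * t)) *: (a - e *: (segment_point x y t - a)) +
        (e * t / (1 + e * t)) *: y.
      by apply/rowP => i; rewrite !mxE; field; rewrite gt_eqF.
    apply: (cC) => //; first by rewrite divr_ge0 ?ltW// mulr_gt0.
    by rewrite ler_pdivrMr// mul1r lerDr.
  have Fy : F y.
    split=> //; exists (e * t / (1 + e * (1 - t))).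
      by rewrite divr_gt0// mulr_gt0.
    have -> : a - (e * t / (1 + e * (1 - t))) *: (y - a) =
        (1 - e * (1 - t) / (1 + e * (1 - t))) *: (a - e *: (segment_point x y t - a)) +
        (e * (1 - t) / (1 + e * (1 - t))) *: x.
      by apply/rowP => i; rewrite !mxE; field; rewrite gt_eqF.
    apply: (cC) => //.
      by rewrite divr_ge0 ?ltW// mulr_gt0// subr_gt0.
    by rewrite ler_pdivrMr// mul1r lerDr.
  by move=> s /andP[s0 s1]; exact: cF.
pose L := [set u | exists2 e : R, 0 < e & C (a + e *: u) /\ C (a - e *: u)].
have sL : subspace L by exact: cvx_subspace.
have FL x : F x -> L (x - a).
  move=> [Cx [e e0 xe]]; exists (Num.min 1 e); first by rewrite lt_min ltr01.
  have m0 : 0 < Num.min 1 e by rewrite lt_min ltr01.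
  split; last first.
    rewrite -scalerN; apply: (@shrink e) => //; first by rewrite ge_min lexx orbT.
    by rewrite scalerN.
  apply: (@shrink 1) => //; first by rewrite ge_min lexx.
  by rewrite scale1r addrC subrK.
split=> //.
have [e e0 He] := cvx_ball cC Ca sL (fun u Lu => Lu).
apply/nbhs_rVP; exists e => // y ay [k [w [x [w1 Fx yE]]]].
have Ly : L (y - a).
  have -> : y - a = \sum_i w i *: (x i - a).
    under eq_bigr do rewrite scalerBr; rewrite sumrB -yE -scaler_suml w1.
    by rewrite scale1r.
  by apply: subspace_sum => // i; apply: subspaceZ => //; exact: FL.
have [Cy CNy] : C (a + (y - a)) /\ C (a + - (y - a)).
  split; apply: (He) => //.
  - by move=> i; rewrite !mxE distrC.
  - by rewrite -scaleN1r; exact: subspaceZ.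
  - by move=> i; rewrite !mxE normrN distrC.
split; first by rewrite addrC subrK in Cy.
by exists 1 => //; rewrite scale1r.
Qed.

Section cone_face.
Variables (C F : set 'rV[R]_n) (a : 'rV[R]_n).
Hypotheses (C0 : C 0) (CD : forall x y, C x -> C y -> C (x + y)).
Hypothesis CZ : forall (t : R) x, 0 < t -> C x -> C (t *: x).
Hypotheses (fF : is_face C F) (rF : relint F a).

Let cF : cvx F. Proof. by case: fF => _ /cvxP. Qed.

Let FC : F `<=` C. Proof. by case: fF. Qed.

Let Fa : F a. Proof. by case: rF. Qed.

Let CZ0 (t : R) x : 0 <= t -> C x -> C (t *: x).
Proof. by rewrite le_eqVlt => /predU1P[<-|/CZ]; [rewrite scale0r|exact]. Qed.

Lemma face_segment x y (t : R) : C x -> C y -> 0 < t < 1 -> F ((1 - t) *: x + t *: y) -> F x.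
Proof.
move=> Cx Cy t01 Ft; case: (fF) => _ _ _ /(_ x y) H.
have := H _ _ 0; rewrite /segment_point subr0 scale1r scale0r addr0; apply.
- by move=> s /andP[s0 s1]; apply: CD; apply: CZ0 => //; rewrite subr_ge0.
- by exists t.
- by rewrite lexx ler01.
Qed.

Lemma face_cone0 : F 0.
Proof.
apply: (@face_segment 0 (2 *: a) (1 / 2)) => //; first exact/CZ/FC.
  by rewrite divr_gt0//= ltr_pdivrMr// mul1r ltr1n.
by rewrite scaler0 add0r scalerA divfK// scale1r.
Qed.

Lemma face_coneZ (t : R) x : 0 < t -> F x -> F (t *: x).
Proof.
move=> t0 Fx; have Cx := FC Fx; have [t2|t2] := ltP t 2.
  apply: (@face_segment _ ((2 - t) *: x) (1 / 2)); [exact: CZ| |lra|].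
    by apply: CZ => //; rewrite subr_gt0.
  rewrite (_ : _ + _ = x)//.
  by apply/rowP => i; rewrite !mxE; field.
have t1 : 1 < t by lra.
apply: (@face_segment _ 0 (1 - t^-1)) => //; first exact: CZ.
  by rewrite subr_gt0 invf_lt1// t1 gtrDl oppr_lt0 invr_gt0.
rewrite (_ : _ + _ = x)//.
by apply/rowP => i; rewrite !mxE; field; rewrite gt_eqF.
Qed.

(** The sum is the midpoint of 2 x and 2 y. Applied to the moments of g on a set and on its
    complement. *)
Lemma face_summand x y : C x -> C y -> F (x + y) -> F x.
Proof.
move=> Cx Cy Fxy; suff : F (2 *: x).
  move=> /(@face_coneZ (1 / 2)); rewrite scalerA divfK// scale1r; apply.
  by rewrite divr_gt0.
apply: (@face_segment _ (2 *: y) (1 / 2)); [exact: CZ|exact: CZ|lra|].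
rewrite (_ : _ + _ = x + y)//.
by apply/rowP => i; rewrite !mxE; field.
Qed.

Definition face_space := [set u | exists2 e : R, 0 < e & F (a + e *: u) /\ F (a - e *: u)].

Lemma face_space_subspace : subspace face_space.
Proof. exact: cvx_subspace. Qed.

Lemma face_extend x : F x -> exists2 e : R, 0 < e & F (a - e *: (x - a)).
Proof.
move=> Fx; case: rF => _ /nbhs_rVP[e e0 H].
pose B := \sum_i `|x 0 i - a 0 i|.
have B0 : 0 <= B by exact: sumr_ge0.
have HB i : `|x 0 i - a 0 i| <= B by rewrite /B (bigD1 i)//= lerDl sumr_ge0.
have B1 : 0 < 1 + B by lra.
exists (e / (1 + B)); first exact: divr_gt0.
set s := e / (1 + B); have s0 : 0 < s by exact: divr_gt0.
apply: H.
  move=> i; rewrite !mxE opprD opprK addrA subrr add0r normrM gtr0_norm//.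
  have := HB i; have : s * (1 + B) = e by rewrite /s divfK// gt_eqF.
  move=> sB h; have : s * `|x 0 i - a 0 i| <= s * B by rewrite ler_pM2l.
  lra.
exists 2%N, (fun i => if i == 0 then 1 + s else - s), (fun i => if i == 0 then a else x).
split.
- by rewrite !big_ord_recl big_ord0/=; ring.
- by move=> i; case: ifP.
- rewrite !big_ord_recl big_ord0/= addr0.
  by apply/rowP => i; rewrite !mxE; ring.
Qed.

(** F lies in its own direction space because 0 belongs to F. *)
Lemma face_sub_space x : F x -> face_space x.
Proof.
have H y : F y -> face_space (y - a).
  move=> Fy; have [e e0 He] := face_extend Fy.
  exists (Num.min 1 e); first by rewrite lt_min ltr01.
  have m0 : 0 < Num.min 1 e by rewrite lt_min ltr01.
  have m1 : Num.min 1 e <= 1 by rewrite ge_min lexx.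
  have me : Num.min 1 e <= e by rewrite ge_min lexx orbT.
  split.
    have -> : a + Num.min 1 e *: (y - a) = (1 - Num.min 1 e) *: a + Num.min 1 e *: y.
      by apply/rowP => i; rewrite !mxE; ring.
    by apply: cF => //; exact: ltW.
  have -> : a - Num.min 1 e *: (y - a) = (1 - Num.min 1 e / e) *: a +
      (Num.min 1 e / e) *: (a - e *: (y - a)).
    by apply/rowP => i; rewrite !mxE; field; rewrite gt_eqF.
  by apply: cF => //; [rewrite divr_ge0// ltW|rewrite ler_pdivrMr// mul1r].
move=> Fx; have -> : x = (x - a) - (0 - a) by rewrite sub0r opprK subrK.
apply: (subspaceB face_space_subspace); apply: H => //; exact: face_cone0.
Qed.

End cone_face.
End faces.

(** * Integrals and moments *)

Section uintegral.
Context {d : measure_display} {Z : measurableType d} {R : realType}.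
Variable mu : {sigma_finite_measure set Z -> \bar R}.
Implicit Types (D : set Z) (f g w : Z -> \bar R).
Local Open Scope ereal_scope.

Lemma uintegral_ge0 D f : (forall z, D z -> 0 <= f z) ->
  uintegral mu D f = \int[mu]_(z in D) f z.
Proof.
move=> f0; rewrite /uintegral; case: ifPn => // /eqP <-.
by apply: eq_integral => z zD; rewrite (ge0_funeposE f0).
Qed.

Lemma uintegral_integrable D f : measurable D -> mu.-integrable D f ->
  uintegral mu D f = \int[mu]_(z in D) f z.
Proof.
move=> mD fi; rewrite /uintegral; case: ifPn => // /eqP E.
by have := integrable_funepos mD fi; move=> /integrable_lty; rewrite E ltxx => /(_ mD).
Qed.

Lemma integrable_posneg D f : measurable D -> measurable_fun D f ->
  \int[mu]_(z in D) f^\+ z < +oo -> \int[mu]_(z in D) f^\- z < +oo -> mu.-integrable D f.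
Proof.
move=> mD mf fp fn; apply/integrableP; split=> //.
rewrite (_ : (fun z => _) = f^\+ \+ f^\-); last by rewrite -fune_abse.
rewrite ge0_integralD//; first by rewrite lte_add_pinfty.
- exact: measurable_funepos.
- exact: measurable_funeneg.
Qed.

Lemma uintegral_fin_integrable D f : measurable D -> measurable_fun D f ->
  uintegral mu D f \is a fin_num -> mu.-integrable D f.
Proof.
move=> mD mf; rewrite /uintegral; case: ifPn => // fp ffin.
have fp' : \int[mu]_(z in D) f^\+ z < +oo by rewrite ltey.
apply: integrable_posneg => //; rewrite ltey; apply/negP => /eqP E.
by move: ffin; rewrite integralE E addeNy.
Qed.

Lemma uintegral_lty_integrable D f w : measurable D -> measurable_fun D f ->
  mu.-integrable D w -> (forall z, D z -> w z <= f z) ->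
  uintegral mu D f < +oo -> mu.-integrable D f.
Proof.
move=> mD mf wi wf; rewrite /uintegral; case: ifPn => [//|fp _].
apply: integrable_posneg => //; first by rewrite ltey.
apply: le_lt_trans (integral_funeneg_lt_pinfty mD wi).
apply: ge0_le_integral => //.
- exact: measurable_funeneg.
- by apply: measurable_funeneg; exact: (measurable_int mu).
- by move=> z /mem_set; apply: funeneg_le => x /set_mem; exact: wf.
Qed.

Lemma ae_eq_uintegral D f g : measurable D -> measurable_fun D f -> measurable_fun D g ->
  ae_eq mu D f g -> uintegral mu D f = uintegral mu D g.
Proof.
move=> mD mf mg fg; rewrite /uintegral (ae_eq_integral g f mD mf mg fg).
have [Dfgp _] := (ae_eq_funeposneg _ _ _ _).1 fg.
rewrite (ge0_ae_eq_integral mD _ _ _ _ Dfgp)//.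
- exact: measurable_funepos.
- exact: measurable_funepos.
Qed.

End uintegral.

Section real_integrals.
Context {d : measure_display} {Z : measurableType d} {R : realType}.
Variable mu : {measure set Z -> \bar R}.
Implicit Types f g w : Z -> R.

Lemma Rintegral_cvg (f_ : nat -> Z -> R) f g :
  (forall k, measurable_fun setT (f_ k)) -> measurable_fun setT f ->
  mu.-integrable setT (EFin \o g) -> (forall z, f_ ^~ z @ \oo --> f z) ->
  (forall k z, `|f_ k z| <= g z) ->
  (\int[mu]_z f_ k z) @[k --> \oo] --> \int[mu]_z f z.
Proof.
move=> mf_ mf gi cf dom.
have [fi _ H] : [/\ mu.-integrable setT (EFin \o f),
  [sequence (\int[mu]_z `|(f_ n z)%:E - (f z)%:E|)%E]_n @ \oo --> (0 : \bar R)%E &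
  [sequence (\int[mu]_z (f_ n z)%:E)%E]_n @ \oo --> (\int[mu]_z (f z)%:E)%E].
  apply: (@dominated_convergence _ _ _ mu setT _ (fun n z => (f_ n z)%:E) (EFin \o f) (EFin \o g)) => //.
  - by move=> k; exact/measurable_EFinP.
  - exact/measurable_EFinP.
  - by apply: aeW => z _; apply: cvg_EFin; [exact: nearW|exact: cf].
  - by apply: aeW => z k _; rewrite lee_fin.
by apply: fine_cvg; rewrite fineK//; exact: integrable_fin_num.
Unshelve. all: by end_near. Qed.

Lemma ae_eq_Rintegral f g : measurable_fun setT f -> measurable_fun setT g ->
  (\forall z \ae mu, f z = g z) -> \int[mu]_z f z = \int[mu]_z g z.
Proof.
move=> mf mg fg; rewrite /Rintegral; congr fine; apply: ae_eq_integral => //.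
- exact/measurable_EFinP.
- exact/measurable_EFinP.
- by apply: filterS fg => z -> _.
Qed.

Lemma Rintegral_sum (I : Type) (s : seq I) (F : I -> Z -> R) :
  (forall i, mu.-integrable setT (EFin \o F i)) ->
  \int[mu]_z (\sum_(i <- s) F i z) = \sum_(i <- s) \int[mu]_z F i z.
Proof.
move=> iF; elim: s => [|i s IH].
  under eq_Rintegral do rewrite big_nil; rewrite big_nil.
  by rewrite /Rintegral integral0.
under eq_Rintegral do rewrite big_cons; rewrite big_cons -IH RintegralD//.
rewrite (_ : EFin \o _ = (fun z => \sum_(j <- s) (F j z)%:E)%E).
  by apply: (@integrable_sum _ _ _ _ _ measurableT) => j _; exact: iF.
by apply/funext => z; rewrite /= sumEFin.
Qed.

Lemma EFin_Rintegral f : mu.-integrable setT (EFin \o f) ->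
  (\int[mu]_z f z)%:E = (\int[mu]_z (f z)%:E)%E.
Proof. by move=> fi; rewrite /Rintegral fineK//; exact: integrable_fin_num. Qed.

End real_integrals.

(** * The moment map and the cone of moments *)

Section moments.
Context {d : measure_display} {Z : measurableType d} {R : realType}.
Variable mu : {sigma_finite_measure set Z -> \bar R}.
Context {n : nat}.
Variable phi : Z -> 'rV[R]_n.
Hypothesis mphi : moment_mapping phi.
Implicit Types (g h : Z -> R) (vt x y : 'rV[R]_n) (L : set 'rV[R]_n).

Local Notation G_space := (G_space mu phi).
Local Notation moment := (moment mu phi).
Local Notation Gplus := (Gplus mu phi).

Lemma G_space_lin (s t : R) g h : G_space g -> G_space h -> G_space (fun z => s * g z + t * h z).
Proof.
move=> [mg ig] [mh ih]; split.
  by apply: measurable_funD; exact: measurable_funM.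
move=> i; rewrite (_ : (fun z => _) =
    (fun z => s%:E * (phi z 0 i * g z)%:E + t%:E * (phi z 0 i * h z)%:E)%E); last first.
  by apply/funext => z; rewrite -!EFinM -EFinD; congr (_%:E); ring.
by apply: integrableD => //; exact: integrableZl.
Qed.

Lemma moment_lin (s t : R) g h : G_space g -> G_space h ->
  moment (fun z => s * g z + t * h z) = s *: moment g + t *: moment h.
Proof.
move=> [mg ig] [mh ih]; apply/rowP => i; rewrite !mxE.
under eq_Rintegral do rewrite mulrDr !(mulrCA (phi _ _ _)).
have is_ (u : R) k : mu.-integrable setT (fun z => (phi z 0 i * k z)%:E) ->
   mu.-integrable setT (EFin \o (fun z => u * (phi z 0 i * k z))).
  by move=> ik; exact: (integrableZl measurableT u ik).
rewrite RintegralD; [|exact: measurableT|exact: is_|exact: is_].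
by rewrite (RintegralZl _ measurableT (ig i)) (RintegralZl _ measurableT (ih i)).
Qed.

Lemma G_space_le g h : G_space g -> measurable_fun setT h ->
  (forall z, `|h z| <= `|g z|) -> G_space h.
Proof.
move=> [mg ig] mh hg; split=> // i; apply: le_integrable (ig i) => //.
  by apply/measurable_EFinP; apply: measurable_funM.
by move=> z _; rewrite lee_fin !normrM ler_wpM2l.
Qed.

Lemma G_space_restrict g (A : set Z) : measurable A -> G_space g -> G_space (g \_ A).
Proof.
move=> mA Gg; apply: (G_space_le Gg).
  by apply/(measurable_restrictT _ mA); case: Gg => mg _; exact: measurable_funTS.
by move=> z; rewrite patchE; case: ifP => // _; rewrite normr0.
Qed.

Lemma integrable_dot vt g : G_space g -> mu.-integrable setT (EFin \o (fun z => dot vt (phi z) * g z)).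
Proof.
move=> [mg ig].
rewrite (_ : _ \o _ = (fun z => \sum_(i < n) (vt 0 i)%:E * (phi z 0 i * g z)%:E)%E).
  by apply: (@integrable_sum _ _ _ _ _ measurableT) => i _; exact: integrableZl.
apply/funext => z; rewrite /= /dot mulr_suml -sumEFin; apply: eq_bigr => i _.
by rewrite -EFinM mulrA.
Qed.

Lemma dot_moment vt g : G_space g -> \int[mu]_z (dot vt (phi z) * g z) = dot vt (moment g).
Proof.
move=> [mg ig]; rewrite {2}/dot.
under eq_Rintegral do rewrite /dot mulr_suml.
rewrite Rintegral_sum; last first.
  move=> i; rewrite (_ : _ \o _ = (fun z => (vt 0 i)%:E * (phi z 0 i * g z)%:E)%E).
    exact: integrableZl.
  by apply/funext => z; rewrite /= -EFinM mulrA.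
apply: eq_bigr => i _; rewrite mxE -(RintegralZl _ measurableT (ig i)).
by apply: eq_Rintegral => z _; rewrite mulrA.
Qed.

(** L is the kernel of finitely many functionals, and each of them passes under the integral. *)
Lemma moment_subspace L g : subspace L -> G_space g ->
  (\forall z \ae mu, L (phi z) \/ g z = 0) -> L (moment g).
Proof.
move=> sL Gg Lg; have [A LA] := subspace_kernel sL; apply/LA.
have H x j : (x *m A) 0 j = dot (\row_i A i j) x.
  by rewrite mxE /dot; apply: eq_bigr => i _; rewrite !mxE mulrC.
apply/rowP => j; rewrite H -dot_moment// mxE.
rewrite (@ae_eq_Rintegral _ _ _ _ _ (cst 0)) //.
- by rewrite /Rintegral integral0.
- by have /(measurable_int mu)/measurable_EFinP := integrable_dot (\row_i A i j) Gg.
- by apply: filterS Lg => z [/LA Az|->]; rewrite ?mulr0// -H Az mxE mul0r.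
Qed.

Lemma moment_ae g h : G_space g -> measurable_fun setT h -> (\forall z \ae mu, g z = h z) ->
  G_space h /\ moment h = moment g.
Proof.
move=> [mg ig] mh gh; split.
  split=> // i; apply/integrableP; have /integrableP[_ fin] := ig i.
  have m2 : measurable_fun setT (fun z => (phi z 0 i * h z)%:E).
    by apply/measurable_EFinP; exact: measurable_funM.
  split=> //; rewrite (ae_eq_integral (fun z => `|(phi z 0 i * g z)%:E|%E))//.
  - exact: measurableT_comp.
  - by apply: measurableT_comp => //; exact: (measurable_int mu).
  - by apply: filterS gh => z -> _.
apply/rowP => i; rewrite !mxE; apply: ae_eq_Rintegral => //.
- exact: measurable_funM.
- exact: measurable_funM.
- by apply: filterS gh => z ->.
Qed.

Lemma G_space0 : G_space (fun=> 0).
Proof.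
split=> // i; rewrite (_ : (fun z => _) = cst 0%E); first exact: integrable0.
by apply/funext => z; rewrite mulr0.
Qed.

Lemma phi_cone0 : phi_cone mu phi 0.
Proof.
exists (fun=> 0); first by split=> //; exact: G_space0.
apply/rowP => i; rewrite !mxE; under eq_Rintegral do rewrite mulr0.
by rewrite /Rintegral integral0.
Qed.

Lemma phi_cone_lin (s t : R) x y : 0 <= s -> 0 <= t -> phi_cone mu phi x -> phi_cone mu phi y ->
  phi_cone mu phi (s *: x + t *: y).
Proof.
move=> s0 t0 [g [Gg g0] <-] [h [Gh h0] <-].
exists (fun z => s * g z + t * h z); last exact: moment_lin.
split; first exact: G_space_lin.
by move=> z; rewrite addr_ge0// mulr_ge0.
Qed.

Lemma phi_coneD x y : phi_cone mu phi x -> phi_cone mu phi y -> phi_cone mu phi (x + y).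
Proof.
by move=> hx hy; rewrite -[x]scale1r -[y]scale1r; exact: phi_cone_lin.
Qed.

Lemma phi_coneZ (t : R) x : 0 < t -> phi_cone mu phi x -> phi_cone mu phi (t *: x).
Proof.
move=> t0 hx; rewrite -[t *: x]addr0 -(scale0r x); apply: phi_cone_lin => //.
exact: ltW.
Qed.

Lemma phi_cone_cvx : cvx (phi_cone mu phi).
Proof. by move=> x y t t0 t1; apply: phi_cone_lin => //; rewrite subr_ge0. Qed.

Lemma Gplus_restrict g (A : set Z) : measurable A -> Gplus g -> Gplus (g \_ A).
Proof.
move=> mA [Gg g0]; split; first exact: G_space_restrict.
by move=> z; rewrite patchE; case: ifP.
Qed.

Lemma moment_restrictC g (A : set Z) : measurable A -> G_space g ->
  moment g = moment (g \_ A) + moment (g \_ (~` A)).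
Proof.
move=> mA Gg; rewrite -[moment (g \_ A)]scale1r -[moment (g \_ ~` A)]scale1r -moment_lin.
- congr (Defs.moment _ _ _); apply/funext => z; rewrite !patchE in_setC.
  by case: (z \in A); rewrite /= !mul1r ?addr0 ?add0r.
- exact: G_space_restrict.
- by apply: G_space_restrict => //; exact: measurableC.
Qed.

Definition box (l u : 'rV[R]_n) : set 'rV[R]_n := [set x | forall i, l 0 i <= x 0 i <= u 0 i].

Lemma measurable_box l u : measurable (phi @^-1` box l u).
Proof.
have -> : phi @^-1` box l u = \bigcap_i [set z | l 0 i <= phi z 0 i <= u 0 i].
  by apply/seteqP; split => z h i; [move=> _|]; exact: h.
apply: fin_bigcap_measurable => // i _.
have -> : [set z | l 0 i <= phi z 0 i <= u 0 i] = setT `&` (fun z => phi z 0 i) @^-1` `[l 0 i, u 0 i]%classic.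
  by rewrite setTI; apply/seteqP; split=> z /=; rewrite in_itv.
exact: mphi.
Qed.

(** Countably many grid cubes fill the complement of a closed set. This serves twice: for
    measurability of its preimage, and to reduce vanishing off T to one cube at a time. *)
Lemma closedC_boxes (A : set 'rV[R]_n) : closed A -> exists l u : nat -> 'rV[R]_n,
  ~` A = \bigcup_j (if `[< box (l j) (u j) `&` A = set0 >] then box (l j) (u j) else set0).
Proof.
move=> cA.
(* An index codes a mesh 1/(k+1) and the integer corner of a cube of that mesh. *)
pose cd (j : nat) : nat * 'rV[int]_n := odflt (0%N, 0) (unpickle j).
exists (fun j => \row_i (((cd j).2 0 i)%:~R / (cd j).1.+1%:R)),
       (fun j => \row_i (((cd j).2 0 i + 1)%:~R / (cd j).1.+1%:R)).
apply/seteqP; split=> [x Ax|x [j _]]; last first.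
  case: asboolP => // BA xB Ax.
  by have : (set0 : set 'rV[R]_n) x by rewrite -BA.
have : nbhs x (~` A).
  by apply: open_nbhs_nbhs; split=> //; exact: closed_openC.
move=> /nbhs_rVP[e e0 H].
have /cvgrPdist_lt/(_ e e0)[k _ /(_ k (leqnn k))] := @cvg_harmonic R.
rewrite /= sub0r normrN gtr0_norm// => ke.
pose c : 'rV[int]_n := \row_i Num.floor (k.+1%:R * x 0 i).
exists (pickle (k, c)) => //; rewrite /cd pickleK /=.
have k0 : (0 : R) < k.+1%:R by [].
have inb y : box (\row_i ((c 0 i)%:~R / k.+1%:R)) (\row_i ((c 0 i + 1)%:~R / k.+1%:R)) y ->
    forall i, (c 0 i)%:~R <= k.+1%:R * y 0 i <= (c 0 i + 1)%:~R.
  move=> yb i; have := yb i; rewrite !mxE ler_pdivrMr// ler_pdivlMr//.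
  by rewrite [y 0 i * _]mulrC.
have xb : box (\row_i ((c 0 i)%:~R / k.+1%:R)) (\row_i ((c 0 i + 1)%:~R / k.+1%:R)) x.
  move=> i; rewrite !mxE ler_pdivrMr// ler_pdivlMr// [x 0 i * _]mulrC.
  by rewrite Num.Theory.floor_le /= ltW// Num.Theory.floorD1_gt.
rewrite asboolT//; apply/seteqP; split=> // y [yb Ay]; apply: (H y) => // i.
apply: le_lt_trans ke; rewrite -[_^-1]mul1r ler_pdivlMr//.
rewrite -(gtr0_norm k0) -normrM mulrBl ler_norml.
have /andP[] := inb _ yb i; have /andP[] := inb _ xb i.
rewrite intrD [x 0 i * _]mulrC [y 0 i * _]mulrC; lra.
Qed.

Lemma measurable_closed_preimage (A : set 'rV[R]_n) : closed A -> measurable (phi @^-1` A).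
Proof.
move=> cA; rewrite -[phi @^-1` A]setCK; apply: measurableC; rewrite preimage_setC.
have [l [u ->]] := closedC_boxes cA; rewrite preimage_bigcup.
apply: bigcup_measurable => j _; case: ifP => _; first exact: measurable_box.
by rewrite preimage_set0.
Qed.

End moments.

(** * Functions with moment in a face vanish off the face *)

Section face_moments.
Context {d : measure_display} {Z : measurableType d} {R : realType}.
Variable mu : {sigma_finite_measure set Z -> \bar R}.
Context {n : nat}.
Variable phi : Z -> 'rV[R]_n.
Hypothesis mphi : moment_mapping phi.
Variables (F : set 'rV[R]_n) (a : 'rV[R]_n).
Hypotheses (fF : is_face (phi_cone mu phi) F) (rF : relint F a).
Implicit Types (g h : Z -> R) (vt x y : 'rV[R]_n).

Local Notation G_space := (G_space mu phi).
Local Notation moment := (moment mu phi).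
Local Notation Gplus := (Gplus mu phi).
Local Notation T := (on_face phi F).
Local Notation C := (phi_cone mu phi).

Let C0 : C 0 := phi_cone0 mu phi.
Let CD x y (Cx : C x) (Cy : C y) : C (x + y) := phi_coneD Cx Cy.
Let CZ (t : R) x (t0 : 0 < t) (Cx : C x) : C (t *: x) := phi_coneZ t0 Cx.

Lemma measurable_on_face : measurable T.
Proof. by apply: (measurable_closed_preimage mphi); exact: closed_closure. Qed.

(** The moment of g on the box is a summand of the moment of g, so it lies in F. Were the mass of g
    on the box positive, dividing by it would give a barycenter lying both in the box and in F. The
    mass is finite because 0 belongs to F: the box misses 0, so some coordinate is bounded away from
    0 on it. *)
Lemma ae_zero_box g l u : Gplus g -> F (moment g) -> box l u `&` closure F = set0 ->
  \forall z \ae mu, box l u (phi z) -> g z = 0.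
Proof.
move=> Gg Fg disj; pose A := phi @^-1` box l u.
have mA : measurable A by exact: measurable_box.
pose k := g \_ A.
have [Gk k0] : Gplus k by exact: Gplus_restrict.
have mk : measurable_fun setT k by case: Gk.
have Fk : F (moment k).
  apply: (@face_summand _ _ _ _ C0 CD CZ fF _ (moment (g \_ ~` A))).
  - by exists k.
  - by exists (g \_ ~` A) => //; apply: Gplus_restrict => //; exact: measurableC.
  - by rewrite -moment_restrictC//; case: Gg.
have [i [e e0 ei]] : exists i : 'I_n, exists2 e : R, 0 < e & forall y, box l u y -> e <= `|y 0 i|.
  apply: contrapT => no.
  suff : (set0 : set 'rV[R]_n) 0 by [].
  rewrite -disj; split; last first.
    by apply: subset_closure; exact: (face_cone0 C0 CD CZ fF rF).
  move=> i; rewrite mxE; apply/negPn/negP; rewrite negb_and -!ltNge => /orP[li|ui].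
    apply: no; exists i, (l 0 i) => // y /(_ i) /andP[ly _].
    exact: (le_trans ly (ler_norm _)).
  apply: no; exists i, (- u 0 i); first by rewrite oppr_gt0.
  move=> y /(_ i) /andP[_ yu]; rewrite -normrN; apply: le_trans (ler_norm _).
  by rewrite lerN2.
have ik : mu.-integrable setT (EFin \o k).
  have [_ /(_ i) iki] := Gk.
  apply: le_integrable (integrableZl measurableT e^-1 iki) => //; first exact/measurable_EFinP.
  move=> z _; rewrite lee_fin !normrM [`|e^-1|]gtr0_norm ?invr_gt0//.
  rewrite /k patchE; case: ifPn => [/set_mem Az|_]; last by rewrite normr0 !mulr0.
  by rewrite ler_pdivlMl// ler_wpM2r// ei.
pose I := \int[mu]_z k z.
have I0 : 0 <= I by apply: Rintegral_ge0 => z _; exact: k0.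
have bound (r : R) j : (forall z, A z -> r <= phi z 0 j) -> r * I <= moment k 0 j.
  move=> H; rewrite -(RintegralZl _ measurableT ik) mxE; apply: le_Rintegral => //.
  - exact: (integrableZl measurableT r ik).
  - by case: Gk => _; apply.
  - move=> z _; rewrite /k patchE; case: ifPn => [/set_mem Az|_]; last by rewrite !mulr0.
    by apply: ler_wpM2r; [case: Gg => _; apply|exact: H].
have bound' (r : R) j : (forall z, A z -> phi z 0 j <= r) -> moment k 0 j <= r * I.
  move=> H; rewrite -(RintegralZl _ measurableT ik) mxE; apply: le_Rintegral => //.
  - by case: Gk => _; apply.
  - exact: (integrableZl measurableT r ik).
  - move=> z _; rewrite /k patchE; case: ifPn => [/set_mem Az|_]; last by rewrite !mulr0.
    by apply: ler_wpM2r; [case: Gg => _; apply|exact: H].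
move: I0; rewrite le_eqVlt => /predU1P[IE|I0]; last first.
  exfalso; suff : (set0 : set 'rV[R]_n) (I^-1 *: moment k) by [].
  rewrite -disj; split; last first.
    apply: subset_closure; apply: (face_coneZ C0 CD CZ fF) => //.
    by rewrite invr_gt0.
  move=> j; rewrite mxE mulrC ler_pdivlMr// ler_pdivrMr//; apply/andP; split.
    by apply: bound => z /(_ j) /andP[].
  by apply: bound' => z /(_ j) /andP[].
have : (\int[mu]_(z in setT) `|(EFin \o k) z|)%E = 0%E.
  under eq_integral do rewrite gee0_abs ?lee_fin//.
  by rewrite -(EFin_Rintegral ik) -/I -IE.
move=> /(ae_eq_integral_abs _ measurableT (measurable_int mu ik)).
apply: filterS => z kz Az; have [] := kz Logic.I.
by rewrite /k patchE mem_set.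
Qed.

Lemma ae_zero_off_face g : Gplus g -> F (moment g) -> \forall z \ae mu, ~ T z -> g z = 0.
Proof.
move=> Gg Fg; have [l [u E]] := closedC_boxes (@closed_closure _ F).
have : \forall z \ae mu, forall j, box (l j) (u j) `&` closure F = set0 ->
    box (l j) (u j) (phi z) -> g z = 0.
  apply: ae_foralln => j.
  have [BF|nBF] := pselect (box (l j) (u j) `&` closure F = set0); last exact: aeW.
  by apply: filterS (ae_zero_box Gg Fg BF) => z.
apply: filterS => z H Tz.
have : (~` closure F) (phi z) by [].
by rewrite E => -[j _]; case: asboolP => // /H.
Qed.

End face_moments.

(** Convexity including the endpoint 0, in terms of real upper bounds so that no extended arithmetic
    arises. *)
Lemma integrand_convex {R : realType} (gamma : R -> \bar R) (s t p q l : R) : is_Gamma gamma ->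
  0 <= s -> 0 <= t -> 0 <= l -> l <= 1 -> (gamma s <= p%:E)%E -> (gamma t <= q%:E)%E ->
  (gamma ((1 - l) * s + l * t)%R <= ((1 - l) * p + l * q)%:E)%E.
Proof.
move=> Gg; have [gNy gfin _ _ _] := Gg.
have fin x r : (gamma x <= r%:E)%E -> gamma x \is a fin_num.
  by move=> h; rewrite fin_numE gNy/= lt_eqF// (le_lt_trans h)// ltry.
have main x y r1 r2 k : 0 <= x -> x < y -> 0 < k -> k < 1 -> (gamma x <= r1%:E)%E ->
    (gamma y <= r2%:E)%E -> (gamma ((1 - k) * x + k * y)%R <= ((1 - k) * r1 + k * r2)%:E)%E.
  move=> x0 xy k0 k1 h1 h2; have f1 := fin _ _ h1; have f2 := fin _ _ h2.
  rewrite -(fineK f1) lee_fin in h1; rewrite -(fineK f2) lee_fin in h2.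
  set m := (1 - k) * x + k * y.
  have yx : 0 < y - x by rewrite subr_gt0.
  have mE : m = x + k * (y - x) by rewrite /m; ring.
  have my : m < y.
    have : k * (y - x) < 1 * (y - x) by rewrite ltr_pM2r.
    by rewrite mE; lra.
  have xm : x < m by rewrite mE ltrDl mulr_gt0.
  have m0 : 0 < m by exact: le_lt_trans xm.
  have := integrand_chord Gg x0 xm my f1.
  have -> : m - x = k * (y - x) by rewrite mE; ring.
  rewrite mulrA ler_pM2r// (integrandE Gg m0) lee_fin /=.
  have k1' : 0 <= 1 - k by lra.
  have := ler_wpM2l (ltW k0) h2; have := ler_wpM2l k1' h1; lra.
move=> s0 t0; rewrite le_eqVlt => /predU1P[<-|l0].
  by rewrite subr0 !mul1r !mul0r !addr0.
rewrite le_eqVlt => /predU1P[->|l1].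
  by rewrite subrr !mul1r !mul0r !add0r.
move=> h1 h2; have [st|ts|E] := ltgtP s t; first exact: main.
  have -> : (1 - l) * s + l * t = (1 - (1 - l)) * t + (1 - l) * s by ring.
  have -> : (1 - l) * p + l * q = (1 - (1 - l)) * q + (1 - l) * p by ring.
  by apply: main => //; lra.
rewrite -E in h2 *; have -> : (1 - l) * s + l * s = s by ring.
have f1 := fin _ _ h1; rewrite -(fineK f1) !lee_fin in h1 h2 *.
have l1' : 0 <= 1 - l by lra.
have := ler_wpM2l (ltW l0) h2; have := ler_wpM2l l1' h1; lra.
Qed.

Section closure_face.
Context {R : realType} {n : nat}.
Implicit Types (x y u v : 'rV[R]_n) (L F : set 'rV[R]_n).

Lemma closure_subspace F L : subspace L -> F `<=` L -> closure F `<=` L.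
Proof.
move=> sL FL x clx; have [A LA] := subspace_kernel sL; apply/LA/rowP => j.
rewrite mxE [RHS]mxE; apply: contrapT => /eqP s0.
set s := \sum_i _ in s0; pose B := \sum_i `|A i j|.
have B0 : 0 <= B by exact: sumr_ge0.
have B1 : 0 < 1 + B by lra.
pose e := `|s| / (1 + B); have e0 : 0 < e by rewrite divr_gt0// normr_gt0.
have /clx [y [Fy xy]] : nbhs x [set y | forall i, `|x 0 i - y 0 i| < e].
  by apply/nbhs_rVP; exists e.
have /LA/rowP/(_ j) := FL _ Fy; rewrite mxE [in X in _ = X -> _]mxE => Ay.
have sE : s = \sum_i (x 0 i - y 0 i) * A i j.
  by under eq_bigr do rewrite mulrBl; rewrite sumrB Ay subr0.
have : `|s| <= e * B.
  rewrite sE /B mulr_sumr; apply: (le_trans (ler_norm_sum _ _ _)).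
  by apply: ler_sum => i _; rewrite normrM ler_wpM2r// ltW// xy.
have : e * (1 + B) = `|s| by rewrite /e divfK// gt_eqF.
lra.
Qed.

End closure_face.

Section finite_measure_exhaustion.
Context {d : measure_display} {Z : measurableType d} {R : realType}.
Variable mu : {sigma_finite_measure set Z -> \bar R}.
Context {n : nat}.
Variable phi : Z -> 'rV[R]_n.
Hypothesis mphi : moment_mapping phi.

(** Intersecting sets of finite measure with bounds on [phi] makes every bounded function on S k
    both integrable and admissible for moments. *)
Lemma bounded_exhaustion : exists S : nat -> set Z,
  [/\ forall k, measurable (S k),
      forall k (g : Z -> R), measurable_fun setT g -> (exists M : R, forall z, S k z -> `|g z| <= M) ->
        mu.-integrable setT (EFin \o (g \_ (S k))) /\ G_space mu phi (g \_ (S k)) &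
      forall z, \forall k \near \oo, S k z].
Proof.
have /sigma_finiteP[S0 [S0T S0nd S0fin]] := sigma_finiteT mu.
pose S k := S0 k `&` \bigcap_i [set z | `|phi z 0 i| <= k%:R].
have mS0 k : measurable (S0 k) by case: (S0fin k).
have mS k : measurable (S k).
  apply: measurableI => //; apply: fin_bigcap_measurable => // i _.
  rewrite -[X in measurable X]setTI.
  rewrite (_ : [set z | _] = (fun z => `|phi z 0 i|) @^-1` `]-oo, k%:R]%classic).
    by apply: measurableT_comp.
  by apply/seteqP; split=> z /=; rewrite in_itv.
have Sfin k : (mu (S k) < +oo)%E.
  case: (S0fin k) => _; apply: le_lt_trans; apply: le_measure; rewrite ?inE//.
  by move=> z [].
exists S; split=> //.
- have bi k (g : Z -> R) M : measurable_fun setT g -> (forall z, S k z -> `|g z| <= M) ->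
      mu.-integrable setT (EFin \o (g \_ (S k))).
    move=> mg gM; have H : mu.-integrable (S k) (EFin \o g).
      apply: measurable_bounded_integrable; [exact: mS|exact: Sfin|exact: measurable_funTS|].
      exists M; split; first exact: num_real.
      by move=> x Mx z /gM h; apply: (le_trans h); exact: ltW.
    have /(integrable_mkcond _ (mS k)) := H.
    by rewrite restrict_EFin.
  move=> k g mg [M gM]; split; first exact: bi gM.
  split; first by apply/(measurable_restrictT _ (mS k)); exact: measurable_funTS.
  move=> i.
  have H : mu.-integrable setT (EFin \o ((fun z => phi z 0 i * g z) \_ (S k))).
    apply: (bi _ _ (k%:R * M)); first exact: measurable_funM.
    move=> z Sz; rewrite normrM ler_pM//; last exact: gM.
    by case: Sz => _ /(_ i); exact.
  apply: eq_integrable H => // z _ /=; rewrite !patchE.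
  by case: ifP => //; rewrite mulr0.
- move=> z; have [k0 _ k0z] : (\bigcup_k S0 k) z by rewrite -S0T.
  pose M := \sum_i `|phi z 0 i|.
  near=> k; split.
    have k0k : (k0 <= k)%N by near: k; exact: nbhs_infty_ge.
    by have /subsetPset := S0nd k0 k k0k; apply.
  move=> i _ /=; apply: (@le_trans _ _ M).
    by rewrite /M (bigD1 i)//= lerDl sumr_ge0.
  by near: k; exact: nbhs_infty_ger.
Unshelve. all: by end_near. Qed.

End finite_measure_exhaustion.

(** * The F(a)-dual problem *)

Section dual_vector.
Context {d : measure_display} {Z : measurableType d} {R : realType}.
Variable mu : {sigma_finite_measure set Z -> \bar R}.
Context {n : nat}.
Variables (phi : Z -> 'rV[R]_n) (beta : Z -> R -> \bar R).
Hypotheses (mphi : moment_mapping phi) (hbeta : is_B beta).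
Variables (F : set 'rV[R]_n) (a : 'rV[R]_n).
Hypotheses (fF : is_face (phi_cone mu phi) F) (rF : relint F a).
Implicit Types (g h : Z -> R) (vt x u v : 'rV[R]_n) (y : R).

Local Notation G_space := (G_space mu phi).
Local Notation moment := (moment mu phi).
Local Notation Gplus := (Gplus mu phi).
Local Notation T := (on_face phi F).
Local Notation C := (phi_cone mu phi).
Local Notation L := (face_space F a).

Let C0 : C 0 := phi_cone0 mu phi.
Let CD x u (Cx : C x) (Cu : C u) : C (x + u) := phi_coneD Cx Cu.
Let CZ (t : R) x (t0 : 0 < t) (Cx : C x) : C (t *: x) := phi_coneZ t0 Cx.
Let Gg z : is_Gamma (beta z). Proof. by case: hbeta. Qed.
Let sL : subspace L := face_space_subspace fF rF.
Let Fa : F a. Proof. by case: rF. Qed.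

Lemma uintegral_le (D : set Z) (f w : Z -> \bar R) : measurable D -> measurable_fun D f ->
  mu.-integrable D w -> (forall z, D z -> (f z <= w z)%E) ->
  (uintegral mu D f <= \int[mu]_(z in D) w z)%E.
Proof.
move=> mD mf wi fw; have mw := measurable_int mu wi.
have Hp : (\int[mu]_(z in D) f^\+ z <= \int[mu]_(z in D) w^\+ z)%E.
  apply: ge0_le_integral => //; [exact: measurable_funepos|exact: measurable_funepos|].
  by move=> z /mem_set; apply: funepos_le => u /set_mem; exact: fw.
rewrite /uintegral; case: ifPn => [/eqP E|_].
  have := le_lt_trans Hp (integral_funepos_lt_pinfty mD wi).
  by rewrite E ltxx.
rewrite integralE [leRHS]integralE; apply: leeB => //.
apply: ge0_le_integral => //; [exact: measurable_funeneg|exact: measurable_funeneg|].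
by move=> z /mem_set; apply: funeneg_le => u /set_mem; exact: fw.
Qed.

Variables (j : R) (g0 : Z -> R).
Hypothesis Jle : forall g, Gplus_at mu phi a g -> (j%:E <= H_functional mu beta g)%E.
Hypotheses (g0a : Gplus_at mu phi a g0) (g0fin : forall z, beta z (g0 z) \is a fin_num).
Hypothesis g0i : mu.-integrable setT (fun z => beta z (g0 z)).

Let psi0 z := fine (beta z (g0 z)).
Let Gg0 : G_space g0. Proof. by case: g0a => -[]. Qed.
Let g00 z : 0 <= g0 z. Proof. by case: g0a => -[]. Qed.
Let mg0 : moment g0 = a. Proof. by case: g0a. Qed.
Let psi0i : mu.-integrable setT (EFin \o psi0).
Proof. by apply: eq_integrable g0i => // z _; rewrite /= fineK. Qed.

Let g0T : \forall z \ae mu, ~ T z -> g0 z = 0.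
Proof. by apply: (ae_zero_off_face mphi fF rF); [case: g0a|rewrite mg0]. Qed.

(* Pairs (moment, upper bound for H), relative to (a, j). *)
Definition adm x (y : R) := exists g, exists2 psi : Z -> R,
  [/\ Gplus g, forall z, ~ T z -> g z = g0 z & moment g = a + x] &
  [/\ mu.-integrable setT (EFin \o psi), forall z, (beta z (g z) <= (psi z)%:E)%E &
      \int[mu]_z psi z = j + y].

(** The cone generated by [adm], that is, by the upper bounds of the value function with the origin
    moved to (a, j). A linear minorant of it is a subgradient at a. *)
Definition adm_cone x (y : R) := exists2 t, 0 < t & adm (t *: x) (t * y).

Lemma adm_convex x1 x2 y1 y2 (l : R) : 0 <= l -> l <= 1 -> adm x1 y1 -> adm x2 y2 ->
  adm ((1 - l) *: x1 + l *: x2) ((1 - l) * y1 + l * y2).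
Proof.
move=> l0 l1 [g1 [p1 [[Gg1 g10] g1T m1] [ip1 b1 E1]]] [g2 [p2 [[Gg2 g20] g2T m2] [ip2 b2 E2]]].
have l1' : 0 <= 1 - l by rewrite subr_ge0.
exists (fun z => (1 - l) * g1 z + l * g2 z), (fun z => (1 - l) * p1 z + l * p2 z).
  split.
  - split; first exact: G_space_lin.
    by move=> z; rewrite addr_ge0// mulr_ge0.
  - by move=> z Tz; rewrite g1T// g2T//; ring.
  - rewrite moment_lin// m1 m2; apply/rowP => i; rewrite !mxE; ring.
have i1 := integrableZl measurableT (1 - l) ip1.
have i2 := integrableZl measurableT l ip2.
split.
- have := integrableD measurableT i1 i2.
  by apply: eq_integrable.
- move=> z; exact: (integrand_convex (Gg z)).
- rewrite RintegralD// (RintegralZl _ measurableT ip1) (RintegralZl _ measurableT ip2) E1 E2.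
  ring.
Qed.

Lemma adm_coneD x1 x2 (y1 y2 : R) : adm_cone x1 y1 -> adm_cone x2 y2 -> adm_cone (x1 + x2) (y1 + y2).
Proof.
move=> [s s0 a1] [t t0 a2]; have st : 0 < s + t by exact: addr_gt0.
exists (s * t / (s + t)); first by rewrite divr_gt0// mulr_gt0.
have := @adm_convex _ _ _ _ (s / (s + t)) _ _ a1 a2.
have -> : (1 - s / (s + t)) *: (s *: x1) + (s / (s + t)) *: (t *: x2) =
    (s * t / (s + t)) *: (x1 + x2).
  by apply/rowP => i; rewrite !mxE; field; rewrite gt_eqF.
have -> : (1 - s / (s + t)) * (s * y1) + (s / (s + t)) * (t * y2) =
    (s * t / (s + t)) * (y1 + y2).
  by field; rewrite gt_eqF.
apply; first by rewrite divr_ge0// ltW.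
by rewrite ler_pdivrMr// mul1r lerDl ltW.
Qed.

Lemma adm_coneZ (t : R) x y : 0 < t -> adm_cone x y -> adm_cone (t *: x) (t * y).
Proof.
move=> t0 [s s0 H]; exists (s / t); first exact: divr_gt0.
by rewrite scalerA mulrA divfK ?gt_eqF.
Qed.

Lemma adm_cone_ge0 (y : R) : adm_cone 0 y -> 0 <= y.
Proof.
move=> [t t0 [g [psi [Ggp gT mg] [ipsi bpsi E]]]].
have ga : Gplus_at mu phi a g by split; rewrite // mg scaler0 addr0.
have H := Jle ga.
have : (j%:E <= (j + t * y)%:E)%E.
  rewrite -E (EFin_Rintegral ipsi); apply: (le_trans H).
  by apply: uintegral_le => //; apply: (measurable_integrand hbeta); case: Ggp => -[].
by rewrite lee_fin lerDl pmulr_rge0.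
Qed.

Lemma face_sub : T `<=` phi @^-1` L.
Proof.
move=> z; apply: closure_subspace => // x Fx.
exact: (face_sub_space C0 CD CZ fF rF).
Qed.

Lemma adm_space x y : adm x y -> L x.
Proof.
move=> [g [psi [[G1 g1] gT mg] _]].
have -> : x = moment g - a by rewrite mg addrC addKr.
apply: subspaceB => //; last exact: (face_sub_space C0 CD CZ fF rF).
apply: moment_subspace => //; apply: filterS g0T => z hz.
have [Tz|Tz] := pselect (T z); first by left; exact: face_sub.
by right; rewrite gT// hz.
Qed.

Definition adm_proj : set 'rV[R]_n := [set x | exists y, adm_cone x y].

Lemma adm_proj_cone : convex_cone adm_proj.
Proof.
split; first by move=> u v [s us] [t vt]; exists (s + t); exact: adm_coneD.
by move=> t u t0 [s us]; exists (t * s); exact: adm_coneZ.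
Qed.

Lemma adm_proj_space : adm_proj `<=` L.
Proof.
move=> x [y [t t0 /adm_space Lx]].
by rewrite -[x]scale1r -(mulVf (lt0r_neq0 t0)) -scalerA; apply: subspaceZ.
Qed.

(* Moving half-way from g0 towards p on a set B where p has finite cost. *)
Lemma adm_bump (B : set Z) (p q : Z -> R) : measurable B -> B `<=` T -> (forall z, 0 <= p z) ->
  G_space (p \_ B) -> mu.-integrable setT (EFin \o (q \_ B)) ->
  (forall z, B z -> (beta z (p z) <= (q z)%:E)%E) ->
  adm_proj (moment (p \_ B) - moment (g0 \_ B)).
Proof.
move=> mB BT p0 GpB iq bq.
have G0B : G_space (g0 \_ B) by exact: G_space_restrict.
have ip0B : mu.-integrable setT (EFin \o (psi0 \_ B)).
  rewrite -restrict_EFin; apply/(integrable_mkcond _ mB).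
  by apply: (@integrableS _ _ _ _ setT) => //.
pose g z := 1 * g0 z + 1 * (- (1 / 2) * (g0 \_ B) z + (1 / 2) * (p \_ B) z).
have GgB := G_space_lin (- (1 / 2)) (1 / 2) G0B GpB.
have Gg' : G_space g by exact: G_space_lin.
have gE z : g z = if z \in B then (1 - 1 / 2) * g0 z + (1 / 2) * p z else g0 z.
  by rewrite /g !patchE; case: ifP => _; field.
pose psi z := psi0 z + (- (1 / 2) * (psi0 \_ B) z + (1 / 2) * (q \_ B) z).
have psiE z : psi z = if z \in B then (1 - 1 / 2) * psi0 z + (1 / 2) * q z else psi0 z.
  by rewrite /psi !patchE; case: ifP => _; field.
(* The competitor moves half the displacement; the scale 1/2 of the cone records this, and the
   factor 2 compensates for it in the cost. *)
exists (2 * (\int[mu]_z psi z - j)); exists (1 / 2); first by rewrite divr_gt0.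
exists g, psi; split.
- split=> // z; rewrite gE; case: ifP => // _.
  by rewrite addr_ge0// mulr_ge0// ?subr_ge0 ?ler_pdivrMr ?mul1r ?ler1n ?divr_ge0.
- by move=> z Tz; rewrite gE; case: ifPn => // /set_mem /BT.
- rewrite moment_lin// moment_lin// mg0 !scale1r; congr (_ + _).
  by apply/rowP => i; rewrite !mxE; ring.
- have := integrableD measurableT psi0i (integrableD measurableT
    (integrableZl measurableT (- (1 / 2)) ip0B) (integrableZl measurableT (1 / 2) iq)).
  by apply: eq_integrable.
- move=> z; rewrite gE psiE; case: ifPn => [/set_mem Bz|_]; last by rewrite /psi0 fineK.
  apply: (integrand_convex (Gg z)) => //; last exact: bq.
  + by rewrite ler_pdivrMr// mul1r ler1n.
  + by rewrite /psi0 fineK.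
- by rewrite mulrA divfK// mul1r addrC subrK.
Qed.

Definition near_adm u := forall e : R, 0 < e -> exists2 v, adm_proj v & forall i, `|u 0 i - v 0 i| < e.

Lemma near_adm_cvg (u : nat -> 'rV[R]_n) x : (forall k, near_adm (u k)) ->
  (forall i, u k 0 i @[k --> \oo] --> x 0 i) -> near_adm x.
Proof.
move=> nu ux e e0; have e20 : 0 < e / 2 by rewrite divr_gt0.
have [k Hk] : exists k, forall i, `|x 0 i - u k 0 i| < e / 2.
  have : \forall k \near \oo, forall i, `|x 0 i - u k 0 i| < e / 2.
    apply: filter_forall => i; have /cvgrPdist_lt/(_ _ e20) := ux i; exact.
  by case=> k _ /(_ k (leqnn k)) Hk; exists k.
have [v Kv uv] := nu k _ e20; exists v => // i.
have -> : x 0 i - v 0 i = (x 0 i - u k 0 i) + (u k 0 i - v 0 i) by ring.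
apply: (le_lt_trans (ler_normD _ _)).
have := Hk i; have := uv i; lra.
Qed.

Lemma near_adm_proj u : adm_proj u -> near_adm u.
Proof. by move=> Ku e e0; exists u => // i; rewrite subrr normr0. Qed.

Lemma moment_cvg (w_ : nat -> Z -> R) (w W : Z -> R) : G_space W -> (forall k, measurable_fun setT (w_ k)) ->
  measurable_fun setT w -> (forall z, w_ k z @[k --> \oo] --> w z) ->
  (forall k z, `|w_ k z| <= `|W z|) ->
  forall i, moment (w_ k) 0 i @[k --> \oo] --> moment w 0 i.
Proof.
move=> [mW iW] mw_ mw cw wW i.
under eq_fun do rewrite mxE; rewrite mxE.
apply: (@Rintegral_cvg _ _ _ mu _ _ (fun z => `|phi z 0 i * W z|)).
- by move=> k; exact: measurable_funM.
- exact: measurable_funM.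
- exact: (integrable_norm (iW i)).
- by move=> z; apply: cvgM; [exact: cvg_cst|exact: cw].
- by move=> k z; rewrite !normrM ler_wpM2l.
Qed.

Lemma moment_restrictB (A : set Z) g h : G_space (g \_ A) -> G_space (h \_ A) ->
  moment ((fun z => g z - h z) \_ A) = moment (g \_ A) - moment (h \_ A).
Proof.
move=> GA hA; rewrite -[moment (g \_ A)]scale1r -scaleN1r -moment_lin//.
congr (Defs.moment _ _ _); apply/funext => z; rewrite !patchE.
by case: ifP => _; rewrite mul1r mulN1r ?subrr.
Qed.

(** Three limits in succession: the cost bound m, the shift e, and the exhausting sets S k. In each
    of them the moments converge by domination, with a majorant built from h, [g0] and a constant on
    S k. *)
Lemma near_adm_moment h : Gplus h -> F (moment h) -> near_adm (moment h - a).
Proof.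
move=> [Gh h0] Fh; have mh : measurable_fun setT h by case: Gh.
have mg0' : measurable_fun setT g0 by case: Gg0.
have mT : measurable T by exact: measurable_on_face.
have hT := ae_zero_off_face mphi fF rF (conj Gh h0 : Gplus h) Fh.
have [S [mS bS Sz]] := bounded_exhaustion mu mphi.
pose D k := T `&` S k; have mD k : measurable (D k) by exact: measurableI.
have G1 k (c : R) : G_space (fun z => ((fun=> c) : Z -> R) \_ (S k) z).
  have cM : exists M : R, forall z, S k z -> `|c| <= M by exists `|c|.
  by have [] := bS k (fun=> c) (measurable_cst c) cM.
have GWk k (c : R) : G_space (fun z => 1 * (1 * h z + 1 * g0 z) + 1 * ((fun=> c) \_ (S k)) z).
  by apply: G_space_lin => //; exact: G_space_lin.
(* Where h vanishes its cost may be +oo, so h is approached by h + e on D k, and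
   this in turn through sets where the cost of h + e is bounded. *)
have step1 k (e : R) : 0 < e -> near_adm (moment ((fun z => h z + e - g0 z) \_ (D k))).
  move=> e0; pose p z := h z + e.
  have mp : measurable_fun setT p by exact: measurable_funD.
  pose B m := D k `&` [set z | `|fine (beta z (p z))| <= m%:R].
  have mB m : measurable (B m).
    apply: measurableI => //; rewrite -[X in measurable X]setTI.
    rewrite (_ : [set z | _] = (fun z => `|fine (beta z (p z))|) @^-1` `]-oo, m%:R]%classic).
      apply: measurableT_comp => //; apply: measurableT_comp => //.
      exact: measurable_integrand.
    by apply/seteqP; split=> z /=; rewrite in_itv.
  have G1D m : G_space (p \_ (B m)).
    have H : G_space (fun z => 1 * h z + 1 * ((fun=> e) \_ (S k)) z) by exact: G_space_lin.
    apply: (G_space_le mphi H).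
      by apply/(measurable_restrictT _ (mB m)); exact: measurable_funTS.
    move=> z; rewrite !patchE !mul1r; case: ifPn => [/set_mem [[_ Sk] _]|_].
      by rewrite mem_set.
    by rewrite normr0.
  have mpg : measurable_fun setT (fun z => p z - g0 z) by exact: measurable_funB.
  apply: (@near_adm_cvg (fun m => moment ((fun z => p z - g0 z) \_ (B m)))).
    move=> m; apply: near_adm_proj; rewrite moment_restrictB//; last exact: G_space_restrict.
    pose q z := fine (beta z (p z)).
    apply: (adm_bump (q := q)) => //.
    - by move=> z [[]].
    - by move=> z; rewrite addr_ge0// ltW.
    - have qB : exists M : R, forall z, S k z -> `|(q \_ (B m)) z| <= M.
        exists m%:R => z _; rewrite patchE; case: ifPn => [/set_mem[]//|_].
        by rewrite normr0.
      have mqB : measurable_fun setT (q \_ (B m)).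
        apply/(measurable_restrictT _ (mB m)); apply: measurable_funTS.
        by apply: measurableT_comp => //; exact: measurable_integrand.
      have [+ _] := bS k _ mqB qB; apply: eq_integrable => // z _ /=.
      rewrite !patchE; case: ifPn => // zS; case: ifPn => // /set_mem[[_ Sz'] _].
      by rewrite mem_set in zS.
    - move=> z Bz; rewrite /q (integrandE (Gg z))//=.
      by rewrite ltr_wpDl.
  apply: (moment_cvg (GWk k e)).
  - by move=> m; apply/(measurable_restrictT _ (mB m)); exact: measurable_funTS.
  - by apply/(measurable_restrictT _ (mD k)); exact: measurable_funTS.
  - move=> z; have [Dz|nDz] := pselect (D k z); last first.
      rewrite patchE memNset//; apply: cvg_near_cst; apply: nearW => m.
      by rewrite patchE memNset// => -[].
    rewrite patchE mem_set//; apply: cvg_near_cst; near=> m.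
    rewrite patchE mem_set//; split=> //=.
    by near: m; exact: nbhs_infty_ger.
  - move=> m z; rewrite !patchE; case: ifPn => [/set_mem[[_ Sk] _]|_].
      rewrite mem_set// !mul1r /p [X in _ <= X]ger0_norm; last by have := h0 z; have := g00 z; lra.
      by rewrite ler_norml; have := h0 z; have := g00 z; lra.
    by rewrite normr0.
have mhg : measurable_fun setT (fun z => h z - g0 z) by exact: measurable_funB.
have step2 k : near_adm (moment ((fun z => h z - g0 z) \_ (D k))).
  apply: (near_adm_cvg (fun m => step1 k _ (harmonic_gt0 m))).
  apply: (moment_cvg (GWk k 1)).
  - move=> m; apply/(measurable_restrictT _ (mD k)); apply: measurable_funTS.
    by apply: measurable_funB => //; exact: measurable_funD.
  - by apply/(measurable_restrictT _ (mD k)); exact: measurable_funTS.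
  - move=> z; rewrite patchE; case: ifPn => zD; last first.
      by under eq_fun do rewrite patchE (negbTE zD); exact: cvg_cst.
    under eq_fun do rewrite patchE zD.
    apply: cvgB; last exact: cvg_cst.
    rewrite -[X in _ --> X]addr0; apply: cvgD; first exact: cvg_cst.
    exact: cvg_harmonic.
  - move=> m z; rewrite !patchE; case: ifPn => [/set_mem[_ Sk]|_].
      have m1 : harmonic m <= 1 :> R by rewrite /= invf_le1// ler1n.
      have m0 := @harmonic_gt0 R m.
      rewrite mem_set// !mul1r [X in _ <= X]ger0_norm; last by have := h0 z; have := g00 z; lra.
      by rewrite ler_norml; have := h0 z; have := g00 z; lra.
    by rewrite normr0.
have mom g : G_space g -> (\forall z \ae mu, ~ T z -> g z = 0) -> moment (g \_ T) = moment g.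
  move=> G1g gT; apply: (moment_ae mphi G1g _ _).2.
    by case: (G_space_restrict mphi mT G1g).
  apply: filterS gT => z; rewrite patchE; case: ifPn => // zT; apply.
  by move=> Tz; rewrite mem_set in zT.
have -> : moment h - a = moment ((fun z => h z - g0 z) \_ T).
  rewrite -mg0 moment_restrictB; [|exact: G_space_restrict|exact: G_space_restrict].
  by rewrite !mom.
apply: (near_adm_cvg step2).
have GW : G_space (fun z => 1 * h z + 1 * g0 z) by exact: G_space_lin.
apply: (moment_cvg GW).
- by move=> k; apply/(measurable_restrictT _ (mD k)); exact: measurable_funTS.
- by apply/(measurable_restrictT _ mT); exact: measurable_funTS.
- move=> z; have [Tz|nTz] := pselect (T z); last first.
    rewrite patchE memNset//; apply: cvg_near_cst; apply: nearW => m.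
    by rewrite patchE memNset// => -[].
  rewrite patchE mem_set//; apply: cvg_near_cst; apply: filterS (Sz z) => k Skz.
  by rewrite patchE mem_set.
- move=> k z; rewrite !patchE; case: ifPn => [_|_]; last by rewrite normr0.
  rewrite !mul1r [X in _ <= X]ger0_norm; last by rewrite addr_ge0.
  by rewrite ler_norml; have := h0 z; have := g00 z; lra.
Unshelve. all: by end_near. Qed.

Lemma near_adm_space u : L u -> near_adm u.
Proof.
move=> [e e0 [Fe _]].
have [h Gh mh] : C (a + e *: u) by case: (fF) => _ _ FC _; exact: FC.
have : near_adm (moment h - a) by apply: near_adm_moment => //; rewrite mh.
rewrite mh addrC addKr => nu r r0.
have er0 : 0 < e * r by exact: mulr_gt0.
have [v Kv uv] := nu _ er0; exists (e^-1 *: v).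
  by have [_] := adm_proj_cone; apply => //; rewrite invr_gt0.
move=> i; have := uv i; rewrite !mxE => ui.
have -> : u 0 i - e^-1 * v 0 i = e^-1 * (e * u 0 i - v 0 i).
  by field; rewrite gt_eqF.
by rewrite normrM gtr0_norm ?invr_gt0// ltr_pdivrMl.
Qed.

Lemma dual_vector_exists : exists vt, forall x y, adm x y -> dot vt x <= y.
Proof.
have KL : L `<=` adm_proj.
  apply: (dense_cone adm_proj_cone sL adm_proj_space) => u Lu.
  exact: near_adm_space.
have [||||vt H] := @cone_minorant _ _ adm_cone.
- by move=> *; exact: adm_coneD.
- by move=> *; exact: adm_coneZ.
- exact: adm_cone_ge0.
(* The required symmetry: -x lies in the direction space, all of which is now attained. *)
- move=> x s xs; apply: KL; rewrite -scaleN1r; apply: subspaceZ => //.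
  by apply: adm_proj_space; exists s.
exists vt => x y xy; apply: H; exists 1 => //.
by rewrite scale1r mul1r.
Qed.

End dual_vector.

(** * Duality without gap *)

Section dual_optimum.
Context {d : measure_display} {Z : measurableType d} {R : realType}.
Variable mu : {sigma_finite_measure set Z -> \bar R}.
Context {n : nat}.
Variables (phi : Z -> 'rV[R]_n) (beta : Z -> R -> \bar R).
Hypotheses (mphi : moment_mapping phi) (hbeta : is_B beta).
Variables (F : set 'rV[R]_n) (a : 'rV[R]_n).
Hypotheses (fF : is_face (phi_cone mu phi) F) (rF : relint F a).
Implicit Types (g h : Z -> R) (vt x u v : 'rV[R]_n) (y : R).

Local Notation G_space := (G_space mu phi).
Local Notation moment := (moment mu phi).
Local Notation Gplus := (Gplus mu phi).
Local Notation T := (on_face phi F).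

Let Gg z : is_Gamma (beta z). Proof. by case: hbeta. Qed.
Let mT : measurable T. Proof. exact: measurable_on_face. Qed.
Let mTC : measurable (~` T). Proof. exact: measurableC. Qed.

(** A near-minimizer is changed to 1 on the null set where its cost is infinite, so that later
    pointwise arguments meet no exceptional set. *)
Lemma base_point : J_value mu phi beta a \is a fin_num ->
  exists g0, [/\ Gplus_at mu phi a g0, forall z, beta z (g0 z) \is a fin_num &
    mu.-integrable setT (fun z => beta z (g0 z))].
Proof.
move=> Jf.
have [_ [g ga <-] gJ] : exists2 x, [set H_functional mu beta g | g in Gplus_at mu phi a] x &
    (x < J_value mu phi beta a + 1%:E)%E.
  by apply: ereal_inf_lt; rewrite lteDl// lte_fin.
have Hge : (J_value mu phi beta a <= H_functional mu beta g)%E by apply: ereal_inf_lbound; exists g.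
have Hf : H_functional mu beta g \is a fin_num.
  rewrite fin_numE; apply/andP; split.
    rewrite gt_eqF//; apply: lt_le_trans Hge; rewrite -(fineK Jf); exact: ltNyr.
  by rewrite lt_eqF//; apply: (lt_le_trans gJ); exact: leey.
have [[Ggg g0] mg] := ga; have mgf : measurable_fun setT g by case: Ggg.
have mb := measurable_integrand hbeta mgf.
have ib := uintegral_fin_integrable measurableT mb Hf.
have bae := integrable_ae measurableT ib.
pose h z := if beta z (g z) \is a fin_num then g z else 1.
have mh : measurable_fun setT h.
  apply: measurable_fun_ifT => // _.
  by apply: (measurable_fun_bool true) => //; rewrite preimage_true; exact: emeasurable_fin_num.
have gh : \forall z \ae mu, g z = h z.
  by apply: filterS bae => z; rewrite /h => ->.
have [Gh mh'] := moment_ae mphi Ggg mh gh.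
exists h; split.
- split; last by rewrite mh'.
  by split=> // z; rewrite /h; case: ifP.
- by move=> z; rewrite /h; case: ifP => //; case: (Gg z) => _ + _ _ _ => /(_ 1 ltr01).
- have mbh := measurable_integrand hbeta mh.
  apply/integrableP; split=> //; have /integrableP[_] := ib.
  rewrite (ae_eq_integral (fun z => `|beta z (h z)|%E))//.
  + exact: measurableT_comp.
  + exact: measurableT_comp.
  + by apply: filterS gh => z -> _.
Qed.

Variables (j : R) (g0 : Z -> R).
Hypothesis Jj : J_value mu phi beta a = j%:E.
Hypotheses (g0a : Gplus_at mu phi a g0) (g0fin : forall z, beta z (g0 z) \is a fin_num).
Hypothesis g0i : mu.-integrable setT (fun z => beta z (g0 z)).

Let Gg0 : G_space g0. Proof. by case: g0a => -[]. Qed.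
Let g00 z : 0 <= g0 z. Proof. by case: g0a => -[]. Qed.
Let mg0 : moment g0 = a. Proof. by case: g0a. Qed.

Lemma J_le g : Gplus_at mu phi a g -> (j%:E <= H_functional mu beta g)%E.
Proof. by move=> ga; rewrite -Jj; apply: ereal_inf_lbound; exists g. Qed.

Lemma off_face_zero g : Gplus_at mu phi a g -> \forall z \ae mu, ~ T z -> g z = 0.
Proof.
by move=> [Gpg mg]; apply: (ae_zero_off_face mphi fF rF) => //; rewrite mg; case: rF.
Qed.

Lemma integral_split (f : Z -> \bar R) : measurable_fun setT f ->
  (\int[mu]_z f z = \int[mu]_(z in T) f z + \int[mu]_(z in ~` T) f z)%E.
Proof.
move=> mf; rewrite -integral_setU//; last by apply/disj_setPCl.
  by rewrite setUv.
by rewrite setUv.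
Qed.

(** The cost off T, common to all competitors for a since they vanish there almost everywhere. *)
Definition off_cost : R := fine (\int[mu]_(z in ~` T) beta z (g0 z)).

Lemma off_costE g : Gplus_at mu phi a g -> (\int[mu]_(z in ~` T) beta z (g z) = off_cost%:E)%E.
Proof.
move=> ga; rewrite /off_cost fineK; last first.
  by apply: integrable_fin_num => //; apply: integrableS g0i.
have mb h : Gplus_at mu phi a h -> measurable_fun (~` T) (fun z => beta z (h z)).
  move=> [[[mh _] _] _]; apply: measurable_funTS; exact: (measurable_integrand hbeta).
apply: ae_eq_integral; [exact: mTC|exact: mb|exact: mb|].
have := off_face_zero ga; have := off_face_zero g0a; apply: filterS2 => z z1 z2 Tz.
by rewrite z1// z2.
Qed.

Lemma dot_on_face vt g : Gplus_at mu phi a g ->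
  (\int[mu]_(z in T) (dot vt (phi z) * g z)%:E = (dot vt a)%:E)%E.
Proof.
move=> ga; have [[G1 _] mg] := ga; have ig := integrable_dot vt G1.
rewrite -mg -dot_moment// (EFin_Rintegral ig) integral_split; last exact: measurable_int ig.
rewrite [X in (_ + X)%E](ae_eq_integral (cst 0%E)).
- by rewrite integral0 adde0.
- exact: mTC.
- by apply: measurable_funTS; exact: measurable_int ig.
- exact: measurable_cst.
- by apply: filterS (off_face_zero ga) => z gz Tz; rewrite gz// mulr0.
Qed.

Lemma H_on_face g : Gplus_at mu phi a g -> mu.-integrable setT (fun z => beta z (g z)) ->
  H_functional mu beta g = (\int[mu]_(z in T) beta z (g z) + off_cost%:E)%E.
Proof.
move=> ga bi; rewrite /H_functional uintegral_integrable// integral_split ?off_costE//.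
exact: measurable_int bi.
Qed.

Lemma measurable_dot vt : measurable_fun setT (fun z => dot vt (phi z)).
Proof.
rewrite /dot; apply: measurable_sum => i.
by apply: measurable_funM => //; exact: mphi.
Qed.

Lemma measurable_conj vt : measurable_fun setT (fun z => conjugate (beta z) (dot vt (phi z))).
Proof. by apply: measurable_conjugate => //; exact: measurable_dot. Qed.

Definition gain vt g z : \bar R := ((dot vt (phi z) * g z)%:E - beta z (g z))%E.

Lemma gain_integrable vt g : G_space g -> mu.-integrable setT (fun z => beta z (g z)) ->
  mu.-integrable setT (gain vt g).
Proof. by move=> G1 bi; apply: integrableB => //; exact: integrable_dot. Qed.

Lemma gain_on_face vt g : Gplus_at mu phi a g -> mu.-integrable setT (fun z => beta z (g z)) ->
  (\int[mu]_(z in T) gain vt g z = (dot vt a)%:E - \int[mu]_(z in T) beta z (g z))%E.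
Proof.
move=> ga bi; rewrite integralB//.
- by rewrite dot_on_face.
- apply: (@integrableS _ _ _ _ setT) => //; apply: integrable_dot; by case: ga => -[].
- exact: (@integrableS _ _ _ _ setT).
Qed.

Lemma gain_le_conjugate vt g z : (gain vt g z <= conjugate (beta z) (dot vt (phi z)))%E.
Proof. exact: conjugate_ge. Qed.

Lemma K_dual_integral vt : (K_dual mu phi beta F vt < +oo)%E ->
  mu.-integrable T (fun z => conjugate (beta z) (dot vt (phi z))) /\
  K_dual mu phi beta F vt = (\int[mu]_(z in T) conjugate (beta z) (dot vt (phi z)))%E.
Proof.
move=> Kvt; have mc : measurable_fun T (fun z => conjugate (beta z) (dot vt (phi z))).
  by apply: measurable_funTS; exact: measurable_conj.
have wi : mu.-integrable T (gain vt g0).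
  by apply: (@integrableS _ _ _ _ setT) => //; exact: gain_integrable.
have ic := uintegral_lty_integrable mT mc wi (fun z _ => gain_le_conjugate vt g0 z) Kvt.
by split=> //; exact: uintegral_integrable.
Qed.

Lemma weak_duality vt : ((dot vt a)%:E - K_dual mu phi beta F vt <= (j - off_cost)%:E)%E.
Proof.
have [/eqP ->|] := boolP (K_dual mu phi beta F vt == +oo%E); first by rewrite addeNy leNye.
rewrite -ltey => /K_dual_integral[ic Kvt].
have cf := integrable_fin_num mT ic; rewrite Kvt.
rewrite -(fineK cf) -EFinB lee_fin; set cv := fine _.
suff : dot vt a + off_cost - cv <= j by lra.
apply/ler_addgt0Pr => e e0.
have [_ [g ga <-] gJ] : exists2 x, [set H_functional mu beta g | g in Gplus_at mu phi a] x &
    (x < j%:E + e%:E)%E.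
  by apply: ereal_inf_lt; rewrite -/(J_value mu phi beta a) Jj lteDl// lte_fin.
have Hf : H_functional mu beta g \is a fin_num.
  rewrite fin_numE; apply/andP; split.
    by rewrite gt_eqF//; apply: lt_le_trans (J_le ga); exact: ltNyr.
  by rewrite lt_eqF//; apply: (lt_le_trans gJ); exact: leey.
have mg : measurable_fun setT g by case: ga => -[[]].
have bi := uintegral_fin_integrable measurableT (measurable_integrand hbeta mg) Hf.
have G1 : G_space g by case: ga => -[].
have gi := gain_integrable vt G1 bi.
have biT : mu.-integrable T (fun z => beta z (g z)) by exact: (@integrableS _ _ _ _ setT).
have bf := integrable_fin_num mT biT.
have := le_integral mT (integrableS measurableT mT (@subsetT _ T) gi) ic
  (fun z _ => gain_le_conjugate vt g z).
rewrite gain_on_face// -(fineK cf) -(fineK bf) -EFinB lee_fin -/cv.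
move: gJ; rewrite H_on_face// -(fineK bf) -!EFinD lte_fin; lra.
Qed.

(** Invariant of the successive switches; the moment is left free, because the supporting vector
    already accounts for it. *)
Let inv g := [/\ Gplus g, forall z, ~ T z -> g z = g0 z, forall z, beta z (g z) \is a fin_num &
  mu.-integrable setT (EFin \o (fun z => fine (beta z (g z))))].

Lemma inv_switch g (q M : R) (A S : set Z) : inv g -> measurable A -> A `<=` T -> 0 < q ->
  A `<=` S -> (forall h : Z -> R, measurable_fun setT h -> (exists M : R, forall z, S z -> `|h z| <= M) ->
        mu.-integrable setT (EFin \o (h \_ S)) /\ G_space (h \_ S)) ->
  (forall z, A z -> `|fine (beta z q)| <= M) ->
  inv (fun z => if z \in A then q else g z).
Proof.
move=> [[G1 gge0] gT gfin gi] mA AT q0 AS HS HM; set g1 := fun z => _.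
have g1E : g1 = (fun z => 1 * g z + 1 * (- 1 * (g \_ A) z + 1 * ((fun=> q) \_ A) z)).
  by apply/funext => z; rewrite /g1 !patchE; case: ifP => _; ring.
have eA (h : Z -> R) z : S z -> (h \_ A) z = ((h \_ A) \_ S) z.
  by move=> Sz; rewrite [RHS]patchE mem_set.
have AS_E (h : Z -> R) : (h \_ A) \_ S = h \_ A.
  apply/funext => z; rewrite !patchE; case: ifPn => // zS; case: ifPn => // /set_mem /AS Sz.
  by rewrite mem_set in zS.
have mr (h : Z -> R) : measurable_fun setT h -> measurable_fun setT (h \_ A).
  by move=> mh; apply/(measurable_restrictT _ mA); exact: measurable_funTS.
have [_ GqA] : mu.-integrable setT (EFin \o ((fun=> q) \_ A)) /\ G_space ((fun=> q) \_ A).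
  rewrite -AS_E; apply: HS; first by apply: mr; exact: measurable_cst.
  exists `|q| => z _; rewrite patchE; case: ifP => // _; by rewrite normr0.
have mbq : measurable_fun setT (fun z => fine (beta z q)).
  by apply: measurableT_comp => //; case: hbeta.
have [biA _] : mu.-integrable setT (EFin \o ((fun z => fine (beta z q)) \_ A)) /\
    G_space ((fun z => fine (beta z q)) \_ A).
  rewrite -AS_E; apply: HS; first exact: mr.
  exists `|M| => z _; rewrite patchE; case: ifPn => [/set_mem Az|_]; last by rewrite normr0.
  exact: le_trans (HM z Az) (ler_norm _).
split.
- split; last by move=> z; rewrite /g1; case: ifP => // _; exact: ltW.
  rewrite g1E; apply: G_space_lin => //; apply: G_space_lin => //.
  exact: G_space_restrict.
- by move=> z Tz; rewrite /g1; case: ifPn => [/set_mem /AT//|_]; exact: gT.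
- move=> z; rewrite /g1; case: ifP => // _.
  by case: (Gg z) => _ + _ _ _; apply.
- have i1 : mu.-integrable setT (EFin \o ((fun z => fine (beta z (g z))) \_ A)).
    rewrite -restrict_EFin; apply/(integrable_mkcond _ mA).
    by apply: (@integrableS _ _ _ _ setT).
  have := integrableD measurableT gi (integrableB measurableT biA i1).
  apply: eq_integrable => // z _ /=; rewrite /g1 !patchE.
  by case: ifP => _ /=; congr (_%:E); ring.
Qed.

(** Every iterate is admissible, so the hypothesis on vt bounds the integral of its [val] by <vt, a>
    - j. On T these integrands increase to the conjugate, and monotone convergence transfers the
    bound. *)
Lemma interchange vt : (forall x y, adm mu phi beta F a j g0 x y -> dot vt x <= y) ->
  mu.-integrable T (fun z => conjugate (beta z) (dot vt (phi z))) /\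
  (\int[mu]_(z in T) conjugate (beta z) (dot vt (phi z)) <= (dot vt a - j + off_cost)%:E)%E.
Proof.
move=> Hvt; pose val z t : R := dot vt (phi z) * t - fine (beta z t).
have vi g : inv g -> mu.-integrable setT (EFin \o (fun z => val z (g z))).
  move=> [[G1 _] _ _ bi]; have := integrableB measurableT (integrable_dot vt G1) bi.
  by apply: eq_integrable.
have vle g : inv g -> \int[mu]_z val z (g z) <= dot vt a - j.
  move=> [Gpg gT gfin bi]; have [G1 _] := Gpg.
  have : adm mu phi beta F a j g0 (moment g - a) (\int[mu]_z fine (beta z (g z)) - j).
    exists g, (fun z => fine (beta z (g z))); split=> //.
    - by rewrite addrC subrK.
    - by move=> z; rewrite fineK.
    - by rewrite addrC subrK.
  move=> /Hvt; rewrite dotBr -dot_moment// => h.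
  rewrite /val RintegralB//; [lra|exact: integrable_dot].
have [S [mS bS Sz]] := bounded_exhaustion mu mphi.
(* e k = i infinitely often, for every i *)
pose e (k : nat) : nat := logn 2 k.
pose q k : R := posrat (e k).
(* Switching only where it is an improvement makes the sequence monotone; the bound k on the cost
   and the set S k keep it integrable. *)
pose A k (g : Z -> R) := (T `&` S k) `&` ([set z | `|fine (beta z (q k))| <= k%:R] `&`
  [set z | val z (g z) < val z (q k)]).
pose G := nat_rect (fun=> Z -> R) g0 (fun k g z => if z \in A k g then q k else g z).
have q0 k : 0 < q k by exact: posrat_gt0.
have mval g : measurable_fun setT g -> measurable_fun setT (fun z => val z (g z)).
  move=> mg; apply: measurable_funB; last first.
    by apply: measurableT_comp => //; exact: measurable_integrand.
  by apply: measurable_funM => //; exact: measurable_dot.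
have mA k g : measurable_fun setT g -> measurable (A k g).
  move=> mg; apply: measurableI; first exact: measurableI.
  apply: measurableI; rewrite -[X in measurable X]setTI.
    rewrite (_ : [set z | _] = (fun z => `|fine (beta z (q k))|) @^-1` `]-oo, k%:R]%classic).
      by apply: measurableT_comp => //; apply: measurableT_comp => //; case: hbeta.
    by apply/seteqP; split=> z /=; rewrite in_itv.
  rewrite -preimage_true; apply: measurable_fun_ltr => //; apply: mval => //.
have invG k : inv (G k).
  elim: k => [|k IH] /=.
    split; [by case: g0a|by []|exact: g0fin|].
    by apply: eq_integrable g0i => // z _; rewrite /= fineK.
  have mg : measurable_fun setT (G k) by case: IH => -[[]].
  apply: (@inv_switch _ _ k%:R _ (S k)) => //.
  - exact: mA.
  - by move=> z [[]].
  - by move=> z [[]].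
  - exact: bS.
  - by move=> z [_ []].
pose w k z := val z (G k z).
have wS k z : w k z <= w k.+1 z.
  rewrite /w /=; case: ifPn => // /set_mem [_ [_ /=]]; exact: ltW.
have wle z k m : (k <= m)%N -> w k z <= w m z.
  move=> km; have /nondecreasing_seqP H : forall k, (w ^~ z) k <= (w ^~ z) k.+1 by move=> i; exact: wS.
  exact: H.
have wcvg z : T z -> (w k z)%:E @[k --> \oo] --> conjugate (beta z) (dot vt (phi z)).
  move=> Tz.
  have -> : conjugate (beta z) (dot vt (phi z)) = ereal_sup (range (fun k => (w k z)%:E)).
    apply/eqP; rewrite eq_le; apply/andP; split; last first.
      apply: ub_ereal_sup => _ [k _ <-]; have [_ _ fk _] := invG k.
      apply: le_trans (@conjugate_ge _ (beta z) _ (G k z)).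
      by rewrite -{1}(fineK (fk z)) -EFinB.
    rewrite (conjugate_posrat (Gg z)); apply: ub_ereal_sup => _ [i _ <-].
    have bfin : beta z (posrat i) \is a fin_num.
      by case: (Gg z) => _ + _ _ _; apply; exact: posrat_gt0.
    rewrite -(fineK bfin) -EFinB.
    have [k [ek Sk bk]] : exists k, [/\ e k = i, S k z & `|fine (beta z (posrat i))| <= k%:R].
      have : \forall m \near \oo, S m z /\ `|fine (beta z (posrat i))| <= m%:R.
        by near=> m; split; [near: m; exact: Sz|near: m; exact: nbhs_infty_ger].
      move=> [N _ HN].
      (* The index 2^i 3^N has 2-adic valuation i and is at least N, so the constant i is tried
         again once z has entered the truncation. *)
      have kN : (N <= 2 ^ i * 3 ^ N)%N.
        by rewrite (leq_trans (ltnW (ltn_expl N (isT : 1 < 3)%N)))// leq_pmull// expn_gt0.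
      exists (2 ^ i * 3 ^ N)%N; have [? ?] := HN _ kN; split=> //.
      by rewrite /e lognM ?expn_gt0// pfactorK// lognX muln0 addn0.
    apply: (@le_trans _ _ (w k.+1 z)%:E); last by apply: ereal_sup_ubound; exists k.+1.
    rewrite lee_fin /w /=; have qk : q k = posrat i by rewrite /q ek.
    case: ifPn => [_|/negP nA]; first by rewrite qk.
    rewrite leNgt; apply/negP => lt; apply: nA; apply/mem_set; split=> //.
    by rewrite qk; split.
  apply: ereal_nondecreasing_cvgn; apply/nondecreasing_seqP => k.
  by rewrite lee_fin.
have w0i : mu.-integrable setT (EFin \o w 0%N) := vi _ (invG 0%N).
have w0iT : mu.-integrable T (EFin \o w 0%N) by exact: (@integrableS _ _ _ _ setT).
(* Subtracting the integrable first term makes the sequence nonnegative, as monotone convergence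
   requires. *)
pose f k z : \bar R := (w k z - w 0%N z)%:E.
have mf k : measurable_fun setT (f k).
  apply/measurable_EFinP; apply: measurable_funB.
    by have /(measurable_int mu)/measurable_EFinP := vi _ (invG k).
  by have /(measurable_int mu)/measurable_EFinP := w0i.
have f0 k z : (0 <= f k z)%E by rewrite lee_fin subr_ge0 wle.
have fcvg z : T z -> f k z @[k --> \oo] -->
    (conjugate (beta z) (dot vt (phi z)) - (w 0%N z)%:E)%E.
  by move=> Tz; rewrite /f; under eq_fun do rewrite EFinB; apply: cvgeB; [exact: fin_num_adde_defl|exact: wcvg|exact: cvg_cst].
pose M := dot vt a - j - \int[mu]_z w 0%N z.
have fM k : (\int[mu]_(z in T) f k z <= M%:E)%E.
  apply: (@le_trans _ _ (\int[mu]_z f k z)%E).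
    by apply: ge0_subset_integral.
  have fi : mu.-integrable setT (EFin \o (fun z => w k z - w 0%N z)).
    by have := integrableB measurableT (vi _ (invG k)) w0i; apply: eq_integrable.
  rewrite -(EFin_Rintegral fi) (RintegralB measurableT (vi _ (invG k)) w0i).
  by rewrite lee_fin lerB// vle.
have lim_le : (\int[mu]_(z in T) (conjugate (beta z) (dot vt (phi z)) - (w 0%N z)%:E) <= M%:E)%E.
  rewrite (eq_integral (fun z => limn (f ^~ z))); last first.
    by move=> z /set_mem Tz; symmetry; apply/cvg_lim => //; exact: fcvg.
  rewrite monotone_convergence//.
  - apply: lime_le; last by apply: nearW.
    apply: ereal_nondecreasing_is_cvgn => k m km.
    apply: ge0_le_integral => //.
    + exact: measurable_funTS.
    + exact: measurable_funTS.
    + by move=> z _; rewrite lee_fin lerB// wle.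
  - by move=> k; exact: measurable_funTS.
  - by move=> z _ k m km; rewrite lee_fin lerB// wle.
have mc : measurable_fun T (fun z => conjugate (beta z) (dot vt (phi z))).
  by apply: measurable_funTS; exact: measurable_conj.
have mw0 : measurable_fun T (EFin \o w 0%N) by exact: measurable_int w0iT.
have cw0 z : T z -> (0 <= conjugate (beta z) (dot vt (phi z)) - (w 0%N z)%:E)%E.
  move=> Tz; rewrite sube_ge0//; have [_ _ fk _] := invG 0%N.
  apply: le_trans (@conjugate_ge _ (beta z) _ (G 0%N z)).
  by rewrite -{1}(fineK (fk z)) -EFinB.
have di : mu.-integrable T (fun z => conjugate (beta z) (dot vt (phi z)) - (w 0%N z)%:E)%E.
  apply/integrableP; split; first exact: emeasurable_funB.
  under eq_integral => z /set_mem Tz do rewrite gee0_abs ?cw0//.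
  by apply: le_lt_trans lim_le _; exact: ltry.
have dE z : T z -> conjugate (beta z) (dot vt (phi z)) =
    (conjugate (beta z) (dot vt (phi z)) - (w 0%N z)%:E + (w 0%N z)%:E)%E.
  by move=> _; rewrite subeK.
have ci : mu.-integrable T (fun z => conjugate (beta z) (dot vt (phi z))).
  have := integrableD mT di w0iT; apply: eq_integrable => // z /set_mem Tz.
  by rewrite /= -dE.
split=> //.
rewrite (eq_integral (fun z => conjugate (beta z) (dot vt (phi z)) - (w 0%N z)%:E + (w 0%N z)%:E)%E); last first.
  by move=> z /set_mem Tz; rewrite -dE.
rewrite integralD//.
have w0T : (\int[mu]_(z in T) (w 0%N z)%:E = (dot vt a)%:E - \int[mu]_(z in T) beta z (g0 z))%E.
  rewrite -gain_on_face//; apply: eq_integral => z _.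
  by rewrite /gain -(fineK (g0fin z)) -EFinB.
have w0Z : (\int[mu]_z w 0%N z)%:E = ((dot vt a)%:E - (\int[mu]_(z in T) beta z (g0 z) + off_cost%:E))%E.
  rewrite EFin_Rintegral// -(off_costE g0a) -integral_split; last exact: measurable_int g0i.
  rewrite -mg0 -dot_moment// (EFin_Rintegral (integrable_dot vt Gg0)) -integralB//; last exact: integrable_dot.
  by apply: eq_integral => z _; rewrite /= -(fineK (g0fin z)) -EFinB.
have bf : (\int[mu]_(z in T) beta z (g0 z))%E \is a fin_num.
  by apply: integrable_fin_num => //; exact: (@integrableS _ _ _ _ setT).
apply: (le_trans (leeD lim_le (lexx _))).
move: w0T w0Z; rewrite -(fineK bf) /M => ->; rewrite -EFinD -EFinB => -[->].
by rewrite -?EFinB -?EFinD lee_fin; lra.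
Unshelve. all: by end_near. Qed.

End dual_optimum.

(** * Existence of dual solutions and their membership in [Theta] *)

Section dual_solutions.
Context {d : measure_display} {Z : measurableType d} {R : realType}.
Variable mu : {sigma_finite_measure set Z -> \bar R}.
Context {n : nat}.
Variables (phi : Z -> 'rV[R]_n) (beta : Z -> R -> \bar R).
Hypotheses (mphi : moment_mapping phi) (hbeta : is_B beta).
Variables (F : set 'rV[R]_n) (a : 'rV[R]_n).
Hypotheses (fF : is_face (phi_cone mu phi) F) (rF : relint F a).
Variables (j : R) (g0 : Z -> R).
Hypothesis Jj : J_value mu phi beta a = j%:E.
Hypotheses (g0a : Gplus_at mu phi a g0) (g0fin : forall z, beta z (g0 z) \is a fin_num).
Hypothesis g0i : mu.-integrable setT (fun z => beta z (g0 z)).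
Implicit Types (g h : Z -> R) (vt x u v : 'rV[R]_n) (y : R).

Local Notation T := (on_face phi F).
Local Notation K_dual := (K_dual mu phi beta F).
Local Notation off := (off_cost mu phi beta F g0).
Local Notation conj z vt := (conjugate (beta z) (dot vt (phi z))).
Local Notation dual vt := (dual_solution mu phi beta F a vt).
Local Notation Theta := (Theta mu phi beta F).

Let Gg z : is_Gamma (beta z). Proof. by case: hbeta. Qed.
Let mT : measurable T. Proof. exact: measurable_on_face. Qed.

Lemma dual_exists : exists2 vt, dual vt & K_dual_conj mu phi beta F a = (j - off)%:E.
Proof.
have [vt Hvt] := dual_vector_exists mphi hbeta fF rF (J_le Jj) g0a g0fin g0i.
have [ic le] := interchange mphi hbeta fF rF g0a g0fin g0i Hvt.
have KE : K_dual vt = (\int[mu]_(z in T) conj z vt)%E by exact: uintegral_integrable.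
have cf := integrable_fin_num mT ic.
have wd := weak_duality mphi hbeta fF rF Jj g0a g0i.
have E : ((dot vt a)%:E - K_dual vt = (j - off)%:E)%E.
  apply/eqP; rewrite eq_le wd /= KE.
  by move: le; rewrite -(fineK cf) -EFinB !lee_fin; lra.
have KC : K_dual_conj mu phi beta F a = (j - off)%:E.
  apply/eqP; rewrite eq_le; apply/andP; split.
    by apply: ub_ereal_sup => _ [v _ <-]; exact: wd.
  by rewrite -E; apply: ereal_sup_ubound; exists vt.
by exists vt => //; split; rewrite KC.
Qed.

Lemma dual_value vt : dual vt ->
  [/\ mu.-integrable T (fun z => conj z vt), K_dual vt = (\int[mu]_(z in T) conj z vt)%E &
      (\int[mu]_(z in T) conj z vt = (dot vt a - (j - off))%:E)%E].
Proof.
move=> [Kf E]; have [_ _ KC] := dual_exists; rewrite KC in E.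
have Kvt : (K_dual vt < +oo)%E.
  by rewrite ltey; apply/negP => /eqP K; move: E; rewrite K.
have [ic KE] := K_dual_integral mphi hbeta g0a g0i Kvt.
split=> //; have cf := integrable_fin_num mT ic.
by move: E; rewrite KE -(fineK cf) -EFinB => -[<-]; congr (_%:E); lra.
Qed.

(* One-sided directional derivatives of K at a dual solution vt towards vt0 are
   bounded below, while those of the integrand are -oo where dot vt (phi z) is
   an endpoint of the domain. *)
Lemma dual_Theta vt vt0 : dual vt -> Theta vt0 -> Theta vt.
Proof.
move=> dvt [K0 near0].
have [ic KE KV] := dual_value dvt.
have [ic0 K0E] := K_dual_integral mphi hbeta g0a g0i K0.
have Kfin : K_dual vt \is a fin_num by rewrite KE; exact: integrable_fin_num.
split; first by rewrite ltey_eq Kfin.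
have mc v : measurable_fun setT (fun z => conj z v) by exact: measurable_conj.
pose N0 := T `&` ([set z | conj z vt = +oo%E] `|` [set z | conj z vt0 = +oo%E]).
have mN0 : measurable N0.
  have my v : measurable [set z | conj z v = +oo%E].
    rewrite -[X in measurable X]setTI.
    exact: (mc v measurableT [set +oo%E] (emeasurable_set1 _)).
  by apply: measurableI => //; apply: measurableU; exact: my.
have N00 : mu N0 = 0%E.
  have := integrable_ae mT ic; have := integrable_ae mT ic0 => h1 h2.
  have : \forall z \ae mu, ~ N0 z.
    apply: filterS2 h1 h2 => z h1 h2 [Tz [h|h]].
      by have := h2 Tz; rewrite h.
    by have := h1 Tz; rewrite h.
  move=> [B [mB B0 sB]]; apply: (subset_measure0 mN0 mB _ B0).
  by apply: subset_trans sB => z /= ? ?.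
pose T' := T `\` N0; have mT' : measurable T' by exact: measurableD.
have T'T : T' `<=` T by move=> z [].
have fin1 z : T' z -> conj z vt \is a fin_num.
  move=> [Tz nz]; apply: (conjugate_fin_numP (Gg z)); rewrite ltey; apply/negP => /eqP E.
  by apply: nz; split=> //; left.
have fin0 z : T' z -> conj z vt0 \is a fin_num.
  move=> [Tz nz]; apply: (conjugate_fin_numP (Gg z)); rewrite ltey; apply/negP => /eqP E.
  by apply: nz; split=> //; right.
have toT' v : mu.-integrable T (fun z => conj z v) -> mu.-integrable T' (fun z => conj z v) /\
    (\int[mu]_(z in T) conj z v = \int[mu]_(z in T') conj z v)%E.
  move=> iv; split; first exact: (integrableS mT mT' T'T iv).
  exact: (negligible_integral mN0 mT iv N00).
have [ic' E'] := toT' _ ic; have [ic0' E0'] := toT' _ ic0.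
have [M0 M0E] : exists M0 : R, (\int[mu]_(z in T') conj z vt0 = M0%:E)%E.
  by exists (fine (\int[mu]_(z in T') conj z vt0)%E); rewrite fineK//; exact: integrable_fin_num.
pose s k : R := (k.+2%:R)^-1.
have s0 k : 0 < s k by rewrite invr_gt0.
have s1 k : s k <= 1 by rewrite invf_le1// ler1n.
pose vs k := (1 - s k) *: vt + s k *: vt0.
have dvs k z : dot (vs k) (phi z) = (1 - s k) * dot vt (phi z) + s k * dot vt0 (phi z).
  by rewrite dotDl !dotZl.
have cvx_bd k z : T' z -> (conj z (vs k) <= ((1 - s k) * fine (conj z vt) + s k * fine (conj z vt0))%:E)%E.
  move=> T'z; rewrite dvs; apply: (conjugate_convex (Gg z)) => //.
  - exact: ltW.
  - by rewrite fineK// fin1.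
  - by rewrite fineK// fin0.
have fins k z : T' z -> conj z (vs k) \is a fin_num.
  by move=> T'z; apply: (conjugate_fin_num (Gg z)); exact: cvx_bd.
have irhs k : mu.-integrable T' (fun z => (1 - s k)%:E * conj z vt + (s k)%:E * conj z vt0)%E.
  by apply: integrableD => //; exact: integrableZl.
have Ks k : (K_dual (vs k) < +oo)%E.
  have mcs : measurable_fun T (fun z => conj z (vs k)) by exact: measurable_funTS.
  have mN0' : measurable (T `\` T') by exact: measurableD.
  have -> : K_dual (vs k) = uintegral mu T ((fun z => conj z (vs k)) \_ T').
    apply: ae_eq_uintegral => //.
      apply/(measurable_restrict _ mT' mT).
      by apply: measurable_funTS; exact: mc.
    exists N0; split=> // z /= /not_implyP [Tz]; rewrite patchE.
    by case: ifPn => // zT' _; apply: contrapT => nz; move: zT'; rewrite mem_set.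
  have ir : mu.-integrable T ((fun z => (1 - s k)%:E * conj z vt + (s k)%:E * conj z vt0)%E \_ T').
    by apply/(integrable_restrict mu mT' mT); rewrite setIidr.
  apply: le_lt_trans (_ : (\int[mu]_(z in T) ((fun z => (1 - s k)%:E * conj z vt + (s k)%:E * conj z vt0)%E \_ T') z < +oo)%E); last first.
    by rewrite ltey_eq integrable_fin_num.
  apply: uintegral_le => //.
    apply/(measurable_restrict _ mT' mT).
    by apply: measurable_funTS; exact: mc.
  move=> z Tz; rewrite !patchE; case: ifPn => // /set_mem T'z.
  by rewrite -(fineK (fin1 z T'z)) -(fineK (fin0 z T'z)) -!EFinM -EFinD; exact: cvx_bd.
have ics k := K_dual_integral mphi hbeta g0a g0i (Ks k).
(* The convexity defect divided by the step: conj at vt0, minus conj at vt, minus the difference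
   quotient from vt towards vt0. It is nonnegative, so Fatou's lemma applies. *)
pose E k z : \bar R := ((s k)^-1%:E *
  ((1 - s k)%:E * conj z vt + (s k)%:E * conj z vt0 - conj z (vs k)))%E.
have EE k z : T' z -> E k z =
    ((s k)^-1 * ((1 - s k) * fine (conj z vt) + s k * fine (conj z vt0) - fine (conj z (vs k))))%:E.
  move=> T'z; rewrite /E -{1}(fineK (fin1 z T'z)) -{1}(fineK (fin0 z T'z)).
  by rewrite -{1}(fineK (fins k z T'z)).
have E_ge0 k z : T' z -> (0 <= E k z)%E.
  move=> T'z; rewrite EE// lee_fin mulr_ge0 ?invr_ge0 ?(ltW (s0 k))// subr_ge0.
  by have := cvx_bd k z T'z; rewrite -{1}(fineK (fins k z T'z)) lee_fin.
have mE k : measurable_fun setT (E k).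
  apply: emeasurable_funM => //; apply: emeasurable_funB => //.
  by apply: emeasurable_funD; apply: emeasurable_funM.
(* The bound comes from weak duality at vs k together with the dual value at vt; the terms in s k
   cancel. *)
pose M := j - off + M0 - dot vt0 a.
have EM k : (\int[mu]_(z in T') E k z <= M%:E)%E.
  have [ick KEk] := ics k; have [ick' Ek'] := toT' _ ick.
  have fk := integrable_fin_num mT' ick'.
  have iD : mu.-integrable T' (fun z => (1 - s k)%:E * conj z vt + (s k)%:E * conj z vt0 - conj z (vs k))%E.
    exact: integrableB.
  rewrite integralZl// integralB// integralD//; [|exact: integrableZl|exact: integrableZl].
  rewrite !integralZl// -E' KV M0E -(fineK fk); set I := fine _.
  rewrite -[leLHS]/(((s k)^-1 * ((1 - s k) * (dot vt a - (j - off)) + s k * M0 - I))%:E) lee_fin.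
  have := weak_duality mphi hbeta fF rF Jj g0a g0i (vs k).
  rewrite KEk Ek' -(fineK fk) -EFinB lee_fin -/I.
  have -> : dot (vs k) a = (1 - s k) * dot vt a + s k * dot vt0 a by rewrite dotDl !dotZl.
  move=> h; rewrite -ler_pdivlMl ?invr_gt0// invrK /M; lra.
(* The bad points: r = <vt, phi z> is a right endpoint of the domain and vt0 gives a strictly
   smaller number. If vt0 gave a number at least r, monotonicity and [near0] would make the
   conjugate finite to the right of r. *)
pose N := T' `&` ([set z | dot vt0 (phi z) < dot vt (phi z)] `&`
  \bigcap_k [set z | conjugate (beta z) (dot vt (phi z) + harmonic k) = +oo%E]).
have mN : measurable N.
  apply: measurableI => //; apply: measurableI.
    rewrite -preimage_true -[X in measurable X]setTI.
    by apply: measurable_fun_ltr => //; exact: measurable_dot.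
  apply: bigcap_measurableType => k _.
  have mck : measurable_fun setT (fun z => conjugate (beta z) (dot vt (phi z) + harmonic k)).
    by apply: measurable_conjugate => //; apply: measurable_funD => //; exact: measurable_dot.
  rewrite -[X in measurable X]setTI.
  exact: (mck measurableT [set +oo%E] (emeasurable_set1 _)).
have NT' : N `<=` T' by move=> z [].
have Ncvg z : N z -> E k z @[k --> \oo] --> +oo%E.
  move=> [T'z [r0r Hoo]]; apply/cvgeyPge => B.
  pose c1 := fine (conj z vt); pose c0 := fine (conj z vt0).
  pose D := dot vt (phi z) - dot vt0 (phi z).
  have D0 : 0 < D by rewrite subr_gt0.
  (* The steepness for which E k z >= c0 - c1 + T0 D >= B. *)
  pose T0 := Num.max 1 ((B - c0 + c1) / D).
  have T00 : 0 < T0 by rewrite lt_max ltr01.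
  have TB : B - c0 + c1 <= T0 * D by rewrite -ler_pdivrMr// le_max lexx orbT.
  have ooe e : 0 < e -> conjugate (beta z) (dot vt (phi z) + e) = +oo%E.
    move=> e0; have /cvgrPdist_lt/(_ e e0)[k _ /(_ k (leqnn k))] := @cvg_harmonic R.
    rewrite /= sub0r normrN gtr0_norm// => he.
    apply/eqP; rewrite -leye_eq -(Hoo k I); apply: (conjugate_homo (Gg z)).
    by rewrite lerD2l ltW.
  have [dd dd0 Hd] := conjugate_steep (Gg z) T00 (fin1 z T'z) ooe.
  near=> k; rewrite EE// lee_fin.
  have sk : s k * D < dd.
    rewrite -ltr_pdivlMr// /s.
    have : harmonic k < dd / D :> R.
      by near: k; apply: (cvgr_lt _ (@cvg_harmonic R)); rewrite divr_gt0.
    by apply: le_lt_trans; rewrite /= lef_pV2 ?posrE// ler_nat.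
  have := Hd (s k * D) (mulr_gt0 (s0 k) D0) sk.
  have -> : dot vt (phi z) - s k * D = dot (vs k) (phi z) by rewrite dvs /D; ring.
  rewrite -{1}(fineK (fins k z T'z)) lee_fin -/c1 -/c0 => h.
  rewrite ler_pdivlMl//; have : s k * (B - c0 + c1) <= s k * (T0 * D) by rewrite ler_pM2l.
  lra.
have muN : mu N = 0%E.
  have : (\int[mu]_(z in N) limn_einf (E ^~ z) <= M%:E)%E.
    apply: (@le_trans _ _ (limn_einf (fun k => \int[mu]_(z in N) E k z))%E).
      apply: fatou => //; first by move=> k; exact: measurable_funTS.
      by move=> k z Nz; apply: E_ge0; exact: NT'.
    rewrite limn_einf_lim; apply: lime_le; first exact: is_cvg_einfs.
    apply: nearW => k; apply: (@le_trans _ _ (\int[mu]_(z in N) E k z)%E).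
      by apply: ereal_inf_lbound; exists k => /=.
    apply: le_trans (EM k); apply: ge0_subset_integral => //.
      exact: measurable_funTS.
    by move=> z T'z; exact: E_ge0.
  have -> : (\int[mu]_(z in N) limn_einf (E ^~ z) = \int[mu]_(z in N) cst +oo z)%E.
    apply: eq_integral => z /set_mem Nz; have cE := Ncvg z Nz.
    by rewrite is_cvg_limn_einfE; [exact/cvg_lim|apply/cvg_ex; exists +oo%E].
  rewrite integral_cst//; have [->//|muN0] := eqVneq (mu N) 0%E.
  by rewrite gt0_mulye ?lt0e ?muN0 ?measure_ge0//.
have aeN : \forall z \ae mu, ~ N z.
  by exists N; split=> // z /= /contrapT.
have aeN0 : \forall z \ae mu, ~ N0 z.
  by exists N0; split=> // z /= /contrapT.
have aeall : \forall z \ae mu, ~ N z /\ ~ N0 z by apply: filterS2 aeN aeN0.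
apply: filterS2 near0 aeall => z nz0 [nN nN0] Tz.
have T'z : T' z by [].
have /(conjugate_fin_nearP (Gg z))[e0 e00 fe0] := nz0 Tz.
apply: contrapT => nnear; apply: nN.
have ooe e : 0 < e -> conjugate (beta z) (dot vt (phi z) + e) = +oo%E.
  move=> ep; apply/eqP; rewrite -leye_eq leNgt; apply/negP => lt.
  by apply: nnear; apply/(conjugate_fin_nearP (Gg z)); exists e.
split=> //; split=> /=; last by move=> k _; apply: ooe; exact: harmonic_gt0.
rewrite ltNge; apply/negP => le.
have : (conjugate (beta z) (dot vt (phi z) + e0) < +oo)%E.
  by apply: le_lt_trans fe0; apply: (conjugate_homo (Gg z)); rewrite lerD2r.
by rewrite ooe.
Unshelve. all: by end_near. Qed.

End dual_solutions.

(** * The Pythagorean identity and uniqueness *)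

Section pythagoras.
Context {d : measure_display} {Z : measurableType d} {R : realType}.
Variable mu : {sigma_finite_measure set Z -> \bar R}.
Context {n : nat}.
Variables (phi : Z -> 'rV[R]_n) (beta : Z -> R -> \bar R).
Hypotheses (mphi : moment_mapping phi) (hbeta : is_B beta).
Variables (F : set 'rV[R]_n) (a : 'rV[R]_n).
Hypotheses (fF : is_face (phi_cone mu phi) F) (rF : relint F a).
Variables (j : R) (g0 : Z -> R).
Hypothesis Jj : J_value mu phi beta a = j%:E.
Hypotheses (g0a : Gplus_at mu phi a g0) (g0fin : forall z, beta z (g0 z) \is a fin_num).
Hypothesis g0i : mu.-integrable setT (fun z => beta z (g0 z)).
Implicit Types (g h : Z -> R) (vt x u v : 'rV[R]_n) (y : R).

Local Notation T := (on_face phi F).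
Local Notation K_dual := (K_dual mu phi beta F).
Local Notation off := (off_cost mu phi beta F g0).
Local Notation conj z vt := (conjugate (beta z) (dot vt (phi z))).
Local Notation dual vt := (dual_solution mu phi beta F a vt).
Local Notation Theta := (Theta mu phi beta F).
Local Notation f_dual := (f_dual phi beta F).

Let Gg z : is_Gamma (beta z). Proof. by case: hbeta. Qed.
Let mT : measurable T. Proof. exact: measurable_on_face. Qed.

Lemma measurable_f_dual vt : measurable_fun setT (f_dual vt).
Proof. by apply: measurable_derive_conjugate => //; exact: measurable_dot. Qed.

Lemma f_dual_argmax vt : Theta vt ->
  \forall z \ae mu, T z -> is_argmax (beta z) (dot vt (phi z)) (f_dual vt z).
Proof.
move=> [_]; apply: filterS => z nz Tz.
have /(conjugate_fin_nearP (Gg z))[e e0 fe] := nz Tz.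
have [ed am] := conjugate_ediff (Gg z) e0 fe.
by rewrite /f_dual asboolT.
Qed.

Lemma f_dual_off vt z : ~ T z -> f_dual vt z = 0.
Proof. by move=> Tz; rewrite /f_dual asboolF// => -[]. Qed.

Lemma bregman_integrand00 z : bregman_integrand (beta z) 0 0 = 0%E.
Proof.
rewrite /bregman_integrand ltxx/=; case: ifPn => fr; last by rewrite mul0e.
have fg := rderiv_fin_integrand (Gg z) (lexx 0) fr.
by rewrite subrr mule0 sube0 subee.
Qed.

Lemma ae_eq_integrable (D : set Z) (f1 f2 : Z -> \bar R) : measurable D -> measurable_fun D f2 ->
  ae_eq mu D f1 f2 -> mu.-integrable D f1 -> mu.-integrable D f2.
Proof.
move=> mD mf2 f12 /integrableP[mf1 fin]; apply/integrableP; split=> //.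
rewrite (ae_eq_integral (fun z => `|f1 z|%E)) => //.
- exact: measurableT_comp.
- exact: measurableT_comp.
- by apply: filterS f12 => z h Dz; rewrite h.
Qed.

Definition correction vt g z : \bar R :=
  ((sgn_deriv (beta z) (g z - f_dual vt z)%R (f_dual vt z) - (dot vt (phi z))%:E)
    * (g z - f_dual vt z)%:E)%E.

Lemma measurable_correction vt g : measurable_fun setT g -> measurable_fun setT (correction vt g).
Proof.
move=> mg; have mf := measurable_f_dual vt.
apply: emeasurable_funM; last by apply/measurable_EFinP; exact: measurable_funB.
apply: emeasurable_funB; last by apply/measurable_EFinP; exact: measurable_dot.
by apply: measurable_sgn_deriv => //; exact: measurable_funB.
Qed.

(** The integrand is nonnegative only almost everywhere on T; [maxe _ 0] makes it so everywhere, and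
    the integrals become additive. *)
Lemma D_correctionE vt g : Theta vt -> measurable_fun setT g -> (forall z, 0 <= g z) ->
  D_correction mu phi beta F vt g = (\int[mu]_(z in T) maxe (correction vt g z) 0)%E.
Proof.
move=> th mg ge0; have mc := measurable_correction vt mg.
rewrite /D_correction -(@uintegral_ge0 _ _ _ mu); last first.
  by move=> z _; rewrite le_max lexx orbT.
apply: ae_eq_uintegral => //; first exact: measurable_funTS.
  by apply: measurable_funTS; exact: measurable_maxe.
apply: filterS (f_dual_argmax th) => z am Tz.
by rewrite /correction max_l//; apply: (correction_ge0 (Gg z)) => //; exact: am.
Qed.

Definition excess vt g z : \bar R :=
  (bregman_integrand (beta z) (g z) (f_dual vt z) + maxe (correction vt g z) 0)%E.

(** The real-valued part of the Fenchel-Young gap, kept apart from [beta z (g z)], which may be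
    infinite or not integrable. *)
Definition dual_gap vt g z : R := fine (conj z vt) - dot vt (phi z) * g z.

Lemma excessE vt g : Theta vt -> (forall z, 0 <= g z) ->
  ae_eq mu T (excess vt g) (fun z => beta z (g z) + (dual_gap vt g z)%:E)%E.
Proof.
move=> th ge0; apply: filterS (f_dual_argmax th) => z am Tz.
rewrite /excess /dual_gap (fenchel_young_gap (Gg z) (am Tz))// max_l//.
by apply: (correction_ge0 (Gg z)) => //; exact: am.
Qed.

Lemma dual_gap_integral vt g : dual vt -> Gplus_at mu phi a g ->
  mu.-integrable T (fun z => (dual_gap vt g z)%:E) /\
  (\int[mu]_(z in T) (dual_gap vt g z)%:E = (off - j)%:E)%E.
Proof.
move=> dvt ga; have [ic _ KV] := dual_value mphi hbeta fF rF Jj g0a g0fin g0i dvt.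
have G1 : G_space mu phi g by case: ga => -[].
have id : mu.-integrable T (fun z => (dot vt (phi z) * g z)%:E).
  exact: (integrableS measurableT mT (@subsetT _ T) (integrable_dot vt G1)).
have aeE : ae_eq mu T (fun z => conj z vt - (dot vt (phi z) * g z)%:E)%E
    (fun z => (dual_gap vt g z)%:E).
  by apply: filterS (integrable_ae mT ic) => z fz Tz; rewrite /dual_gap -{1}(fineK (fz Tz)).
have mgap : measurable_fun T (fun z => (dual_gap vt g z)%:E).
  apply: measurable_funTS; apply/measurable_EFinP; apply: measurable_funB.
    by apply: measurableT_comp => //; exact: measurable_conj.
  by apply: measurable_funM; [exact: measurable_dot|case: G1].
have iB := integrableB mT ic id.
split; first exact: ae_eq_integrable aeE iB.
rewrite -(ae_eq_integral _ _ _ _ _ aeE)//; last exact: measurable_int iB.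
rewrite integralB// KV (dot_on_face mphi fF rF)// -EFinB; congr (_%:E); ring.
Qed.

Lemma measurable_excess vt g : measurable_fun setT g -> measurable_fun setT (excess vt g).
Proof.
move=> mg; apply: emeasurable_funD.
  by apply: measurable_bregman => //; exact: measurable_f_dual.
by apply: measurable_maxe => //; exact: measurable_correction.
Qed.

Lemma excess_ge0 vt g z : (0 <= excess vt g z)%E.
Proof.
by rewrite adde_ge0//; [exact: bregman_integrand_ge0|rewrite le_max lexx orbT].
Qed.

(** If the cost of g is not integrable, both sides are [+oo]: the left because it is at least j, the
    right because an integrable excess minus the integrable [dual_gap] would be an integrable cost
    on T, and off T the cost is that of [g0]. *)
Lemma H_excess vt g : dual vt -> Theta vt -> Gplus_at mu phi a g ->
  H_functional mu beta g = (j%:E + \int[mu]_(z in T) excess vt g z)%E.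
Proof.
move=> dvt th ga; have [[[mg ig] ge0] _] := ga.
have mb := measurable_integrand hbeta mg.
have [igap gapE] := dual_gap_integral dvt ga.
have mbT : measurable_fun T (fun z => beta z (g z)) by exact: measurable_funTS.
have me : measurable_fun T (excess vt g) by apply: measurable_funTS; exact: measurable_excess.
have ms : measurable_fun T (fun z => beta z (g z) + (dual_gap vt g z)%:E)%E.
  by apply: emeasurable_funD => //; exact: measurable_int igap.
have [bi|nbi] := pselect (mu.-integrable setT (fun z => beta z (g z))).
  have biT : mu.-integrable T (fun z => beta z (g z)).
    exact: (integrableS measurableT mT (@subsetT _ T) bi).
  rewrite (H_on_face mphi hbeta fF rF g0a g0i ga bi) (ae_eq_integral _ _ _ _ _ (excessE th ge0))//.
  rewrite integralD// gapE.
  have bf := integrable_fin_num mT biT.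
  by rewrite -(fineK bf) -!EFinD; congr (_%:E); ring.
have -> : H_functional mu beta g = +oo%E.
  apply/eqP; rewrite -leye_eq leNgt; apply/negP => lt; apply: nbi.
  apply: (uintegral_fin_integrable measurableT mb).
  rewrite fin_numE; apply/andP; split; last by rewrite lt_eqF.
  by rewrite gt_eqF//; apply: lt_le_trans (J_le Jj ga); exact: ltNyr.
suff -> : (\int[mu]_(z in T) excess vt g z = +oo)%E by rewrite addey.
apply/eqP; rewrite -leye_eq leNgt; apply/negP => lt; apply: nbi.
have ie : mu.-integrable T (excess vt g).
  apply/integrableP; split=> //.
  by under eq_integral do rewrite gee0_abs ?excess_ge0//.
have iT : mu.-integrable T (fun z => beta z (g z)).
  apply: (ae_eq_integrable mT mbT _ (integrableB mT ie igap)).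
  by apply: filterS (excessE th ge0) => z h Tz; rewrite /= h// addeK.
have iTC : mu.-integrable (~` T) (fun z => beta z (g z)).
  have mTC := measurableC mT.
  apply: (ae_eq_integrable mTC (measurable_funTS mb) _ (integrableS measurableT mTC (@subsetT _ (~` T)) g0i)).
  have := off_face_zero mphi fF rF ga; have := off_face_zero mphi fF rF g0a.
  by apply: filterS2 => z z1 z2 Tz; rewrite z1// z2.
apply/integrableP; split=> //.
rewrite (integral_split mu mphi F); last exact: measurableT_comp.
by rewrite lte_add_pinfty//; [have /integrableP[] := iT|have /integrableP[] := iTC].
Qed.

Lemma bregman_on_face vt g : Gplus_at mu phi a g ->
  bregman_distance mu beta g (f_dual vt) =
  (\int[mu]_(z in T) bregman_integrand (beta z) (g z) (f_dual vt z))%E.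
Proof.
move=> ga; have mg : measurable_fun setT g by case: ga => -[[]].
have mb : measurable_fun setT (fun z => bregman_integrand (beta z) (g z) (f_dual vt z)).
  by apply: measurable_bregman => //; exact: measurable_f_dual.
rewrite /bregman_distance uintegral_ge0; last by move=> z _; exact: bregman_integrand_ge0.
rewrite (integral_split mu mphi F)// [X in (_ + X)%E](ae_eq_integral (cst 0%E)).
- by rewrite integral0 adde0.
- exact: measurableC.
- exact: measurable_funTS.
- exact: measurable_cst.
- apply: filterS (off_face_zero mphi fF rF ga) => z gz Tz.
  by rewrite gz// f_dual_off// bregman_integrand00.
Qed.

Lemma pythagorean_identity vt g : dual vt -> Theta vt -> Gplus_at mu phi a g ->
  H_functional mu beta g =
  (j%:E + bregman_distance mu beta g (f_dual vt) + D_correction mu phi beta F vt g)%E.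
Proof.
move=> dvt th ga; have [[[mg ig] ge0] _] := ga.
rewrite (H_excess dvt th ga) (bregman_on_face _ ga) D_correctionE// -addeA; congr (_ + _)%E.
rewrite ge0_integralD//.
- by move=> z _; exact: bregman_integrand_ge0.
- apply: measurable_funTS; apply: measurable_bregman => //; exact: measurable_f_dual.
- by move=> z _; rewrite le_max lexx orbT.
- by apply: measurable_funTS; apply: measurable_maxe => //; exact: measurable_correction.
Qed.

Lemma D_correction_ge0 vt g : Theta vt -> Gplus_at mu phi a g ->
  (0 <= D_correction mu phi beta F vt g)%E.
Proof.
move=> th [[[mg _] ge0] _]; rewrite D_correctionE//.
by apply: integral_ge0 => z _; rewrite le_max lexx orbT.
Qed.

End pythagoras.

(** * Independence of the dual solution, and uniqueness *)

Section uniqueness.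
Context {d : measure_display} {Z : measurableType d} {R : realType}.
Variable mu : {sigma_finite_measure set Z -> \bar R}.
Context {n : nat}.
Variables (phi : Z -> 'rV[R]_n) (beta : Z -> R -> \bar R).
Hypotheses (mphi : moment_mapping phi) (hbeta : is_B beta).
Implicit Types (g h : Z -> R) (vt x u v : 'rV[R]_n) (y : R).

Let Gg z : is_Gamma (beta z). Proof. by case: hbeta. Qed.

(** The threshold that forces closeness depends on z, so no uniform estimate is possible. But the
    lower limit of the summed distances vanishes at almost every z, and a single index with a small
    sum already puts h1 z and h2 z close together. *)
Lemma bregman_limit_unique (g_ : nat -> Z -> R) h1 h2 :
  measurable_fun setT h1 -> measurable_fun setT h2 -> (forall k, measurable_fun setT (g_ k)) ->
  (forall k, (bregman_distance mu beta (g_ k) h1 <= (harmonic k)%:E)%E) ->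
  (forall k, (bregman_distance mu beta (g_ k) h2 <= (harmonic k)%:E)%E) ->
  h1 = h2 %[ae mu].
Proof.
move=> m1 m2 mg B1 B2.
pose D h k z := bregman_integrand (beta z) (g_ k z) (h z).
have D0 h k z : (0 <= D h k z)%E by exact: bregman_integrand_ge0.
have mD h k : measurable_fun setT h -> measurable_fun setT (D h k).
  by move=> mh; exact: measurable_bregman.
pose S k z := (D h1 k z + D h2 k z)%E.
have S0 k z : (0 <= S k z)%E by exact: adde_ge0.
have mS k : measurable_fun setT (S k) by apply: emeasurable_funD; exact: mD.
have IS k : (\int[mu]_z S k z <= (2 * harmonic k)%:E)%E.
  rewrite ge0_integralD//; [|exact: mD|exact: mD].
  have -> : 2 * harmonic k = harmonic k + harmonic k :> R by ring.
  rewrite EFinD; apply: leeD.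
    by have := B1 k; rewrite /bregman_distance uintegral_ge0// => z _; exact: D0.
  by have := B2 k; rewrite /bregman_distance uintegral_ge0// => z _; exact: D0.
pose L z := limn_einf (S ^~ z).
have L0 z : (0 <= L z)%E.
  rewrite /L limn_einf_lim; apply: lime_ge; first exact: is_cvg_einfs.
  by apply: nearW => k; apply: le_ereal_inf_tmp => _ [m _ <-].
have mL : measurable_fun setT L.
  rewrite (_ : L = (fun z => - limn_esup (fun k => - S k z))%E).
    apply: measurableT_comp => //; apply: measurable_fun_limn_esup => k.
    exact: measurableT_comp.
  by apply/funext => z; rewrite -limn_einfN; congr limn_einf; apply/funext => k /=; rewrite oppeK.
have IL : (\int[mu]_z L z = 0)%E.
  apply/eqP; rewrite eq_le integral_ge0// andbT.
  apply: (@le_trans _ _ (limn_einf (fun k => \int[mu]_z S k z)%E)); first exact: fatou.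
  have c0 : (2 * (harmonic k : R))%:E @[k --> \oo] --> (0%R)%:E.
    apply: cvg_EFin; first exact: nearW.
    rewrite -[X in _ --> X](mulr0 2); apply: cvgM; first exact: cvg_cst.
    exact: cvg_harmonic.
  apply: (@le_trans _ _ (limn (fun k => (2 * harmonic k)%:E))); last by rewrite (cvg_lim _ c0).
  rewrite limn_einf_lim; apply: lee_lim.
  - exact: is_cvg_einfs.
  - by apply/cvg_ex; exists 0%:E.
  - apply: nearW => k; apply: le_trans (IS k).
    by apply: ereal_inf_lbound; exists k => /=.
have aeL : ae_eq mu setT L (cst 0%E).
  apply/(ae_eq_integral_abs _ measurableT mL).
  by rewrite -IL; apply: eq_integral => z _; rewrite gee0_abs.
apply: filterS aeL => z /(_ Logic.I) Lz _.
apply/eqP; apply: contraT => ne.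
pose e := `|h1 z - h2 z| / 2.
have e0 : 0 < e by rewrite divr_gt0// normr_gt0 subr_eq0.
have [d1 d10 H1] := bregman_integrand_small (Gg z) (h1 z) e0.
have [d2 d20 H2] := bregman_integrand_small (Gg z) (h2 z) e0.
pose dd := Num.min d1 d2.
have dd0 : 0 < dd by rewrite lt_min d10.
have [k Sk] : exists k, (S k z < dd%:E)%E.
  apply: contrapT => /forallNP H.
  have : (dd%:E <= L z)%E.
    rewrite /L limn_einf_lim; apply: lime_ge; first exact: is_cvg_einfs.
    apply: nearW => k; apply: le_ereal_inf_tmp => _ [m _ <-].
    by rewrite leNgt; apply/negP/H.
  by rewrite Lz lee_fin leNgt dd0.
have k1 : `|g_ k z - h1 z| < e.
  apply: H1; apply: (@le_lt_trans _ _ (S k z)); first by rewrite /S leeDl.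
  by apply: (lt_le_trans Sk); rewrite lee_fin ge_min lexx.
have k2 : `|g_ k z - h2 z| < e.
  apply: H2; apply: (@le_lt_trans _ _ (S k z)); first by rewrite /S leeDr.
  by apply: (lt_le_trans Sk); rewrite lee_fin ge_min lexx orbT.
have : `|h1 z - h2 z| < 2 * e.
  have -> : h1 z - h2 z = (g_ k z - h2 z) - (g_ k z - h1 z) by ring.
  by apply: (le_lt_trans (ler_normB _ _)); lra.
by rewrite /e mulrC divfK// ltxx.
Qed.

Variables (F : set 'rV[R]_n) (a : 'rV[R]_n).
Hypotheses (fF : is_face (phi_cone mu phi) F) (rF : relint F a).
Variables (j : R) (g0 : Z -> R).
Hypothesis Jj : J_value mu phi beta a = j%:E.
Hypotheses (g0a : Gplus_at mu phi a g0) (g0fin : forall z, beta z (g0 z) \is a fin_num).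
Hypothesis g0i : mu.-integrable setT (fun z => beta z (g0 z)).

Local Notation T := (on_face phi F).
Local Notation dual vt := (dual_solution mu phi beta F a vt).
Local Notation Theta := (Theta mu phi beta F).
Local Notation f_dual := (f_dual phi beta F).
Local Notation D_correction := (D_correction mu phi beta F).

Let mT : measurable T. Proof. exact: measurable_on_face. Qed.

Lemma minimizing_sequence : exists g_ : nat -> Z -> R,
  forall k, Gplus_at mu phi a (g_ k) /\ (H_functional mu beta (g_ k) <= (j + harmonic k)%:E)%E.
Proof.
have ex k : exists g, Gplus_at mu phi a g /\ (H_functional mu beta g <= (j + harmonic k)%:E)%E.
  have [_ [g ga <-] gJ] : exists2 x, [set H_functional mu beta g | g in Gplus_at mu phi a] x &
      (x < j%:E + (harmonic k)%:E)%E.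
    by apply: ereal_inf_lt; rewrite -/(J_value mu phi beta a) Jj lteDl// lte_fin harmonic_gt0.
  by exists g; split=> //; rewrite EFinD; exact: ltW.
by have [g_ Hg] := choice ex; exists g_.
Qed.

(** With an arbitrary nonnegative remainder c this covers both a function h satisfying the identity
    and the function of another dual solution. *)
Lemma bregman_unique vt h : dual vt -> Theta vt -> measurable_fun setT h ->
  (forall g, Gplus_at mu phi a g -> exists2 c, (0 <= c)%E &
     H_functional mu beta g = (j%:E + bregman_distance mu beta g h + c)%E) ->
  h = f_dual vt %[ae mu].
Proof.
move=> dvt th mh Hh; have [g_ Hg] := minimizing_sequence.
have bd h' k c : (0 <= c)%E ->
    H_functional mu beta (g_ k) = (j%:E + bregman_distance mu beta (g_ k) h' + c)%E ->
    (bregman_distance mu beta (g_ k) h' <= (harmonic k)%:E)%E.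
  move=> c0 E; have [_] := Hg k; rewrite E EFinD -addeA leeD2lE// => le.
  by apply: le_trans le; rewrite leeDl.
apply: (@bregman_limit_unique g_) => //.
- exact: measurable_f_dual.
- by move=> k; have [[[[]]]] := Hg k.
- by move=> k; have [c c0 E] := Hh _ (Hg k).1; exact: bd E.
- move=> k; apply: (bd _ _ _ (D_correction_ge0 mphi hbeta th (Hg k).1)).
  exact: (pythagorean_identity mphi hbeta fF rF Jj g0a g0fin g0i dvt th (Hg k).1).
Qed.

Lemma f_dual_unique vt vt' : dual vt -> Theta vt -> dual vt' -> Theta vt' ->
  f_dual vt = f_dual vt' %[ae mu].
Proof.
move=> d1 t1 d2 t2; apply: bregman_unique => //; first exact: measurable_f_dual.
move=> g ga; exists (D_correction vt g); first exact: D_correction_ge0 ga.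
exact: (pythagorean_identity mphi hbeta fF rF Jj g0a g0fin g0i).
Qed.

(** For equal f the derivative terms are equal and finite, so they cancel; what remains is (<vt, phi
    z> - <vt', phi z>) (f - g), the difference of the gaps. Its integral vanishes, since both gaps
    have integral off - j. *)
Lemma correction_gap vt vt' g z : is_argmax (beta z) (dot vt (phi z)) (f_dual vt z) ->
  is_argmax (beta z) (dot vt' (phi z)) (f_dual vt' z) -> f_dual vt z = f_dual vt' z ->
  0 <= g z ->
  (correction phi beta F vt g z =
   correction phi beta F vt' g z + ((dual_gap phi beta vt g z)%:E - (dual_gap phi beta vt' g z)%:E))%E
  /\ (0 <= correction phi beta F vt g z)%E /\ (0 <= correction phi beta F vt' g z)%E.
Proof.
move=> am am' E ge0; split; last first.
  by split; apply: (correction_ge0 (Gg z)).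
rewrite /correction /dual_gap (argmax_conjugate (Gg z) am) (argmax_conjugate (Gg z) am').
rewrite E; set f := f_dual vt' z; rewrite -/f in am'.
have sf : sgn_deriv (beta z) (g z - f) f \is a fin_num.
  have [fr _] := argmax_rderiv (Gg z) am'.
  rewrite /sgn_deriv; case: ifPn => //; rewrite -ltNge subr_lt0 => gf.
  by rewrite /lderiv (le_lt_trans ge0 gf).
rewrite -(fineK sf) /= -!EFinB -!EFinM -!EFinD; congr (_%:E); ring.
Qed.

Lemma D_correction_le vt vt' g : dual vt -> Theta vt -> dual vt' -> Theta vt' ->
  Gplus_at mu phi a g -> (D_correction vt' g < +oo)%E -> D_correction vt g = D_correction vt' g.
Proof.
move=> dv tv dv' tv' ga; have [[[mg ig] ge0] _] := ga.
have [i1 E1] := dual_gap_integral mphi hbeta fF rF Jj g0a g0fin g0i dv ga.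
have [i2 E2] := dual_gap_integral mphi hbeta fF rF Jj g0a g0fin g0i dv' ga.
pose cp v z := maxe (correction phi beta F v g z) 0%E.
have DE v : Theta v -> D_correction v g = (\int[mu]_(z in T) cp v z)%E.
  by move=> tv''; exact: D_correctionE.
rewrite (DE vt tv) (DE vt' tv') => lt.
have mc v : measurable_fun T (cp v).
  apply: measurable_funTS; apply: measurable_maxe => //; exact: measurable_correction.
have cp0 v z : (0 <= cp v z)%E by rewrite /cp le_max lexx orbT.
have cpE v z : (0 <= correction phi beta F v g z)%E -> cp v z = correction phi beta F v g z.
  exact: max_l.
have ic : mu.-integrable T (cp vt').
  apply/integrableP; split; first exact: mc.
  by under eq_integral do rewrite gee0_abs ?cp0//.
clearbody cp.
have ae : ae_eq mu T (cp vt) (fun z => cp vt' z +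
    ((dual_gap phi beta vt g z)%:E - (dual_gap phi beta vt' g z)%:E))%E.
  have am := f_dual_argmax hbeta tv; have am' := f_dual_argmax hbeta tv'.
  have := f_dual_unique dv tv dv' tv'.
  apply: filterS3 am am' => z a1 a2 fe Tz.
  have [E [p1 p2]] := correction_gap (a1 Tz) (a2 Tz) (fe Logic.I) (ge0 z).
  by rewrite (cpE _ _ p1) (cpE _ _ p2) E.
have id := integrableB mT i1 i2.
have ms : measurable_fun T (fun z => cp vt' z +
    ((dual_gap phi beta vt g z)%:E - (dual_gap phi beta vt' g z)%:E))%E.
  by apply: emeasurable_funD; [exact: mc|exact: measurable_int id].
rewrite (ae_eq_integral _ _ mT (mc vt) ms ae) (integralD mT ic id) (integralB mT i1 i2).
by rewrite E1 E2 subee// adde0.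
Qed.

Lemma D_correction_unique vt vt' g : dual vt -> Theta vt -> dual vt' -> Theta vt' ->
  Gplus_at mu phi a g -> D_correction vt g = D_correction vt' g.
Proof.
move=> dv tv dv' tv' ga.
have [/eqP E'|] := boolP (D_correction vt' g == +oo%E); last first.
  by rewrite -ltey; exact: D_correction_le.
have [/eqP E|] := boolP (D_correction vt g == +oo%E); first by rewrite E E'.
by rewrite -ltey => lt; symmetry; exact: D_correction_le lt.
Qed.

End uniqueness.

Theorem theorem7p10 (d : measure_display) (Z : measurableType d) (R : realType)
    (mu : {sigma_finite_measure set Z -> \bar R}) (n : nat)
    (phi : Z -> 'rV[R]_n) (mphi : moment_mapping phi)
    (beta : Z -> R -> \bar R) (hbeta : is_B beta)
    (a : 'rV[R]_n)
    (hJ : J_value mu phi beta a \is a fin_num)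
    (hTheta : Theta mu phi beta (face_of mu phi a) !=set0) :
  exists gtilde : Z -> R,
    [/\ measurable_fun setT gtilde,
        forall g, Gplus_at mu phi a g ->
          H_functional mu beta g
          = (J_value mu phi beta a + bregman_distance mu beta g gtilde
             + C_correction mu phi beta a g)%E,
        forall h : Z -> R, measurable_fun setT h ->
          (forall g, Gplus_at mu phi a g ->
             H_functional mu beta g
             = (J_value mu phi beta a + bregman_distance mu beta g h
                + C_correction mu phi beta a g)%E) ->
          h = gtilde %[ae mu] &
        effective_dual_solution mu phi beta (face_of mu phi a) a gtilde].
Proof.
have [g0 [g0a g0fin g0i]] := base_point mphi hbeta hJ.
have [fF rF] : is_face (phi_cone mu phi) (face_of mu phi a) /\ relint (face_of mu phi a) a.
  apply: (xgetPex set0 (face_exists (@phi_cone_cvx _ _ _ mu _ phi) _)).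
  by case: g0a => Gg0 mg0; exists g0.
(* An opaque name for the face, so that its definition by choice is not unfolded. *)
have [F FE] : exists F, face_of mu phi a = F by eexists.
rewrite FE in fF rF hTheta *; have [vt0 tvt0] := hTheta.
have Jj : J_value mu phi beta a = (fine (J_value mu phi beta a))%:E by rewrite fineK.
have [vt dvt _] := dual_exists mphi hbeta fF rF Jj g0a g0fin g0i.
have dT v : dual_solution mu phi beta F a v -> Theta mu phi beta F v.
  by move=> dv; exact: (dual_Theta mphi hbeta fF rF Jj g0a g0fin g0i dv tvt0).
have tvt := dT _ dvt.
(* Independence of the dual solution makes the set in [C_correction] a singleton, so that the
   default value is not taken. *)
have CE g : Gplus_at mu phi a g -> C_correction mu phi beta a g = D_correction mu phi beta F vt g.
  move=> ga; rewrite /C_correction FE.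
  have ex : [set c |
    (exists v, Theta mu phi beta F v /\ dual_solution mu phi beta F a v) /\
    (forall v, Theta mu phi beta F v -> dual_solution mu phi beta F a v ->
       D_correction mu phi beta F v g = c)] (D_correction mu phi beta F vt g).
    split; first by exists vt.
    move=> v tv dv.
    exact: (D_correction_unique mphi hbeta fF rF Jj g0a g0fin g0i dv tv dvt tvt ga).
  by have [_ H] := xgetPex -oo%E (ex_intro _ _ ex); rewrite (H vt).
exists (f_dual phi beta F vt); split.
- exact: measurable_f_dual.
- move=> g ga; rewrite CE// Jj.
  exact: (pythagorean_identity mphi hbeta fF rF Jj g0a g0fin g0i dvt tvt ga).
- move=> h mh Hh; apply: (bregman_unique mphi hbeta fF rF Jj g0a g0fin g0i dvt tvt mh) => g ga.
  exists (D_correction mu phi beta F vt g); first exact: (D_correction_ge0 mphi hbeta tvt ga).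
  by rewrite Hh// CE// -Jj.
- split; first by exists vt.
  move=> v dv; split; first exact: dT.
  exact: (f_dual_unique mphi hbeta fF rF Jj g0a g0fin g0i dvt tvt dv (dT _ dv)).
Qed.
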